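(* For any fixed $r,s,t$, there is an algorithm that, given $n$, $a$, an $r\times t$ matrix $A_1$ and an $s\times t$ matrix $A_2$ with all entries bounded by $a$ in absolute value, vectors $\mathbf{b},\mathbf{l},\mathbf{u}$, and a separable convex function $f:\mathbb{R}^{nt}\to\mathbb{R}$ presented by a comparison oracle, solves the problem $$\min\{f(\mathbf{x}) : A^{(n)}\mathbf{x}=\mathbf{b},\ \mathbf{l}\le\mathbf{x}\le\mathbf{u},\ \mathbf{x}\in\mathbb{Z}^{nt}\}$$ in time $O(a^{3t(rs+st+r+s)} n^3 L)$.
   Context: $A^{(n)}$ is the $(r+ns)\times nt$ matrix whose first block row consists of $n$ copies of $A_1$ side by side, followed by $n$ block rows where the $k$-th has $A_2$ in the $k$-th block column and zeros elsewhere. A function $f$ is separable convex if $f(\mathbf{x})=\sum_i f_i(x_i)$ with each $f_i$ univariate convex. A comparison oracle, queried on $\mathbf{x},\mathbf{y}$, answers whether $f(\mathbf{x})\le f(\mathbf{y})$. $L$ is the total binary encoding length of $a,\mathbf{b},\mathbf{l},\mathbf{u}$ (and the objective data). Time counts arithmetic operations and oracle queries. *)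

(* Defs.v *)
From HB Require Import structures.
From mathcomp Require Import all_boot all_order all_algebra.
From mathcomp Require Import all_classical all_reals all_analysis.

Set Implicit Arguments.
Unset Strict Implicit.
Unset Printing Implicit Defensive.

Import Order.TTheory GRing.Theory Num.Theory.
Local Open Scope ring_scope.

(* N-fold integer programs.  The library's \sum_(k < n) t (that is, n * t)   *)
(* is the number of columns of a matrix with n block columns of width t;     *)
(* the entry (j, c) of a block vector has flat index j * t + c.              *)

Definition nfold (r s t n : nat) (A1 : 'M[int]_(r, t)) (A2 : 'M[int]_(s, t)) :
    'M[int]_(r + \sum_(k < n) s, \sum_(k < n) t) :=
  col_mx (\mxrow_(j < n) A1)
         (\mxblock_(k < n, j < n) (if k == j then A2 else 0)).

Definition feasible (m N : nat) (A : 'M[int]_(m, N)) (b : 'cV[int]_m)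
    (l u x : 'cV[int]_N) : Prop :=
  A *m x = b /\ forall i, l i 0 <= x i 0 <= u i 0.

Definition at_point (R : realType) (N : nat) (f : 'cV[R]_N -> R)
  (x : 'cV[int]_N) : R := f (map_mx intr x).

Definition optimal (R : realType) (m N : nat) (A : 'M[int]_(m, N))
    (b : 'cV[int]_m) (l u : 'cV[int]_N) (f : 'cV[R]_N -> R)
    (x : 'cV[int]_N) : Prop :=
  feasible A b l u x /\
  forall y, feasible A b l u y -> at_point f x <= at_point f y.

Definition separable_convex (R : realType) (N : nat) (f : 'cV[R]_N -> R) :
    Prop :=
  exists g : 'I_N -> R -> R,
    (forall i, @convex_function R R^o setT (g i)) /\
    (forall x, f x = \sum_i g i (x i 0)).

Definition comparison_oracle (R : realType) (N : nat) (f : 'cV[R]_N -> R) :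
    rel 'cV[int]_N := fun x y => at_point f x <= at_point f y.

(* One sign bit, followed by the ceil(log2(|z| + 1)) binary digits of |z|. *)
Definition bitlen (z : int) : nat := (up_log 2 `|z|.+1).+1.

Definition vec_bitlen (m : nat) (v : 'cV[int]_m) : nat :=
  (\sum_i bitlen (v i 0%R))%N.

Definition input_bitlen (m N : nat) (a : nat) (b : 'cV[int]_m)
    (l u : 'cV[int]_N) : nat :=
  (bitlen a%:Z + vec_bitlen b + vec_bitlen l + vec_bitlen u)%N.

(* The model of computation: programs of a while language over unbounded     *)
(* integers, with integer variables, one-dimensional integer arrays (both    *)
(* named by natural numbers that are constants of the program) and a         *)
(* comparison oracle.  A program is a finite object, so that one program     *)
(* serves all input sizes.                                                   *)

Inductive binop := OpAdd | OpSub | OpMul | OpDiv | OpLe.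

Inductive expr :=
  | Cst of int
  | Var of nat
  | Get of nat & expr
  | Bin of binop & expr & expr.

(* A test (in If and While) is an expression, false when its value is 0.     *)
(* Query v p q compares the vectors held by the arrays p and q.              *)
Inductive cmd :=
  | Skip
  | Assign of nat & expr
  | Put of nat & expr & expr
  | Query of nat & nat & nat
  | Seq of cmd & cmd
  | If of expr & cmd & cmd
  | While of expr & cmd.

Record state := State { vars : nat -> int; arrs : nat -> int -> int }.

Definition set_var (x : nat) (v : int) (st : state) : state :=
  State (fun y => if y == x then v else vars st y) (arrs st).

Definition set_cell (p : nat) (i v : int) (st : state) : state :=
  State (vars st)
    (fun q j => if (q == p) && (j == i) then v else arrs st q j).

Definition vec_of (N : nat) (st : state) (p : nat) : 'cV[int]_N :=
  \col_(i < N) arrs st p i%:Z.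

(* divz is Euclidean division: nonnegative remainder, and x %/ 0 = 0.        *)
Definition binop_sem (o : binop) (x y : int) : int :=
  match o with
  | OpAdd => x + y
  | OpSub => x - y
  | OpMul => x * y
  | OpDiv => (x %/ y)%Z
  | OpLe => ((x <= y)%R : nat)%:Z
  end.

Fixpoint value (st : state) (e : expr) : int :=
  match e with
  | Cst z => z
  | Var x => vars st x
  | Get p e1 => arrs st p (value st e1)
  | Bin o e1 e2 => binop_sem o (value st e1) (value st e2)
  end.

(* Besides arithmetic operations, reading a constant, variable or array cell *)
(* is also charged one unit.                                                 *)
Fixpoint expr_cost (e : expr) : nat :=
  match e with
  | Cst _ => 1
  | Var _ => 1
  | Get _ e1 => (expr_cost e1).+1
  | Bin _ e1 e2 => (expr_cost e1 + expr_cost e2).+1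
  end.

(* exec cmp c st T st': run from st with oracle cmp, the command c halts in  *)
(* st' after time T.                                                         *)
Inductive exec (N : nat) (cmp : rel 'cV[int]_N) :
    cmd -> state -> nat -> state -> Prop :=
  | ExecSkip st : exec cmp Skip st 1 st
  | ExecAssign x e st :
      exec cmp (Assign x e) st (expr_cost e).+1 (set_var x (value st e) st)
  | ExecPut p e1 e2 st :
      exec cmp (Put p e1 e2) st (expr_cost e1 + expr_cost e2).+1
        (set_cell p (value st e1) (value st e2) st)
  | ExecQuery x p q st :
      exec cmp (Query x p q) st 1
        (set_var x (cmp (vec_of N st p) (vec_of N st q))%:Z st)
  | ExecSeq c1 c2 st1 st2 st3 T1 T2 :
      exec cmp c1 st1 T1 st2 -> exec cmp c2 st2 T2 st3 ->
      exec cmp (Seq c1 c2) st1 (T1 + T2) st3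
  | ExecIfTrue e c1 c2 st st' T :
      value st e != 0 -> exec cmp c1 st T st' ->
      exec cmp (If e c1 c2) st (expr_cost e + T).+1 st'
  | ExecIfFalse e c1 c2 st st' T :
      value st e = 0 -> exec cmp c2 st T st' ->
      exec cmp (If e c1 c2) st (expr_cost e + T).+1 st'
  | ExecWhileTrue e c st1 st2 st3 T1 T2 :
      value st1 e != 0 -> exec cmp c st1 T1 st2 ->
      exec cmp (While e c) st2 T2 st3 ->
      exec cmp (While e c) st1 (expr_cost e + T1 + T2).+1 st3
  | ExecWhileFalse e c st :
      value st e = 0 -> exec cmp (While e c) st (expr_cost e).+1 st.

(* Input conventions: variables 0 and 1 hold n and a; arrays 0 to 4 hold A1, *)
(* A2, b, l, u (matrices row by row); everything else is 0.                  *)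

Definition row_major (m n : nat) (A : 'M[int]_(m, n)) : seq int :=
  [seq A i j | i <- enum 'I_m, j <- enum 'I_n].

Definition arr_of_seq (e : seq int) (z : int) : int :=
  if z is Posz k then nth 0 e k else 0.

Definition init_state (r s t n a : nat)
    (A1 : 'M[int]_(r, t)) (A2 : 'M[int]_(s, t))
    (b : 'cV[int]_(r + \sum_(k < n) s)) (l u : 'cV[int]_(\sum_(k < n) t)) :
    state :=
  State (fun x => nth 0 [:: n%:Z; a%:Z] x)
        (fun p => arr_of_seq
           (nth [::] [:: row_major A1; row_major A2; row_major b;
                         row_major l; row_major u] p)).

(* Output conventions: variable 0 holds 1 and array 5 an optimal solution,   *)
(* or variable 0 holds 0 and there is no feasible point.  As the box [l, u]  *)
(* is finite, the problem is never unbounded.                                *)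
Definition solves (R : realType) (m N : nat) (A : 'M[int]_(m, N))
    (b : 'cV[int]_m) (l u : 'cV[int]_N) (f : 'cV[R]_N -> R) (st : state) :
    Prop :=
  (vars st 0%N = 1 /\ optimal A b l u f (vec_of N st 5)) \/
  (vars st 0%N = 0 /\ forall x, ~ feasible A b l u x).

(* Main.v *)
Require Import Defs.
From HB Require Import structures.
From mathcomp Require Import all_boot all_order all_algebra.
From mathcomp Require Import all_classical all_reals all_analysis.
From mathcomp Require Import fintype finset zify ring lra.

Set Implicit Arguments.
Unset Strict Implicit.
Unset Printing Implicit Defensive.

Import Order.TTheory GRing.Theory Num.Theory.
Local Open Scope ring_scope.

(* Let V(x) be a large multiple of the violation of the box plus the l1      *)
(* norm of b - A x.  The program minimizes (V, f) lexicographically over all *)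
(* integer vectors; the problem is feasible iff the minimum has V = 0.       *)
(* Along the steps g = 2^p, ..., 2, 1 it keeps a point x that is optimal on  *)
(* x + g Z^N.  To pass from 2 g to g the coordinates are released one at a   *)
(* time: x is optimal among the x + g z with z_q even for q >= k, and one    *)
(* looks for an optimum when z_k may be odd too.  Given such a z, cut it     *)
(* together with the row slacks A z into units, and use the Steinitz lemma,  *)
(* first inside the bricks and then across them, to partition the units into *)
(* blocks of bounded size that lie in the kernel of [A | -I].  A block       *)
(* without the odd unit of z_k is a step that does not improve x, so by      *)
(* convexity removing it from x + g z does no harm.  Hence some optimum has  *)
(* |z|_1 <= K = O(a^(r s + r + s)), and it is found by a dynamic program     *)
(* over the bricks whose states are the partial sums of the bricks of z in   *)
(* [-K, K]^t.  A comparison of two candidates takes time O(n), so a release  *)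
(* takes time O(n^2 K^(2 t)), and there are n t releases for each of the     *)
(* O(L) steps g.                                                             *)

(** * The Steinitz lemma and zero-sum blocks *)


(** Three facts, all with constants independent of [n], carry the theorem.

    Long steps split. An integer vector together with its row slacks lies in the kernel of an N-fold
    matrix with slack columns. [zero_sum_blocks], a pigeonhole consequence of the Steinitz lemma, is
    applied in dimension [s] inside the bricks and in dimension [r] to the blocks so obtained
    ([nfold_blocks]). If the vector is long, some nonzero piece lies between 0 and the vector in
    every coordinate and every row, and parities can be respected up to one unit
    ([conformal_split]). The threshold is [O(a^(r s + r + s))] by [split_bound_le].

    Conformal pieces can be exchanged. For separable convex functions of coordinates and rows, a
    piece that does not improve [x] can be removed from any competitor of [x] without loss
    ([lex_le_convex]). Repeated removal gives [proximity]: when one more coordinate may take odd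
    multiples of the step, an optimum lies within bounded l1 distance.

    Short steps can be searched. The shared rows see only the sum of the bricks, so Bellman's
    principle ([lex_le_bump], [table_le]) applies with that sum as state, and [released_step] shows
    that the table yields the new optimum.

    The scaling starts from [released_init], where the step is so large that 0 is optimal, passes
    from one scale to the next by [opt_halve], and ends with [opt_global]. Feasibility is read off
    the minimal energy by [feasible_energy]. One release costs [O(n^2 S^2)] with [S = (2K+1)^t]
    states, and there are [n t] releases at each of the [O(L)] scales; [S^2] contributes the power
    [2t(rs+r+s)] of [a], which is below the power claimed. *)

Definition fractional (F : realFieldType) (I : finType) (lam : I -> F) :
  {set I} := [set i | 0 < lam i < 1].

Lemma dependent_support (F : fieldType) (I : finType) (D : nat)
    (w : I -> 'rV[F]_D) (X : {set I}) :
  (D < #|X|)%N ->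
  exists c : I -> F, [/\ \sum_i c i *: w i = 0,
    (forall i, i \notin X -> c i = 0) & exists2 i, i \in X & c i != 0].
Proof.
move=> ltDX.
pose W : 'M[F]_(#|X|, D) := \matrix_(k < #|X|) w (enum_val k).
have ker_neq0 : kermx W != 0.
  rewrite -mxrank_eq0 mxrank_ker subn_eq0 -ltnNge.
  exact: leq_ltn_trans (rank_leq_col W) ltDX.
have [u uker u_neq0] : exists2 u : 'rV[F]_#|X|, u *m W = 0 & u != 0.
  have /rowV0Pn[u /sub_kermxP uW u0] := ker_neq0.
  by exists u.
have [k uk] : exists k, u 0 k != 0.
  apply/existsP; apply: contraNT u_neq0 => /existsPn H.
  by apply/eqP/rowP => k; rewrite mxE; apply/eqP; move: (H k); rewrite negbK.
pose c i := \sum_(j | enum_val j == i) u 0 j.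
have c_val j : c (enum_val j) = u 0 j.
  by rewrite /c (big_pred1 j) // => k'; rewrite (inj_eq enum_val_inj).
have c_out i : i \notin X -> c i = 0.
  move=> niX; rewrite /c big_pred0 // => j.
  by apply: contraNF niX => /eqP <-; apply: enum_valP.
exists c; split=> //.
- rewrite (bigID (mem X)) /= [X in _ + X]big1 ?addr0; last first.
    by move=> i /c_out ->; rewrite scale0r.
  rewrite big_enum_val /=; transitivity (u *m W) => //.
  rewrite mulmx_sum_row; apply: eq_bigr => j _.
  by rewrite c_val rowK.
- by exists (enum_val k); rewrite ?enum_valP // c_val.
Qed.

(** The vertex argument of linear programming: while more than [D] weights are fractional, their
    vectors are dependent. Moving along the dependency keeps the weighted sum, and the first weight
    to reach 0 or 1 leaves the fractional set. Weights equal to 0 or 1 never move. *)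
Lemma reduce_fractional (F : realFieldType) (I : finType) (D : nat)
    (w : I -> 'rV[F]_D) (lam : I -> F) :
  (forall i, 0 <= lam i <= 1) ->
  exists mu : I -> F, [/\ forall i, 0 <= mu i <= 1,
    \sum_i mu i *: w i = \sum_i lam i *: w i,
    forall i, lam i = 0 -> mu i = 0 & (#|fractional mu| <= D)%N].
Proof.
have [m] := ubnP #|fractional lam|.
elim: m lam => // m IHm lam; rewrite ltnS => le_m lam01.
have [leD | ltD] := leqP #|fractional lam| D; first by exists lam.
have [c [cw cX [i0 Xi0 ci0]]] := dependent_support w ltD.
(* The largest step along [c] that stays in the cube. *)
pose lim i := if 0 < c i then (1 - lam i) / c i else lam i / - c i.
pose P := [pred i | (i \in fractional lam) && (c i != 0)].
have Pi0 : P i0 by rewrite /= Xi0.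
case: (@Order.TotalTheory.arg_minP _ F I i0 P lim Pi0) => j /andP[Xj cj] minj.
pose mu i := lam i + lim j * c i.
have lim_ge0 : 0 <= lim j.
  have /andP[lj0 lj1] := lam01 j; rewrite /lim; case: ltP => cj0.
    by rewrite divr_ge0 ?subr_ge0 // ltW.
  by rewrite divr_ge0 // oppr_ge0.
have mu0 i : lam i = 0 -> mu i = 0.
  by move=> li0; rewrite /mu li0 cX ?mulr0 ?addr0 // inE li0 ltxx.
have mu1 i : lam i = 1 -> mu i = 1.
  by move=> li1; rewrite /mu li1 cX ?mulr0 ?addr0 // inE li1 ltxx andbF.
have mu01 i : 0 <= mu i <= 1.
  have /andP[li0 li1] := lam01 i.
  have [ci0'|ci_neq0] := eqVneq (c i) 0.
    by rewrite /mu ci0' mulr0 addr0 lam01.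
  have Xi : i \in fractional lam by apply: contraNT ci_neq0 => /cX ->.
  have /minj : P i by rewrite /= Xi.
  rewrite {2}/lim /mu; case: ltgtP ci_neq0 => // ci0' _.
    rewrite ler_pdivlMr // => le_lim.
    have := mulr_ge0 lim_ge0 (ltW ci0'); lra.
  rewrite ler_pdivlMr ?oppr_gt0 // => le_lim.
  have : 0 <= lim j * - c i by rewrite mulr_ge0 ?oppr_ge0 // ltW.
  lra.
have muj : j \notin fractional mu.
  rewrite inE /mu /lim; case: (ltP 0 (c j)) => cj0.
    by rewrite divfK // addrC subrK ltxx andbF.
  by rewrite invrN mulrN mulNr divfK // subrr ltxx.
have lt_frac : (#|fractional mu| < m)%N.
  apply: leq_trans le_m; apply: proper_card; apply/properP; split.
    apply/subsetP => i; rewrite !inE; have /andP[li0 li1] := lam01 i.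
    move=> mui; rewrite !lt_neqAle li0 li1 !andbT.
    apply/andP; split; apply: contraTneq mui.
      by move=> /esym /mu0 ->; rewrite ltxx.
    by move=> /mu1 ->; rewrite ltxx andbF.
  by exists j.
have [nu [nu01 nuw nu0 nuD]] := IHm mu lt_frac mu01.
exists nu; split=> //; last by move=> i /mu0 /nu0.
rewrite nuw; under eq_bigr do rewrite /mu scalerDl -scalerA.
by rewrite big_split /= -scaler_sumr cw scaler0 addr0.
Qed.

Definition sup_bounded (d : nat) (B : nat) (x : 'I_d -> int) : Prop :=
  forall c, `|x c| <= B%:Z.

Section Steinitz.
Variables (I : finType) (d B : nat) (v : I -> 'I_d -> int).
Hypothesis v_le : forall i, sup_bounded B (v i).

(* The invariant of Grinberg and Sevast'yanov's proof of the Steinitz lemma. *)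
Definition balanced (k : nat) (A : {set I}) : Prop :=
  exists lam : I -> rat, [/\ forall i, 0 <= lam i <= 1,
    forall i, i \notin A -> lam i = 0,
    forall c, \sum_i lam i * (v i c)%:~R = 0 &
    \sum_i lam i = (k - d)%N%:R].

(** The vectors weighted by [lam] cancel, so the sum over [A] is also the sum with weights
    [1 - lam]. These are nonnegative with total [k - (k - d) = d]. *)
Lemma balanced_bounded k (A : {set I}) :
  (d <= k)%N -> #|A| = k -> balanced k A ->
  sup_bounded (d * B) (fun c => \sum_(i in A) v i c).
Proof.
move=> dk Ak [lam [lam01 lam0 lamv lam1]] c.
have -> : `|\sum_(i in A) v i c| <= (d * B)%:Z =
    (`|\sum_(i in A) (v i c)%:~R| <= (d * B)%:R :> rat).
  rewrite -rmorph_sum /= -intr_norm.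
  by rewrite (_ : (d * B)%:R = (d * B)%:Z%:~R) // ler_int.
have -> : \sum_(i in A) (v i c)%:~R = \sum_(i in A) (1 - lam i) * (v i c)%:~R :> rat.
  under [RHS]eq_bigr do rewrite mulrBl mul1r.
  rewrite sumrB [X in _ - X](_ : _ = 0) ?subr0 //.
  rewrite -[RHS](lamv c) [RHS](bigID (mem A)) /= [X in _ = _ + X]big1 ?addr0 //.
  by move=> i /lam0 ->; rewrite mul0r.
apply: le_trans (ler_norm_sum _ _ _) _.
apply: le_trans (_ : \sum_(i in A) (1 - lam i) * B%:R <= _).
  apply: ler_sum => i _; have /andP[l0 l1] := lam01 i.
  rewrite normrM ger0_norm ?subr_ge0 // ler_wpM2l ?subr_ge0 //.
  rewrite -intr_norm (_ : B%:R = B%:Z%:~R) // ler_int; exact: v_le.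
rewrite -mulr_suml sumrB sumr_const Ak.
have -> : \sum_(i in A) lam i = (k - d)%N%:R.
  rewrite -lam1 [RHS](bigID (mem A)) /= [X in _ = _ + X]big1 ?addr0 //.
by rewrite natrB // opprB addrC subrK natrM.
Qed.

Lemma balanced_shrink k (A : {set I}) :
  (d <= k)%N -> #|A| = k.+1 -> balanced k.+1 A ->
  exists2 i, i \in A & balanced k (A :\ i).
Proof.
move=> dk Ak [lam [lam01 lam0 lamv lam1]].
(* The coordinate [ord0] is constantly 1, so keeping the weighted sum of [w] also keeps the total
   weight. The factor [q] below lowers that total to [k - d]. *)
pose w i : 'rV[rat]_d.+1 :=
  \row_j (if unlift ord0 j is Some c then (v i c)%:~R else 1).
pose q : rat := (k - d)%N%:R / (k.+1 - d)%N%:R.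
have q01 : 0 <= q <= 1.
  rewrite divr_ge0 ?ler0n //= ler_pdivrMr ?mul1r ?ler_nat ?ltr0n; lia.
have qlam01 i : 0 <= q * lam i <= 1.
  have /andP[q0 q1] := q01; have /andP[l0 l1] := lam01 i.
  by rewrite mulr_ge0 //= mulr_ile1.
have [mu [mu01 muw mu0 muF]] := reduce_fractional w qlam01.
have muA i : i \notin A -> mu i = 0 by move=> /lam0 li; rewrite mu0 // li mulr0.
have muv c : \sum_i mu i * (v i c)%:~R = 0.
  move/rowP/(_ (lift ord0 c)): muw; rewrite !summxE.
  under eq_bigr do rewrite !mxE liftK.
  move=> ->; under eq_bigr do rewrite !mxE liftK -mulrA.
  by rewrite -mulr_sumr lamv mulr0.
have mu1 : \sum_i mu i = (k - d)%N%:R.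
  move/rowP/(_ ord0): muw; rewrite !summxE.
  under eq_bigr do rewrite !mxE unlift_none mulr1.
  move=> ->; under eq_bigr do rewrite !mxE unlift_none mulr1.
  rewrite -mulr_sumr lam1 /q divfK // pnatr_eq0; lia.
(* At most [d.+1] weights are fractional. If none on [A] were 0, at least [k - d] would equal 1, and
   any fractional weight would push the total above [k - d]; with no fractional weight the total
   would be [k.+1]. *)
have [i Ai mui] : exists2 i, i \in A & mu i = 0.
  suff /exists_inP[i Ai /eqP mui] : [exists i in A, mu i == 0] by exists i.
  apply: contraT => /exists_inPn nz; exfalso.
  have mu_gt0 i : i \in A -> 0 < mu i.
    by move=> /nz mui; rewrite lt_neqAle eq_sym mui; case/andP: (mu01 i).
  have FA : fractional mu \subset A.
    by apply/subsetP => i; rewrite inE; apply: contraTT => /muA ->; rewrite ltxx.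
  have sumA : \sum_i mu i = \sum_(i in A) mu i.
    by rewrite (bigID (mem A)) /= [X in _ + X]big1 ?addr0.
  have sum1 : \sum_(i in A :\: fractional mu) mu i = (k.+1 - #|fractional mu|)%N%:R.
    rewrite -Ak -(cardsDS FA) -sumr_const; apply: eq_bigr => i.
    rewrite !inE => /andP[+ Ai]; rewrite mu_gt0 //= -leNgt => mui.
    by apply/eqP; rewrite eq_le mui; case/andP: (mu01 i) => _ ->.
  have sumF : \sum_i mu i = (k.+1 - #|fractional mu|)%N%:R + \sum_(i in fractional mu) mu i.
    rewrite sumA -sum1 (big_setID (fractional mu)) /= addrC.
    by rewrite (setIidPr FA).
  have [F0|/set0Pn[i Fi]] := eqVneq (fractional mu) set0.
    move: sumF; rewrite mu1 F0 cards0 big_set0 addr0 => /eqP.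
    rewrite eqr_nat; lia.
  have : 0 < \sum_(i in fractional mu) mu i.
    rewrite (bigD1 i) //= ltr_pwDl //; first by rewrite mu_gt0 // (subsetP FA).
    by apply: sumr_ge0 => j _; case/andP: (mu01 j).
  have : (k - d)%N%:R <= (k.+1 - #|fractional mu|)%N%:R :> rat.
    by rewrite ler_nat; lia.
  move: sumF; rewrite mu1; lra.
exists i => //; exists mu; split=> // j; rewrite !inE negb_and negbK.
by case/orP=> [/eqP -> //|/muA].
Qed.

(** The Steinitz lemma in terms of sets: read from the smallest set upwards, the chain orders the
    vectors so that the partial sums stay in a box depending on [d] and [B] only. *)
Lemma balanced_chain j :
  (forall c, \sum_i v i c = 0) -> (j + d <= #|I|)%N ->
  exists p : seq {set I}, [/\ size p = j.+1,
    sorted (fun X Y : {set I} => X \proper Y) p,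
    #|head set0 p| = (#|I| - j)%N, balanced (#|I| - j) (head set0 p) &
    forall X, X \in p -> (d <= #|X|)%N /\ sup_bounded (d * B) (fun c => \sum_(i in X) v i c)].
Proof.
move=> v0; elim: j => [|j IHj] le_j.
  have bal : balanced #|I| [set: I].
    have [I0|I_gt0] := posnP #|I|.
      exists (fun=> 0); split=> //.
        by move=> c; rewrite big1 // => i _; rewrite mul0r.
      by rewrite big1 // (_ : #|I| - d = 0)%N //; lia.
    pose q : rat := (#|I| - d)%N%:R / #|I|%:R.
    exists (fun=> q); split=> // [i|i|c|]; rewrite ?inE //.
    + rewrite divr_ge0 ?ler0n //= ler_pdivrMr ?mul1r ?ler_nat ?ltr0n; lia.
    + by rewrite -mulr_sumr -rmorph_sum v0 mulr0.
    + by rewrite sumr_const -[q *+ _]mulr_natr /q divfK // pnatr_eq0; lia.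
  exists [:: [set: I]]; rewrite /= cardsT subn0; split=> // X.
  rewrite inE => /eqP ->; rewrite cardsT; split=> //.
  by apply: balanced_bounded bal; rewrite ?cardsT.
have [|p [szp sp hp bp Xp]] := IHj; first lia.
case: p szp sp hp bp Xp => // X p /= szp sp hp bp Xp.
have Ik : (#|I| - j = (#|I| - j.+1).+1)%N by lia.
rewrite Ik in hp bp; have [|i Xi bal] := balanced_shrink _ hp bp; first lia.
have cXi : #|X :\ i| = (#|I| - j.+1)%N by move: hp; rewrite (cardsD1 i) Xi => -[].
exists (X :\ i :: X :: p); split=> //=; first by rewrite szp.
  by rewrite sp properD1.
move=> Y; rewrite inE => /orP[/eqP ->|/Xp //].
rewrite cXi; split; first lia.
by apply: balanced_bounded bal => //; lia.
Qed.

(** Pigeonhole: the chain has [#|I| - d + 1] sets and their sums take at most [(2 * (d * B)).+1 ^ d]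
    values. Two nested sets thus have the same sum, and their difference sums to zero. *)
Lemma zero_sum_set :
  (0 < d)%N -> (forall c, \sum_i v i c = 0) ->
  ((2 * (d * B)).+1 ^ d + d <= #|I|)%N ->
  exists A : {set I}, [/\ A != set0, A != setT & forall c, \sum_(i in A) v i c = 0].
Proof.
move=> d_gt0 v0 le_I.
have [|p [szp sp _ _ Xp]] := @balanced_chain (#|I| - d) v0; first lia.
pose code (X : {set I}) : {ffun 'I_d -> 'I_(2 * (d * B)).+1} :=
  [ffun c => inord `|(\sum_(i in X) v i c + (d * B)%:Z)%R|%N].
have code_inj X Y : X \in p -> Y \in p -> code X = code Y ->
    forall c, \sum_(i in X) v i c = \sum_(i in Y) v i c.
  move=> /Xp[_ bX] /Xp[_ bY] /ffunP eXY c; have := bX c; have := bY c.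
  move: (eXY c); rewrite !ffunE => /(congr1 val); rewrite !val_insubd.
  move: (\sum_(i in X) _) (\sum_(i in Y) _) => x y.
  by case: ifP; case: ifP; lia.
have : ~~ uniq (map code p).
  apply/negP => /card_uniqP; rewrite size_map szp => cp.
  have := max_card (mem (map code p)); rewrite cp card_ffun !card_ord; lia.
move=> /(uniqPn (code set0)) [i [j [ij]]]; rewrite size_map => jp.
rewrite !(nth_map set0) //; last exact: ltn_trans jp.
have pi : nth set0 p i \in p by rewrite mem_nth //; apply: ltn_trans jp.
have pj : nth set0 p j \in p by rewrite mem_nth.
move=> /(code_inj _ _ pi pj) eqv.
have tr : transitive (fun X Y : {set I} => X \proper Y).
  by move=> Y X Z; apply: proper_trans.
have := sorted_ltn_nth tr set0 sp i j (ltn_trans ij jp) jp ij.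
move: (nth set0 p i) (nth set0 p j) pi pj eqv => X Y /Xp[dX _] _ eqv.
move=> /properP[XY [i1 Yi1 nXi1]].
exists (Y :\: X); split.
- by apply/set0Pn; exists i1; rewrite inE nXi1.
(* The chain stops at size [d > 0], so the smaller set is nonempty and the difference is not
   everything. *)
- have /card_gt0P[i2 Xi2] : (0 < #|X|)%N by lia.
  by apply/eqP => /setP /(_ i2); rewrite !inE Xi2.
- move=> c; have := eqv c; rewrite [RHS](big_setID X) /= (setIidPr XY).
  by rewrite -[LHS]addr0 => /addrI <-.
Qed.

End Steinitz.

(** A sequence that is too long has a proper nonempty zero-sum part. The complement then sums to
    zero too, and both are split further. *)
Lemma zero_sum_blocks (T : eqType) (d B : nat) (v : T -> 'I_d -> int)
    (s : seq T) :
  (0 < d)%N -> (forall x, x \in s -> sup_bounded B (v x)) ->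
  (forall c, \sum_(x <- s) v x c = 0) ->
  exists ss : seq (seq T), [/\ perm_eq (flatten ss) s,
    forall b, b \in ss -> (size b <= (2 * (d * B)).+1 ^ d + d)%N &
    forall b, b \in ss -> forall c, \sum_(x <- b) v x c = 0].
Proof.
move=> d_gt0; have [m] := ubnP (size s).
elim: m s => // m IHm s; rewrite ltnS => le_m v_le v0.
have [le_s|lt_s] := leqP (size s) ((2 * (d * B)).+1 ^ d + d).
  exists [:: s]; split=> /= [|b|b]; first by rewrite cats0.
    by rewrite inE => /eqP ->.
  by rewrite inE => /eqP ->.
have w_le i : sup_bounded B (v (tnth (in_tuple s) i)).
  by apply: v_le; apply: mem_tnth.
have [||A [A0 AT Av]] := zero_sum_set w_le d_gt0.
- by move=> c; rewrite -[RHS](v0 c) [RHS](big_tnth _ _ s).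
- by rewrite card_ord ltnW.
(* Parts are sets of positions, since [s] may contain the same value several times. *)
pose sub (X : {set 'I_(size s)}) := [seq tnth (in_tuple s) i | i <- enum X].
have sub_perm : perm_eq (sub A ++ sub (~: A)) s.
  rewrite /sub -map_cat -[X in perm_eq _ X](map_tnth_enum (in_tuple s)).
  apply: perm_map; apply: uniq_perm; rewrite ?enum_uniq //.
    rewrite cat_uniq !enum_uniq andbT /=; apply/hasPn => i.
    by rewrite !mem_enum inE.
  by move=> i; rewrite mem_cat !mem_enum !inE orbN.
have sub_size X : size (sub X) = #|X| by rewrite size_map -cardE.
have sub_sum X c : \sum_(x <- sub X) v x c = \sum_(i in X) v (tnth (in_tuple s) i) c.
  by rewrite big_map big_enum.
have cAC := cardsC A; rewrite card_ord in cAC.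
have A_gt0 : (0 < #|A|)%N by rewrite card_gt0.
have C_gt0 : (0 < #|~: A|)%N.
  rewrite card_gt0; apply: contraNneq AT => AC.
  by rewrite -[A]setCK AC setC0.
have ltA : (#|A| < size s)%N.
  by rewrite -[X in (_ < X)%N]cAC -[X in (X < _)%N]addn0 ltn_add2l.
have ltC : (#|~: A| < size s)%N.
  by rewrite -[X in (_ < X)%N]cAC -[X in (X < _)%N]add0n ltn_add2r.
have subA x : x \in sub A -> x \in s by rewrite -(perm_mem sub_perm) mem_cat => ->.
have subC x : x \in sub (~: A) -> x \in s.
  by rewrite -(perm_mem sub_perm) mem_cat => xC; rewrite xC orbT.
have sumC c : \sum_(x <- sub (~: A)) v x c = 0.
  have := v0 c; rewrite -(perm_big _ sub_perm) big_cat /= sub_sum Av add0r.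
  by [].
have [|||ssA [pA sA zA]] := IHm (sub A).
- by apply: leq_trans le_m; rewrite sub_size.
- by move=> x /subA /v_le.
- by move=> c; rewrite sub_sum Av.
have [|||ssC [pC sC zC]] := IHm (sub (~: A)).
- by apply: leq_trans le_m; rewrite sub_size.
- by move=> x /subC /v_le.
- by move=> c; rewrite sumC.
exists (ssA ++ ssC); split.
- rewrite flatten_cat; apply: perm_trans sub_perm; exact: perm_cat.
- by move=> b; rewrite mem_cat => /orP[/sA|/sC].
- by move=> b; rewrite mem_cat => /orP[/zA|/zC].
Qed.

(** * Decomposing N-fold kernel vectors *)

Definition block_size (d B : nat) : nat := ((2 * (d * B)).+1 ^ d + d)%N.

Section NfoldBlocks.
Variables (T : eqType) (r s B : nat) (brick : T -> nat).
Variables (v1 : T -> 'I_r -> int) (v2 : T -> 'I_s -> int).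
Hypotheses (r_gt0 : (0 < r)%N) (s_gt0 : (0 < s)%N).

(** The sums of [v2] are taken brick by brick, so each brick is split on its own and the block size
    does not depend on [n]. *)
Lemma brick_blocks n (G : seq T) :
  (forall x, x \in G -> (brick x < n)%N) ->
  (forall x, x \in G -> sup_bounded B (v2 x)) ->
  (forall j c, \sum_(x <- G | brick x == j) v2 x c = 0) ->
  exists ss : seq (seq T), [/\ perm_eq (flatten ss) G,
    forall b, b \in ss -> (size b <= block_size s B)%N &
    forall b, b \in ss -> forall j c, \sum_(x <- b | brick x == j) v2 x c = 0].
Proof.
elim: n G => [|n IHn] G brick_lt v2_le v20.
  exists [::]; split=> //; case: G brick_lt {v2_le v20} => // x G.
  by move=> /(_ x); rewrite mem_head => /(_ isT).
pose G1 := [seq x <- G | brick x == n]; pose G2 := [seq x <- G | brick x != n].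
have sub1 x : x \in G1 -> x \in G by rewrite mem_filter => /andP[].
have sub2 x : x \in G2 -> x \in G by rewrite mem_filter => /andP[].
have [|||ss2 [p2 b2 z2]] := IHn G2.
- move=> x; rewrite mem_filter => /andP[xn /brick_lt]; rewrite ltnS leq_eqVlt.
  by rewrite (negPf xn).
- by move=> x /sub2 /v2_le.
- move=> j c; have [->|jn] := eqVneq j n.
    rewrite big1_seq // => x; rewrite mem_filter => /andP[/eqP -> /andP[]].
    by rewrite eqxx.
  rewrite -[RHS](v20 j c) [in RHS](bigID (fun x => brick x == n)) /=.
  rewrite [X in _ = X + _]big1 ?add0r; last first.
    by move=> x /andP[/eqP -> /eqP]; move/eqP: jn.
  by rewrite big_filter_cond; apply: eq_bigl => x; rewrite andbC.
have [||ss1 [p1 b1 z1]] := @zero_sum_blocks T s B v2 G1 s_gt0.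
- by move=> x /sub1 /v2_le.
- by move=> c; rewrite big_filter v20.
exists (ss1 ++ ss2); split.
- rewrite flatten_cat; apply: perm_trans (perm_cat p1 p2) _.
  exact/permEl/perm_filterC.
- by move=> b; rewrite mem_cat => /orP[/b1|/b2].
- move=> b; rewrite mem_cat => /orP[bs j c|/z2 //].
  have brickb x : x \in b -> brick x = n.
    move=> xb; suff : x \in G1 by rewrite mem_filter => /andP[/eqP].
    by rewrite -(perm_mem p1); apply/flattenP; exists b.
  have [->|jn] := eqVneq j n.
    rewrite -[RHS](z1 b bs c) big_seq_cond [RHS]big_seq; apply: eq_bigl => x.
    by case: (boolP (x \in b)) => //= /brickb ->; rewrite eqxx.
  rewrite big_seq_cond big_pred0 // => x.
  by apply/negP => /andP[/brickb -> /eqP njn]; rewrite njn eqxx in jn.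
Qed.

(** A block of at most [block_size s B] items has a [v1]-sum bounded by [block_size s B * B]. This
    is the entry bound for the second partition, in dimension [r], whose items are blocks. *)
Definition nfold_size : nat :=
  (block_size r (block_size s B * B) * block_size s B)%N.

Lemma sum_flatten (V : zmodType) (F : T -> V) (P : pred T) (ss : seq (seq T)) :
  \sum_(x <- flatten ss | P x) F x = \sum_(b <- ss) \sum_(x <- b | P x) F x.
Proof. by rewrite big_flatten. Qed.

Lemma nfold_blocks n (G : seq T) :
  (forall x, x \in G -> (brick x < n)%N) ->
  (forall x, x \in G -> sup_bounded B (v2 x)) ->
  (forall x, x \in G -> sup_bounded B (v1 x)) ->
  (forall j c, \sum_(x <- G | brick x == j) v2 x c = 0) ->
  (forall c, \sum_(x <- G) v1 x c = 0) ->
  exists ss : seq (seq T), [/\ perm_eq (flatten ss) G,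
    forall b, b \in ss -> (size b <= nfold_size)%N,
    forall b, b \in ss -> forall j c, \sum_(x <- b | brick x == j) v2 x c = 0 &
    forall b, b \in ss -> forall c, \sum_(x <- b) v1 x c = 0].
Proof.
move=> brick_lt v2_le v1_le v20 v10.
have [ss [pss bss zss]] := brick_blocks brick_lt v2_le v20.
pose w (b : seq T) c := \sum_(x <- b) v1 x c.
have sub b x : b \in ss -> x \in b -> x \in G.
  by move=> bs xb; rewrite -(perm_mem pss); apply/flattenP; exists b.
have [||sss [psss bsss zsss]] :=
    @zero_sum_blocks _ r (block_size s B * B) w ss r_gt0.
- move=> b bs c; apply: le_trans (ler_norm_sum _ _ _) _.
  apply: le_trans (_ : \sum_(x <- b) B%:Z <= _).
    by rewrite !big_seq; apply: ler_sum => x /(sub _ _ bs) /v1_le.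
  rewrite big_const_seq count_predT iter_addr_0.
  by rewrite -mulr_natl natz -PoszM lez_nat leq_mul2r bss ?orbT.
- by move=> c; rewrite -(sum_flatten (v1^~ c) predT) (perm_big _ pss) v10.
have flatten_flatten : flatten (map flatten sss) = flatten (flatten sss).
  by elim: (sss) => //= b bs ->; rewrite flatten_cat.
have mem_blocks (B' : seq (seq T)) b : B' \in sss -> b \in B' -> b \in ss.
  by move=> Bs bB; rewrite -(perm_mem psss); apply/flattenP; exists B'.
exists (map flatten sss); split.
- by rewrite flatten_flatten; apply: perm_trans pss; apply: perm_flatten.
- move=> _ /mapP[B' Bs ->]; rewrite size_flatten /shape.
  apply: leq_trans (_ : size B' * block_size s B <= _)%N; last first.
    by rewrite leq_mul2r bsss ?orbT.
  rewrite sumnE big_map -sum1_size big_distrl /= !big_seq.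
  by apply: leq_sum => b bB; rewrite mul1n (bss _ (mem_blocks _ _ Bs bB)).
- move=> _ /mapP[B' Bs ->] j c; rewrite sum_flatten big_seq big1 // => b bB.
  exact: zss (mem_blocks _ _ Bs bB) j c.
- by move=> _ /mapP[B' Bs ->] c; rewrite (sum_flatten _ predT); apply: zsss.
Qed.

End NfoldBlocks.

(** * Sign-compatible decompositions into units *)

Definition conformal (h g : int) : bool := (0 <= h <= g) || (g <= h <= 0).

Section Items.
Variable J : seq (nat * nat).
Hypothesis J_uniq : uniq J.

Definition item : eqType := ((nat * nat) * int)%type.

Definition coef (p : nat * nat) (b : seq item) : int :=
  \sum_(x <- b | x.1 == p) x.2.

Lemma sum_items (c : nat * nat -> int) (P : pred (nat * nat)) (b : seq item) :
  (forall x, x \in b -> x.1 \in J) ->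
  \sum_(x <- b | P x.1) c x.1 * x.2 = \sum_(p <- J | P p) c p * coef p b.
Proof.
move=> bJ.
under [RHS]eq_bigr do rewrite /coef big_distrr /=.
rewrite [RHS](exchange_big_dep (fun x => P x.1)) /=; last first.
  by move=> p x Pp /eqP ->.
rewrite big_seq_cond [RHS]big_seq_cond; apply: eq_bigr => x /andP[xb Px].
rewrite big_mkcond (bigD1_seq x.1) ?bJ //= Px eqxx [X in _ + X]big1 ?addr0 //.
by move=> p; rewrite eq_sym => /negPf ->; rewrite andbF.
Qed.

(** The sign condition excludes cancellation between the items of a column. *)
Definition fits (tau : nat * nat -> int) (G : seq item) : Prop :=
  (forall p, p \in J -> coef p G = tau p) /\
  (forall x, x \in G -> x.1 \in J /\ 0 < x.2 * tau x.1).

Lemma fits_flatten tau (U : nat * nat -> seq item) :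
  (forall p x, p \in J -> x \in U p -> x.1 = p /\ 0 < x.2 * tau p) ->
  (forall p, p \in J -> \sum_(x <- U p) x.2 = tau p) ->
  fits tau (flatten [seq U p | p <- J]).
Proof.
move=> Up Us; split=> [p pJ|x /flatten_mapP[p pJ xU]].
  rewrite /coef big_flatten big_map (bigD1_seq p) //= [X in _ + X]big1_seq ?addr0.
    rewrite -[RHS]Us // big_seq_cond [RHS]big_seq; apply: eq_bigl => x.
    by case: (boolP (x \in U p)) => //= /(Up _ _ pJ)[-> _]; rewrite eqxx.
  move=> q /andP[qp qJ]; rewrite big1_seq // => x /andP[xp /(Up _ _ qJ)[xq _]].
  by rewrite -xq xp in qp.
by have [-> ?] := Up p x pJ xU.
Qed.

End Items.

(** A part and its complement contribute to each column with the sign of the target, so the part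
    lies between 0 and the whole. *)
Lemma coef_conformal J tau (G b b' : seq item) p :
  fits J tau G -> perm_eq (b ++ b') G -> p \in J -> conformal (coef p b) (tau p).
Proof.
move=> [cG sG] pG pJ.
have sgn_coef (c : seq item) : (forall x, x \in c -> x \in G) ->
    0 <= coef p c * tau p /\ (tau p = 0 -> coef p c = 0).
  move=> cGx; split=> [|tau0].
    rewrite /coef big_distrl /= big_seq_cond; apply: sumr_ge0 => x.
    by move=> /andP[/cGx /sG[_ /ltW]] + /eqP <-.
  rewrite /coef big1_seq // => x /andP[/eqP xp /cGx /sG[_]].
  by rewrite xp tau0 mulr0 ltxx.
have sub1 x : x \in b -> x \in G by rewrite -(perm_mem pG) mem_cat => ->.
have sub2 x : x \in b' -> x \in G.
  by rewrite -(perm_mem pG) mem_cat => ->; rewrite orbT.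
have := sgn_coef b sub1; have := sgn_coef b' sub2.
have <- : coef p b + coef p b' = tau p by rewrite -cG // /coef -(perm_big _ pG) big_cat.
rewrite /conformal; move: (coef p b) (coef p b') => x y [y0 y00] [x0 x00].
have [xy0|] := eqVneq (x + y) 0; first by rewrite (x00 xy0) (y00 xy0).
nia.
Qed.

(** * Rows of the N-fold matrix and bounded conformal pieces *)

Definition row1 (t : nat) (A1 : nat -> nat -> int) (N : nat) (i : nat)
    (x : nat -> int) : int :=
  \sum_(q < N) A1 i (q %% t)%N * x q.

Definition row2 (s t : nat) (A2 : nat -> nat -> int) (w : nat)
    (x : nat -> int) : int :=
  \sum_(c < t) A2 (w %% s)%N c * x (w %/ s * t + c)%N.

Lemma sum_brick (n t j : nat) (F : nat -> int) :
  (0 < t)%N -> (j < n)%N ->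
  \sum_(0 <= q < n * t | (q %/ t)%N == j) F q = \sum_(c < t) F (j * t + c)%N.
Proof.
move=> t_gt0 jn; rewrite big_mkcond big_nat_mul /=.
rewrite (bigD1_seq j) ?mem_index_iota ?iota_uniq //= [X in _ + X]big1_seq ?addr0.
  rewrite mulSn -{1}[(j * t)%N]add0n big_addn addnK big_mkord.
  apply: eq_bigr => c _.
  by rewrite addnC divnMDl // divn_small // addn0 eqxx.
move=> i /andP[ij _]; rewrite big_nat big1 // => q /andP[iq qi].
suff -> : (q %/ t)%N = i by rewrite (negPf ij).
by apply/eqP; rewrite eqn_leq leq_divRL // iq andbT -ltnS ltn_divLR.
Qed.

Lemma sum_out_brick (N t j : nat) (F : nat -> int) :
  (0 < t)%N -> (N <= j * t)%N ->
  \sum_(0 <= q < N | (q %/ t)%N == j) F q = 0.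
Proof.
move=> t_gt0 Nj; rewrite big_nat_cond big1 // => q /andP[/andP[_ qN] /eqP qj].
by move: qN; rewrite ltnNge (leq_trans Nj) // -qj leq_trunc_div.
Qed.

Section ConformalSplit.
Variables (r s t n k a : nat) (A1 A2 : nat -> nat -> int) (g : nat -> int).
Hypotheses (r_gt0 : (0 < r)%N) (s_gt0 : (0 < s)%N) (t_gt0 : (0 < t)%N).
Hypothesis a_gt0 : (0 < a)%N.
Hypothesis A1_le : forall i c, `|A1 i c| <= a%:Z.
Hypothesis A2_le : forall i c, `|A2 i c| <= a%:Z.

Let N := (n * t)%N.

(* Columns of the matrix extended by slack columns for the rows: (0, q) is   *)
(* the coordinate q, (1, i) the slack of row i of the first block row, and   *)
(* (2, w) the slack of row w among the other rows.                           *)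
Definition columns : seq (nat * nat) :=
  [seq (0, q)%N | q <- index_iota 0 N] ++
  [seq (1, i)%N | i <- index_iota 0 r] ++
  [seq (2, w)%N | w <- index_iota 0 (n * s)].

Definition entry1 (i : nat) (p : nat * nat) : int :=
  match p.1 with
  | 0 => A1 i (p.2 %% t)%N
  | 1 => (p.2 == i)%:Z
  | _ => 0
  end%N.

Definition entry2 (i : nat) (p : nat * nat) : int :=
  match p.1 with
  | 0 => A2 i (p.2 %% t)%N
  | 1 => 0
  | _ => (p.2 %% s == i)%N%:Z
  end%N.

(** The slacks of the shared rows are put into a fictitious brick [n], where [entry2] vanishes on
    them. This is why [nfold_blocks] is used with [n.+1] bricks. *)
Definition brick_of (p : nat * nat) : nat :=
  match p.1 with 0 => (p.2 %/ t)%N | 1 => n | _ => (p.2 %/ s)%N end%N.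

(** The slacks are minus the rows of [g], which puts the extended vector into the kernel of the
    extended matrix. *)
Definition target (p : nat * nat) : int :=
  match p.1 with
  | 0 => g p.2
  | 1 => - row1 t A1 N p.2 g
  | _ => - row2 s t A2 p.2 g
  end%N.

(* At most one unit is odd in a coordinate from k on; a block without it      *)
(* moves all these coordinates by even amounts.                              *)
Definition units (p : nat * nat) : seq item :=
  let z := target p in
  if (p.1 == 0)%N && (k <= p.2)%N then
    nseq (`|z| %/ 2)%N (p, 2 * sgz z) ++ nseq (`|z| %% 2)%N (p, sgz z)
  else nseq `|z|%N (p, sgz z).

Definition odd_unit (x : item) : bool :=
  [&& (x.1.1 == 0)%N, (k <= x.1.2)%N & (`|x.2| == 1)%N].

Lemma columns_uniq : uniq columns.
Proof.
rewrite /columns !cat_uniq !map_inj_uniq ?iota_uniq /=; first last.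
- by move=> x y [].
- by move=> x y [].
- by move=> x y [].
rewrite andbT; apply/andP; split; apply/hasPn => p.
  by rewrite mem_cat => /orP[] /mapP[x _ ->]; apply/mapP => -[].
by move=> /mapP[x _ ->]; apply/mapP => -[].
Qed.

Lemma sum_columns (P : pred (nat * nat)) (F : nat * nat -> int) :
  \sum_(p <- columns | P p) F p =
  \sum_(0 <= q < N | P (0, q)%N) F (0, q)%N +
  (\sum_(0 <= i < r | P (1, i)%N) F (1, i)%N +
   \sum_(0 <= w < n * s | P (2, w)%N) F (2, w)%N).
Proof. by rewrite !big_cat !big_map. Qed.

Lemma mem_columns0 q : ((0, q)%N \in columns) = (q < N)%N.
Proof.
rewrite !mem_cat mem_map => [|x y []//]; rewrite mem_index_iota /=.
rewrite [X in _ || X](_ : _ = false) ?orbF //.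
by apply/negP => /orP[] /mapP[x _].
Qed.

Lemma mem_columns1 i : ((1, i)%N \in columns) = (i < r)%N.
Proof.
rewrite !mem_cat (mem_map (f := pair 1%N)) => [|x y []//]; rewrite mem_index_iota /=.
rewrite [X in X || _](_ : _ = false) /=; last by apply/negP => /mapP[].
by rewrite [X in _ || X](_ : _ = false) ?orbF //; apply/negP => /mapP[].
Qed.

Lemma mem_columns2 w : ((2, w)%N \in columns) = (w < n * s)%N.
Proof.
rewrite !mem_cat (mem_map (f := pair 2%N)) => [|x y []//]; rewrite mem_index_iota /=.
rewrite [X in X || _](_ : _ = false) /=; last by apply/negP => /mapP[].
by rewrite [X in X || _](_ : _ = false) //; apply/negP => /mapP[].
Qed.

Lemma units_spec p x : p \in columns -> x \in units p ->
  [/\ x.1 = p, 0 < x.2 * target p, (`|x.2| <= 2)%N &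
      (p.1 == 0)%N && (k <= p.2)%N -> (`|x.2| == 1)%N -> odd `|target p|].
Proof.
move=> _; rewrite /units; case: ifP => _; last first.
  by move=> /nseqP[-> z_gt0]; split=> //=; move: (target p) z_gt0 => z; lia.
rewrite mem_cat => /orP[] /nseqP[-> z_gt0]; split=> //=;
  move: (target p) z_gt0 => z; lia.
Qed.

Lemma sum_units p : \sum_(x <- units p) x.2 = target p.
Proof.
rewrite /units; case: ifP => _; last first.
  rewrite big_nseq iter_addr_0 /=; move: (target p) => z; lia.
rewrite big_cat !big_nseq !iter_addr_0 /=; move: (target p) => z; lia.
Qed.

Definition all_units : seq item := flatten [seq units p | p <- columns].

Lemma fits_all_units : fits columns target all_units.
Proof.
apply: fits_flatten => [|p x pJ xU|p pJ]; last exact: sum_units.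
  exact: columns_uniq.
by have [? ? _ _] := units_spec pJ xU.
Qed.

Lemma entries1 (b : seq item) i : (forall x, x \in b -> x.1 \in columns) ->
  (i < r)%N ->
  \sum_(x <- b) entry1 i x.1 * x.2 =
  row1 t A1 N i (fun q => coef (0, q)%N b) + coef (1, i)%N b.
Proof.
move=> bJ ir; rewrite (sum_items columns_uniq (entry1 i) predT bJ) sum_columns.
congr (_ + _); first by rewrite big_mkord.
rewrite [X in _ + X]big1_seq ?addr0 => [|w _]; last by rewrite mul0r.
rewrite (bigD1_seq i) ?mem_index_iota ?iota_uniq //= /entry1 /= eqxx mul1r.
by rewrite big1 ?addr0 // => j /negPf ->; rewrite mul0r.
Qed.

Lemma entries2 (b : seq item) w : (forall x, x \in b -> x.1 \in columns) ->
  (w < n * s)%N ->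
  \sum_(x <- b | brick_of x.1 == (w %/ s)%N) entry2 (w %% s)%N x.1 * x.2 =
  row2 s t A2 w (fun q => coef (0, q)%N b) + coef (2, w)%N b.
Proof.
move=> bJ wn; have jn : (w %/ s < n)%N by rewrite ltn_divLR.
rewrite (sum_items columns_uniq _ (fun p => brick_of p == (w %/ s)%N) bJ) sum_columns.
rewrite /brick_of /entry2 /= sum_brick //; congr (_ + _).
  by apply: eq_bigr => c _; rewrite modnMDl (modn_small (ltn_ord c)).
rewrite big1 ?add0r => [|i _]; last by rewrite mul0r.
rewrite sum_brick // (bigD1 (Ordinal (ltn_pmod w s_gt0))) //= [X in _ + X]big1 ?addr0.
  by rewrite modnMDl modn_mod eqxx mul1r -divn_eq.
move=> c; rewrite -val_eqE /= modnMDl (modn_small (ltn_ord c)) // => /negPf ->.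
by rewrite mul0r.
Qed.

Lemma entries2_zero j (c : 'I_s) :
  \sum_(x <- all_units | brick_of x.1 == j) entry2 c x.1 * x.2 = 0.
Proof.
have [coefG sgnG] := fits_all_units.
have GJ x : x \in all_units -> x.1 \in columns by move=> /sgnG[].
have [jn|nj] := ltnP j n.
  have wn : (j * s + c < n * s)%N.
    by rewrite -ltn_divLR // divnMDl // divn_small // addn0.
  have := entries2 GJ wn.
  rewrite divnMDl // divn_small // addn0 modnMDl modn_small // => ->.
  rewrite coefG ?mem_columns2 // /target /=.
  rewrite [row2 _ _ _ _ (fun q => _)](_ : _ = row2 s t A2 (j * s + c) g) ?subrr //.
  apply: eq_bigr => d _; rewrite coefG // mem_columns0 -ltn_divLR //.
  by rewrite !divnMDl // !divn_small // !addn0.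
rewrite (sum_items columns_uniq _ (fun p => brick_of p == j) GJ) sum_columns.
rewrite /brick_of /= !sum_out_brick ?leq_mul2r ?nj ?orbT // big1 // => i _.
by rewrite mul0r.
Qed.

Lemma entries1_zero (i : 'I_r) : \sum_(x <- all_units) entry1 i x.1 * x.2 = 0.
Proof.
have [coefG sgnG] := fits_all_units.
rewrite entries1 // => [|x /sgnG[]//]; rewrite coefG ?mem_columns1 // /target /=.
rewrite [X in X - _](_ : _ = row1 t A1 N i g) ?subrr //.
by apply: eq_bigr => d _; rewrite coefG // mem_columns0.
Qed.

(** Only column [k] can leave an odd remainder, and [units] cuts it into pairs plus at most one
    single unit. *)
Lemma count_odd_units : (forall q, (k < q < N)%N -> (2 %| g q)%Z) ->
  (count odd_unit all_units <= 1)%N.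
Proof.
move=> g_even; rewrite /all_units count_flatten -map_comp sumnE big_map.
apply: leq_trans (_ : \sum_(p <- columns) (p == (0, k)%N) <= _)%N; last first.
  apply: leq_trans (_ : count_mem (0, k)%N columns <= _)%N; last first.
    by rewrite count_uniq_mem ?columns_uniq // leq_b1.
  by rewrite -sum1_count [leqRHS]big_mkcond; apply: leq_sum => p _; rewrite /=; case: (p == _).
rewrite big_seq [leqRHS]big_seq; apply: leq_sum => -[kd q] pJ /=.
have [[-> ->]|npk] := eqVneq (kd, q) (0, k)%N.
  rewrite /units /= leqnn count_cat !count_nseq /odd_unit /=.
  move: (target _) => z; lia.
rewrite leqn0 -leqn0 leqNgt -has_count; apply/hasPn => x xU.
have [xp _ _ /= odd_t] := units_spec pJ xU; rewrite /odd_unit xp /=.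
apply/negP => /and3P[/eqP kd0 kq x1]; subst kd.
move: odd_t; rewrite kq x1 /= => /(_ isT isT).
move: pJ; rewrite mem_columns0 => qN.
have /g_even : (k < q < N)%N.
  by rewrite qN andbT ltn_neqAle kq andbT; apply: contraNneq npk => ->.
rewrite /target /=; move: (g q) => z; lia.
Qed.

Lemma sum_abs_coef (b : seq item) : (forall x, x \in b -> (`|x.2| <= 2)%N) ->
  (\sum_(q < N) `|coef (0, nat_of_ord q)%N b| <= 2 * size b)%N.
Proof.
move=> b2; apply: leq_trans (_ : \sum_(x <- b) `|x.2| <= _)%N; last first.
  rewrite -sum1_size big_distrr /= big_seq [leqRHS]big_seq.
  by apply: leq_sum => x /b2; rewrite muln1.
apply: leq_trans (_ : \sum_(q < N) \sum_(x <- b | x.1 == (0, nat_of_ord q)%N) `|x.2| <= _)%N.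
  apply: leq_sum => q _; rewrite /coef.
  elim/big_ind2: _ => // x1 x2 y1 y2 le1 le2; lia.
rewrite (exchange_big_dep predT) //=; apply: leq_sum => x _.
rewrite sum_nat_const; apply: leq_trans (_ : 1 * `|x.2| <= _)%N; last by rewrite mul1n.
rewrite leq_mul2r; apply/orP; right; apply/card_le1_eqP => q q'.
rewrite !unfold_in => /andP[_ /eqP xq] /andP[_ /eqP xq'].
by apply: val_inj; rewrite /= in xq xq' *; rewrite -xq.
Qed.

(** Units have absolute value at most 2. Hence the scaled columns are bounded by [2 * a], and a
    block moves the coordinates by at most twice its size in l1 norm. *)
Definition split_bound : nat := 2 * nfold_size r s (2 * a).

(** The piece [h] is a kernel block of units that contains no odd unit and moves some coordinate. At
    most one block is lost to the odd unit, and it is too small to account for all of [g]. *)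
Lemma conformal_split :
  (forall q, (k < q < N)%N -> (2 %| g q)%Z) ->
  (split_bound < \sum_(q < N) `|g q|)%N ->
  exists h : nat -> int, [/\ exists q, (q < N)%N && (h q != 0),
    forall q, (q < N)%N -> conformal (h q) (g q),
    forall i, (i < r)%N -> conformal (row1 t A1 N i h) (row1 t A1 N i g),
    forall w, (w < n * s)%N -> conformal (row2 s t A2 w h) (row2 s t A2 w g) &
    forall q, (k <= q < N)%N -> (2 %| h q)%Z].
Proof.
move=> g_even g_large.
have fitsG := fits_all_units; have [coefG sgnG] := fitsG.
have GJ x : x \in all_units -> x.1 \in columns by move=> /sgnG[].
have G2 x : x \in all_units -> (`|x.2| <= 2)%N.
  by move=> /flatten_mapP[p pJ xU]; have [] := units_spec pJ xU.
have entry1_le (i : nat) p : `|entry1 i p| <= a%:Z.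
  by rewrite /entry1; case: p.1 => [|[|_]] //; case: eqP; lia.
have entry2_le (i : nat) p : `|entry2 i p| <= a%:Z.
  by rewrite /entry2; case: p.1 => [|[|_]] //; case: eqP; lia.
have [|||||ss [pss bss zss2 zss1]] := @nfold_blocks _ r s (2 * a)
    (fun x : item => brick_of x.1)
    (fun (x : item) (i : 'I_r) => entry1 i x.1 * x.2)
    (fun (x : item) (i : 'I_s) => entry2 i x.1 * x.2) r_gt0 s_gt0 n.+1 all_units.
- move=> x /GJ; rewrite /brick_of; case: x => -[[|[|kd]] p] v //=.
    by rewrite mem_columns0 => pN; rewrite ltnS ltnW // ltn_divLR.
  rewrite !mem_cat => /or3P[] /mapP[w wn] // [_ ->].
  move: wn; rewrite mem_index_iota => /andP[_ wn].
  by rewrite ltnS ltnW // ltn_divLR.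
- move=> x /G2 x2 c; rewrite normrM; have := entry2_le c x.1; nia.
- move=> x /G2 x2 c; rewrite normrM; have := entry1_le c x.1; nia.
- exact: entries2_zero.
- exact: entries1_zero.
have subG b x : b \in ss -> x \in b -> x \in all_units.
  by move=> bs xb; rewrite -(perm_mem pss); apply/flattenP; exists b.
have [b [bs not_odd [q /andP[qN hq]]]] : exists b, [/\ b \in ss,
    ~~ has odd_unit b & exists q, (q < N)%N && (coef (0, q)%N b != 0)].
  (* If every block without an odd unit vanished on the coordinates, the norm of [g] would come from
     the single remaining block, hence be at most [split_bound]. *)
  suff /hasP[b bs /andP[nb /hasP[q]]] : has (fun b => ~~ has odd_unit b &&
      has (fun q => coef (0, q)%N b != 0) (iota 0 N)) ss.
    by rewrite mem_iota add0n /= => qN hq; exists b; split=> //; exists q; rewrite qN.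
  apply: contraLR g_large => /hasPn noblock; rewrite -leqNgt.
  apply: leq_trans (_ : \sum_(q < N) \sum_(b <- ss) `|coef (0, nat_of_ord q)%N b| <= _)%N.
    apply: leq_sum => q _; rewrite -[g q]/(target (0, nat_of_ord q)%N).
    rewrite -coefG ?mem_columns0 // /coef -(perm_big _ pss) sum_flatten.
    by elim/big_ind2: _ => // x1 x2 y1 y2 le1 le2; lia.
  rewrite exchange_big /=.
  apply: leq_trans (_ : \sum_(b <- ss) has odd_unit b * split_bound <= _)%N.
    rewrite big_seq [leqRHS]big_seq; apply: leq_sum => b bs.
    have := noblock b bs; case: (has odd_unit b) => /= [_|].
      rewrite mul1n; apply: leq_trans (sum_abs_coef _) _ => [x xb|].
        exact: G2 (subG _ _ bs xb).
      by rewrite leq_mul2l bss.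
    move=> /hasPn noq; rewrite big1 // => q _; apply/eqP; rewrite absz_eq0.
    by have := noq (nat_of_ord q); rewrite mem_iota ltn_ord negbK => ->.
  rewrite -big_distrl /= -[leqRHS]mul1n leq_mul2r; apply/orP; right.
  apply: leq_trans (count_odd_units g_even); rewrite -(permP pss) count_flatten.
  rewrite sumnE big_map; apply: leq_sum => b _; rewrite has_count.
  by case: (count _ _).
have perm_b : perm_eq (b ++ flatten (rem b ss)) all_units.
  apply: perm_trans pss; rewrite -[b ++ _]/(flatten (b :: rem b ss)).
  by apply: perm_flatten; rewrite perm_sym perm_to_rem.
have bJ x : x \in b -> x.1 \in columns by move=> /(subG _ _ bs) /GJ.
have conf p : p \in columns -> conformal (coef p b) (target p).
  exact: (coef_conformal fitsG perm_b).
exists (fun q => coef (0, q)%N b); split.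
- by exists q; rewrite qN.
- by move=> q' qN'; apply: (conf (0, q')%N); rewrite mem_columns0.
(* The block is in the kernel, so its slack coefficient is minus the row of [h]; conformality of the
   slack is conformality of the row. *)
- move=> i ir; have := conf (1, i)%N; rewrite mem_columns1 => /(_ ir).
  have := entries1 bJ ir; rewrite (zss1 b bs (Ordinal ir)) /target /conformal /=.
  lia.
- move=> w wn; have := conf (2, w)%N; rewrite mem_columns2 => /(_ wn).
  have := entries2 bJ wn; rewrite (zss2 b bs _ (Ordinal (ltn_pmod w s_gt0))).
  rewrite /target /conformal /=; lia.
- move=> q' /andP[kq qN'].
  (* Units from coordinate [k] on have absolute value 1 or 2, and the block contains none with
     absolute value 1. *)
  rewrite /coef big_seq_cond; apply: rpred_sum => x /andP[xb /eqP xq].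
  have /hasPn/(_ x xb) := not_odd; rewrite /odd_unit xq /= kq /=.
  have := G2 x (subG _ _ bs xb); have [_] := sgnG x (subG _ _ bs xb).
  have : x.2 = 0 \/ x.2 != 0 by case: eqP; [left|right].
  move=> [->|]; first by rewrite mul0r ltxx.
  move: x.2 => v; lia.
Qed.

End ConformalSplit.

(** * Penalized objective *)

Definition pos_part (z : int) : int := z * (0 <= z)%R%:Z.

(** The four-point form of convexity: moving two points towards each other by the same amount,
    within their distance, does not increase the sum of the values. *)
Definition convex_at (R : numDomainType) (phi : int -> R) : Prop :=
  forall x w h, conformal h (w - x) -> phi (x + h) + phi (w - h) <= phi x + phi w.

Lemma convex_pos_part (c : int) :
  convex_at (fun z => pos_part (z - c)) /\ convex_at (fun z => pos_part (c - z)).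
Proof. by split=> x w h; rewrite /conformal /pos_part; nia. Qed.

Lemma convex_distance (c : int) : convex_at (fun z => `|z - c|).
Proof. by move=> x w h; rewrite /conformal; lia. Qed.

Lemma eq_row1 t A1 N i x y :
  (forall q, (q < N)%N -> x q = y q) -> row1 t A1 N i x = row1 t A1 N i y.
Proof. by move=> xy; apply: eq_bigr => q _; rewrite xy. Qed.

Lemma eq_row2 s t A2 n w x y : (w < n * s)%N ->
  (forall q, (q < n * t)%N -> x q = y q) -> row2 s t A2 w x = row2 s t A2 w y.
Proof.
move=> wn xy; apply: eq_bigr => c _; rewrite xy //.
have s_gt0 : (0 < s)%N by lia.
have : (w %/ s < n)%N by rewrite ltn_divLR.
have := ltn_ord c; move: (w %/ s)%N => j; nia.
Qed.

Lemma row1D t A1 N i x y g :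
  row1 t A1 N i (fun q => x q + g * y q) = row1 t A1 N i x + g * row1 t A1 N i y.
Proof.
rewrite /row1 mulr_sumr -big_split /=; apply: eq_bigr => q _.
by rewrite mulrDr mulrCA.
Qed.

Lemma row2D s t A2 w x y g :
  row2 s t A2 w (fun q => x q + g * y q) = row2 s t A2 w x + g * row2 s t A2 w y.
Proof.
rewrite /row2 mulr_sumr -big_split /=; apply: eq_bigr => q _.
by rewrite mulrDr mulrCA.
Qed.

Lemma addr3_le (u1 u2 u3 u4 v1 v2 v3 v4 w1 w2 w3 w4 : int) :
  u1 + u2 <= u3 + u4 -> v1 + v2 <= v3 + v4 -> w1 + w2 <= w3 + w4 ->
  u1 + v1 + w1 + (u2 + v2 + w2) <= u3 + v3 + w3 + (u4 + v4 + w4).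
Proof. lia. Qed.

Section Objective.
Variables (r s t n : nat) (A1 A2 : nat -> nat -> int) (b : nat -> int).
Let N := (n * t)%N.

(** The coordinate costs [phi] are a parameter because the same sum is used with the box penalty
    alone and with an added parity penalty. *)
Definition energy (phi : nat -> int -> int) (x : nat -> int) : int :=
  \sum_(q < N) phi q (x q) + \sum_(i < r) `|row1 t A1 N i x - b i| +
  \sum_(w < n * s) `|row2 s t A2 w x - b (r + w)%N|.

Lemma eq_energy phi x y :
  (forall q, (q < N)%N -> x q = y q) -> energy phi x = energy phi y.
Proof.
move=> xy; rewrite /energy; congr (_ + _ + _); apply: eq_bigr => i _.
- by rewrite xy.
- by rewrite (eq_row1 _ _ _ xy).
- by rewrite (eq_row2 _ (ltn_ord i) xy).
Qed.

Lemma eq_energy_cost phi psi x :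
  (forall q, (q < N)%N -> phi q (x q) = psi q (x q)) -> energy phi x = energy psi x.
Proof.
by move=> e; rewrite /energy; congr (_ + _ + _); apply: eq_bigr => q _; rewrite e.
Qed.

Variables (R : realDomainType) (f : nat -> int -> R).

Definition total (x : nat -> int) : R := \sum_(q < N) f q (x q).

Lemma eq_total x y : (forall q, (q < N)%N -> x q = y q) -> total x = total y.
Proof. by move=> xy; apply: eq_bigr => q _; rewrite xy. Qed.

Definition lex_le phi (x y : nat -> int) : bool :=
  (energy phi x < energy phi y) ||
  ((energy phi x == energy phi y) && (total x <= total y)).

Lemma lex_le_refl phi x : lex_le phi x x.
Proof. by rewrite /lex_le eqxx lexx orbT. Qed.

Lemma lex_le_trans phi y x z : lex_le phi x y -> lex_le phi y z -> lex_le phi x z.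
Proof.
rewrite /lex_le => /orP[xy|/andP[/eqP -> xy]] /orP[yz|/andP[/eqP yz' yz]].
- by rewrite (lt_trans xy yz).
- by rewrite -yz' xy.
- by rewrite yz.
- by rewrite yz' eqxx (le_trans xy yz) orbT.
Qed.

Lemma lex_le_total phi x y : lex_le phi x y || lex_le phi y x.
Proof. by rewrite /lex_le; case: ltgtP => //= _; case: leP => //= /ltW ->. Qed.

Lemma eq_lex_le phi x y x' y' :
  (forall q, (q < N)%N -> x q = x' q) -> (forall q, (q < N)%N -> y q = y' q) ->
  lex_le phi x y = lex_le phi x' y'.
Proof.
by move=> xx yy; rewrite /lex_le !(eq_energy _ xx) !(eq_energy _ yy) (eq_total xx) (eq_total yy).
Qed.

(** Passing from the pair [x], [y] to [x'], [y'] increases neither sum. What [x'] loses against [x]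
    must therefore be gained by [y'] against [y]. *)
Lemma lex_le_exchange phi x y x' y' :
  energy phi x' + energy phi y' <= energy phi x + energy phi y ->
  total x' + total y' <= total x + total y ->
  lex_le phi x x' -> lex_le phi y' y.
Proof.
rewrite /lex_le => e_le t_le /orP[lt_x|/andP[/eqP eq_x le_x]].
  by apply/orP; left; lia.
have [//|gt_y|eq_y] := ltgtP (energy phi y') (energy phi y).
  by exfalso; move: e_le gt_y; rewrite eq_x; lia.
by rewrite -(lerD2l (total x')) (le_trans t_le) // lerD2r.
Qed.

Definition translate (x : nat -> int) (g : int) (z : nat -> int) (q : nat) : int :=
  x q + g * z q.

(** The points [x] and [x + g z] are moved towards each other by [g h]. Conformality in the rows is
    what makes the distances [|row - b|] obey the exchange inequality as well. *)
Lemma lex_le_convex phi x (g : nat) z h :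
  (forall q, (q < N)%N -> convex_at (f q)) ->
  (forall q, (q < N)%N -> convex_at (phi q)) ->
  (forall q, (q < N)%N -> conformal (h q) (z q)) ->
  (forall i, (i < r)%N -> conformal (row1 t A1 N i h) (row1 t A1 N i z)) ->
  (forall w, (w < n * s)%N -> conformal (row2 s t A2 w h) (row2 s t A2 w z)) ->
  lex_le phi x (translate x g%:Z h) ->
  lex_le phi (translate x g%:Z (fun q => z q - h q)) (translate x g%:Z z).
Proof.
move=> f_convex phi_convex hz hz1 hz2.
have exch (V : numDomainType) (psi : int -> V) (u v w : int) : convex_at psi ->
    conformal v w ->
    psi (u + g%:Z * v) + psi (u + g%:Z * (w - v)) <= psi u + psi (u + g%:Z * w).
  move=> c vw; have := c u (u + g%:Z * w) (g%:Z * v).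
  rewrite (_ : u + _ * w - _ * v = u + g%:Z * (w - v)); last by ring.
  apply; rewrite addrAC subrr add0r.
  have g0 : 0 <= g%:Z by [].
  by move: vw => /orP[] /andP[v0 vw]; apply/orP; [left|right]; apply/andP; split; nia.
have row1B i : row1 t A1 N i (fun q => z q - h q) = row1 t A1 N i z - row1 t A1 N i h.
  by rewrite /row1 -sumrB; apply: eq_bigr => c _; rewrite mulrBr.
have row2B w : row2 s t A2 w (fun q => z q - h q) = row2 s t A2 w z - row2 s t A2 w h.
  by rewrite /row2 -sumrB; apply: eq_bigr => c _; rewrite mulrBr.
set x' := translate x g%:Z h; set w := translate x g%:Z z.
set y' := translate x g%:Z _.
have cost_le : \sum_(q < N) phi q (x' q) + \sum_(q < N) phi q (y' q) <=
    \sum_(q < N) phi q (x q) + \sum_(q < N) phi q (w q).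
  rewrite -!big_split; apply: ler_sum => q _ /=.
  exact: exch (phi_convex _ (ltn_ord q)) (hz _ (ltn_ord q)).
have row1_le : \sum_(i < r) `|row1 t A1 N i x' - b i| + \sum_(i < r) `|row1 t A1 N i y' - b i| <=
    \sum_(i < r) `|row1 t A1 N i x - b i| + \sum_(i < r) `|row1 t A1 N i w - b i|.
  rewrite -!big_split; apply: ler_sum => i _ /=; rewrite !row1D row1B.
  exact: exch (@convex_distance (b i)) (hz1 _ (ltn_ord i)).
have row2_le : \sum_(i < n * s) `|row2 s t A2 i x' - b (r + i)%N| +
    \sum_(i < n * s) `|row2 s t A2 i y' - b (r + i)%N| <=
    \sum_(i < n * s) `|row2 s t A2 i x - b (r + i)%N| +
    \sum_(i < n * s) `|row2 s t A2 i w - b (r + i)%N|.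
  rewrite -!big_split; apply: ler_sum => i _ /=; rewrite !row2D row2B.
  exact: exch (@convex_distance (b (r + i)%N)) (hz2 _ (ltn_ord i)).
apply: lex_le_exchange; first exact: addr3_le cost_le row1_le row2_le.
rewrite /total -!big_split /=; apply: ler_sum => i _.
exact: exch (f_convex _ (ltn_ord i)) (hz _ (ltn_ord i)).
Qed.

End Objective.

(** * Proximity and the dynamic program *)

Lemma sum_bricks (n t : nat) (V : nmodType) (F : nat -> V) :
  \sum_(q < n * t) F q = \sum_(j < n) \sum_(c < t) F (j * t + c)%N.
Proof.
rewrite -(big_mkord xpredT F) big_nat_mul big_mkord.
apply: eq_bigr => j _; rewrite mulSn -{1}[(j * t)%N]add0n big_addn addnK big_mkord.
by apply: eq_bigr => c _; rewrite addnC.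
Qed.

Section Descent.
Variables (r s t n : nat) (A1 A2 : nat -> nat -> int) (b : nat -> int) (a : nat).
Hypotheses (r_gt0 : (0 < r)%N) (s_gt0 : (0 < s)%N) (t_gt0 : (0 < t)%N).
Hypothesis a_gt0 : (0 < a)%N.
Hypothesis A1_le : forall i c, `|A1 i c| <= a%:Z.
Hypothesis A2_le : forall i c, `|A2 i c| <= a%:Z.
Let N := (n * t)%N.
Variables (R : realDomainType) (f : nat -> int -> R) (box : nat -> int -> int).
Hypothesis f_convex : forall q, (q < N)%N -> convex_at (f q).
Hypothesis box_convex : forall q, (q < N)%N -> convex_at (box q).
Hypothesis box_ge0 : forall q z, 0 <= box q z.

Let le := lex_le r s t n A1 A2 b f box.

(** The index [k] interpolates between two scales: [k = 0] is optimality on [x + 2 g Z^N], and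
    [k = N] is optimality on [x + g Z^N]. *)
Definition released (g k : nat) (x : nat -> int) : Prop :=
  forall z, (forall q, (k <= q < N)%N -> (2 %| z q)%Z) ->
    lex_le r s t n A1 A2 b f box x (translate x g z).

(** While [z] is long, [conformal_split] gives a piece that is even from [k] on. It does not improve
    the released point [x], so it can be removed from [z]; being conformal and nonzero, its removal
    shortens [z]. *)
Lemma proximity g k x z :
  released g k x -> (forall q, (k < q < N)%N -> (2 %| z q)%Z) ->
  exists z', [/\ forall q, (k < q < N)%N -> (2 %| z' q)%Z,
    (\sum_(q < N) `|z' q| <= split_bound r s a)%N &
    le (translate x g z') (translate x g z)].
Proof.
move=> x_opt; have [m] := ubnP (\sum_(q < N) `|z q|)%N.
elim: m z => // m IHm z; rewrite ltnS => le_m z_even.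
have [z_small|z_large] := leqP (\sum_(q < N) `|z q|)%N (split_bound r s a).
  by exists z; split=> //; apply: lex_le_refl.
have [h [[q0 /andP[q0N hq0]] hz hz1 hz2 h_even]] :=
  conformal_split r_gt0 s_gt0 t_gt0 a_gt0 A1_le A2_le z_even z_large.
have le_xh : le x (translate x g h) by apply: x_opt.
have le_zh := lex_le_convex f_convex box_convex hz hz1 hz2 le_xh.
have [||z' [z'_even z'_small le_z']] := IHm (fun q => z q - h q).
- apply: leq_trans le_m.
  have part q : (q < N)%N -> (`|(z q - h q)%R| + `|h q| = `|z q|)%N.
    by move=> /hz; rewrite /conformal; lia.
  rewrite (bigD1 (Ordinal q0N)) //= [ltnRHS](bigD1 (Ordinal q0N)) //= -addSn.
  apply: leq_add; first by have := part q0 q0N; lia.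
  by apply: leq_sum => q _; rewrite -(part q (ltn_ord q)) leq_addr.
- move=> q /andP[kq qN]; apply: rpredB; first by apply: z_even; rewrite kq.
  by apply: h_even; rewrite ltnW.
by exists z'; split=> //; apply: lex_le_trans le_z' le_zh.
Qed.

(** * The dynamic program over the bricks *)

Section DynamicProgram.
Variables (g k K : nat) (x : nat -> int) (big : int).

Let B := (2 * K).+1.
Definition states := (B ^ t)%N.

(** A state encodes a vector of [[-K, K]^t] as a number in base [2 * K + 1], its digits shifted by
    [K]. *)
Definition digit (c sigma : nat) : int :=
  ((sigma %/ B ^ c) %% B)%N%:Z - K%:Z.

Lemma state_of_digits (d : nat -> int) :
  (forall c, (c < t)%N -> `|d c| <= K%:Z) ->
  exists2 sigma, (sigma < states)%N & forall c, (c < t)%N -> digit c sigma = d c.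
Proof.
rewrite /states; elim: t => [|t' IHt] dK; first by exists 0%N.
have [|sg sg_lt dsg] := IHt; first by move=> c ct; apply: dK; rewrite ltnW.
have dt := dK t' (leqnn _).
pose v := `|(d t' + K%:Z)%R|%N; have v_lt : (v < B)%N by rewrite /v /B; lia.
exists (v * B ^ t' + sg)%N; first by rewrite expnS; nia.
have B_gt0 c : (0 < B ^ c)%N by rewrite expn_gt0.
move=> c; rewrite ltnS leq_eqVlt => /orP[/eqP ->|ct].
  rewrite /digit divnMDl // divn_small // addn0 modn_small //; lia.
rewrite -dsg // /digit; congr (_%:Z - _).
have -> : (v * B ^ t' = v * B ^ (t' - c.+1) * B * B ^ c)%N.
  by rewrite -!mulnA -expnS -expnD subnK.
by rewrite divnMDl // modnMDl.
Qed.

Definition bump (i sigma q : nat) : int :=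
  if (q %/ t == i)%N then digit (q %% t) sigma else 0.

(* A penalty big above the energy of x forbids odd multiples of g in the      *)
(* coordinates after k.                                                      *)
Definition layer_cost (q : nat) (z : int) : int :=
  box q z + (k < q)%N%:Z * (big * ((z - x q) %% (2 * g%:Z))%Z).

Let key_le := lex_le r s t n A1 A2 b f layer_cost.

Lemma eq_key_le y z y' z' :
  (forall q, (q < N)%N -> y q = y' q) -> (forall q, (q < N)%N -> z q = z' q) ->
  key_le y z = key_le y' z'.
Proof. exact: eq_lex_le. Qed.

Definition pick (y z : nat -> int) : nat -> int :=
  if lex_le r s t n A1 A2 b f layer_cost z y then z else y.

Fixpoint best (c : nat -> nat -> int) (m : nat) : nat -> int :=
  if m is m'.+1 then pick (best c m') (c m') else c 0%N.

Lemma pick_le y z : key_le (pick y z) y /\ key_le (pick y z) z.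
Proof.
rewrite /pick; case: ifP => [zy|/negbT zy]; first by split=> //; apply: lex_le_refl.
split; first exact: lex_le_refl.
by have := lex_le_total r s t n A1 A2 b f layer_cost z y; rewrite (negPf zy).
Qed.

Lemma best_le c m sigma : (sigma < m)%N -> key_le (best c m) (c sigma).
Proof.
elim: m => // m IHm; rewrite ltnS leq_eqVlt => /orP[/eqP ->|/IHm le_m] /=.
  by have [] := pick_le (best c m) (c m).
by apply: lex_le_trans le_m; have [] := pick_le (best c m) (c m).
Qed.

Lemma best_mem c m : exists sigma, best c m = c sigma.
Proof.
elim: m => [|m [sigma IHm]]; first by exists 0%N.
rewrite /= /pick; case: ifP => _; first by exists m.
by exists sigma.
Qed.

(** A state records the sum of the bricks [0..i] of the step, not the last brick: going from
    [sigma'] to [sigma] places the difference of their digits in the next brick. Layer [n] acts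
    beyond the last coordinate, so [table n 0] is just the best entry of layer [n - 1] over all
    states. *)
Fixpoint table (i sigma : nat) : nat -> int :=
  if i is i'.+1 then
    best (fun sigma' => translate (table i' sigma') g
            (fun q => bump i sigma q - bump i sigma' q)) states
  else translate x g (bump 0 sigma).

Definition candidate (i sigma sigma' : nat) : nat -> int :=
  translate (table i sigma') g (fun q => bump i.+1 sigma q - bump i.+1 sigma' q).

Lemma states_gt0 : (0 < states)%N. Proof. by rewrite expn_gt0. Qed.

(* All that the later layers need to know about a table entry.               *)
Definition in_layer (i sigma : nat) (z : nat -> int) : Prop :=
  (forall q, (i < q %/ t)%N -> z q = 0) /\
  ((i < n)%N -> forall c, (c < t)%N -> \sum_(j < n) z (j * t + c)%N = digit c sigma).

Lemma bump_sum i sigma c : (i < n)%N -> (c < t)%N ->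
  \sum_(j < n) bump i sigma (j * t + c)%N = digit c sigma.
Proof.
move=> i_lt ct; rewrite (bigD1 (Ordinal i_lt)) //= [X in _ + X]big1 ?addr0.
  by rewrite /bump divnMDl // divn_small // addn0 eqxx modnMDl modn_small.
move=> j; rewrite -val_eqE /= => /negPf ji.
by rewrite /bump divnMDl // divn_small // addn0 ji.
Qed.

Lemma table_in_layer i sigma :
  exists2 z, table i sigma = translate x g z & in_layer i sigma z.
Proof.
elim: i sigma => [|i IHi] sigma /=.
  exists (bump 0 sigma) => //; split=> [q|n_gt0 c]; last exact: bump_sum.
  by rewrite /bump; case: eqP => // ->.
have [sg' ->] := best_mem (candidate i sigma) states.
have [z e [z0 zs]] := IHi sg'; rewrite /candidate e.
exists (fun q => z q + (bump i.+1 sigma q - bump i.+1 sg' q)).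
  by apply/boolp.funext => q; rewrite /translate; ring.
split=> [q iq|i_lt c ct].
  by rewrite z0 ?(ltnW iq) // /bump eq_sym (ltn_eqF iq).
by rewrite big_split sumrB /= zs ?(ltnW i_lt) // !bump_sum //; ring.
Qed.

(** Bellman's principle: a change in brick [i.+1] alone affects both vectors equally, because they
    agree on that brick and have the same sum of bricks. *)
Lemma lex_le_bump i sigma z z' delta : (i.+1 < n)%N ->
  in_layer i sigma z -> in_layer i sigma z' ->
  (forall q, (q %/ t != i.+1)%N -> delta q = 0) ->
  key_le (translate x g z) (translate x g z') ->
  key_le (translate (translate x g z) g delta) (translate (translate x g z') g delta).
Proof.
move=> i_lt [z0 zs] [z'0 z's] d0.
have zz' q : (q %/ t == i.+1)%N -> z q = z' q by move=> /eqP qi; rewrite z0 ?z'0 ?qi.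
have swap (V : zmodType) (psi : int -> V) q :
    psi (translate x g z' q) + psi (translate (translate x g z) g delta q) =
    psi (translate x g z q) + psi (translate (translate x g z') g delta q).
  rewrite /translate; have [/zz' -> //|/d0 ->] := boolP (q %/ t == i.+1)%N.
  by rewrite mulr0 !addr0 addrC.
(* The same [A1] stands in every brick, so a shared row depends only on the sum of the bricks. *)
have row1_eq i' : row1 t A1 N i' z = row1 t A1 N i' z'.
  rewrite /row1 (sum_bricks _ _ (fun q => A1 i' (q %% t)%N * z q)).
  rewrite (sum_bricks _ _ (fun q => A1 i' (q %% t)%N * z' q)).
  rewrite exchange_big [RHS]exchange_big /=; apply: eq_bigr => c _.
  under eq_bigr do rewrite modnMDl; under [RHS]eq_bigr do rewrite modnMDl.
  by rewrite -!mulr_sumr zs ?z's // ltnW.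
apply: lex_le_exchange; last first.
  rewrite -!big_split /= le_eqVlt; apply/orP; left; apply/eqP/eq_bigr => q _.
  exact: swap.
apply: addr3_le; rewrite -!big_split /= le_eqVlt; apply/orP; left; apply/eqP/eq_bigr => w _.
- exact: swap.
- by rewrite !row1D row1_eq.
- rewrite !row2D; have [wi|wi] := boolP (w %/ s == i.+1)%N.
    rewrite (_ : row2 s t A2 w z = row2 s t A2 w z') //.
    by apply: eq_bigr => c _; rewrite zz' // divnMDl // (divn_small (ltn_ord c)) addn0.
  rewrite (_ : row2 s t A2 w delta = 0) ?mulr0 ?addr0 1?addrC //.
  by rewrite /row2 big1 // => c _; rewrite d0 ?mulr0 // divnMDl // (divn_small (ltn_ord c)) addn0.
Qed.

Definition prefix (z : nat -> int) (i : nat) (q : nat) : int :=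
  if (q %/ t <= i)%N then z q else 0.

Definition prefix_sum (z : nat -> int) (i c : nat) : int :=
  \sum_(j < n) prefix z i (j * t + c)%N.

Lemma prefix_sumS z i c : (i.+1 < n)%N -> (c < t)%N ->
  prefix_sum z i.+1 c = prefix_sum z i c + z (i.+1 * t + c)%N.
Proof.
move=> i_lt ct; rewrite /prefix_sum (bigD1 (Ordinal i_lt)) //= addrC.
rewrite [X in _ = X + _](bigD1 (Ordinal i_lt)) //= /prefix !divnMDl //.
rewrite (divn_small ct) !addn0 leqnn ltnn add0r; congr (_ + _).
apply: eq_bigr => j; rewrite -val_eqE /= => /negPf ji.
by rewrite divnMDl // (divn_small ct) addn0 leq_eqVlt ji.
Qed.

Lemma prefix_sum0 z c : (0 < n)%N -> (c < t)%N -> prefix_sum z 0 c = z c.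
Proof.
move=> n_gt0 ct; rewrite /prefix_sum (bigD1 (Ordinal n_gt0)) //= [X in _ + X]big1 ?addr0.
  by rewrite /prefix mul0n add0n divn_small.
move=> j; rewrite -val_eqE /= -lt0n => j_gt0.
by rewrite /prefix divnMDl // (divn_small ct) addn0 leqNgt j_gt0.
Qed.

Lemma prefix_in_layer z i sigma :
  (forall c, (c < t)%N -> digit c sigma = prefix_sum z i c) ->
  in_layer i sigma (prefix z i).
Proof.
move=> dz; split=> [q iq|i_lt c ct]; first by rewrite /prefix leqNgt iq.
by rewrite dz.
Qed.

(** Since the partial sums of [z] stay in the box, the sum of its previous prefix is a state [sg'],
    and the candidate through [sg'] is one of those compared. *)
Lemma table_le z i sigma :
  (forall i c, (i < n)%N -> (c < t)%N -> `|prefix_sum z i c| <= K%:Z) ->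
  (i < n)%N -> (forall c, (c < t)%N -> digit c sigma = prefix_sum z i c) ->
  key_le (table i sigma) (translate x g (prefix z i)).
Proof.
move=> zK; elim: i sigma => [|i IHi] sigma i_lt dz.
  rewrite (@eq_key_le _ _ (translate x g (prefix z 0)) (translate x g (prefix z 0))).
  - exact: lex_le_refl.
  - move=> q _; rewrite /= /translate /prefix /bump leqn0; case: eqP => // q0.
    rewrite dz ?ltn_pmod // prefix_sum0 ?ltn_pmod //.
    by congr (_ + _ * z _); rewrite {2}(divn_eq q t) q0 mul0n add0n.
  - by [].
have [sg' sg'_lt dsg'] := state_of_digits (fun c => zK i c (ltnW i_lt)).
apply: lex_le_trans (best_le (candidate i sigma) sg'_lt) _.
have [z1 ez1 z1_layer] := table_in_layer i sg'.
have := IHi sg' (ltnW i_lt) dsg'; rewrite /candidate ez1.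
set delta := (fun q => _) => le_i.
have d0 q : (q %/ t != i.+1)%N -> delta q = 0.
  by move=> /negPf qi; rewrite /delta /bump qi subrr.
have := lex_le_bump i_lt z1_layer (prefix_in_layer dsg') d0 le_i.
set u := translate _ g delta; set v := translate _ g delta => le_uv.
suff : key_le u (translate x g (prefix z i.+1)) by [].
rewrite (@eq_key_le _ _ u v) // => q _.
rewrite /v /translate -addrA -mulrDr; congr (_ + _ * _).
rewrite /prefix /delta /bump [in LHS]leq_eqVlt ltnS.
case: eqP => [qi|_] /=; last by rewrite subrr addr0.
rewrite qi ltnn add0r dz ?ltn_pmod // dsg' ?ltn_pmod // prefix_sumS ?ltn_pmod //.
by rewrite addrAC subrr add0r -qi -divn_eq.
Qed.

Lemma prefix_sum_le (z : nat -> int) : (\sum_(q < N) `|z q| <= K)%N ->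
  forall i c, (i < n)%N -> (c < t)%N -> `|prefix_sum z i c| <= K%:Z.
Proof.
move=> zK i c _ ct; suff : (`|prefix_sum z i c| <= K)%N by lia.
apply: leq_trans zK; rewrite (sum_bricks _ _ (fun q => `|z q|%N)) exchange_big /=.
rewrite [leqRHS](bigD1 (Ordinal ct)) //=; apply: leq_trans (leq_addr _ _).
rewrite /prefix_sum; elim/big_ind2: _ => // [x1 x2 y1 y2|j _]; first lia.
by rewrite /prefix; case: ifP.
Qed.

Lemma energy_layer y : energy r s t n A1 A2 b layer_cost y =
  energy r s t n A1 A2 b box y +
  \sum_(q < N) (k < q)%N%:Z * (big * ((y q - x q) %% (2 * g%:Z))%Z).
Proof. by rewrite /energy big_split /=; ring. Qed.

Lemma table_last_le (z : nat -> int) : (0 < n)%N -> (\sum_(q < N) `|z q| <= K)%N ->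
  key_le (table n 0) (translate x g z).
Proof.
move=> n_gt0 zK; have zb := prefix_sum_le zK.
have i_lt : (n.-1 < n)%N by rewrite prednK.
have [sg sg_lt dsg] := state_of_digits (fun c => zb n.-1 c i_lt).
have q_lt q : (q < N)%N -> (q %/ t < n)%N by rewrite ltn_divLR.
rewrite -(prednK n_gt0) in q_lt *.
apply: lex_le_trans (best_le (candidate n.-1 0) sg_lt) _.
suff : key_le (candidate n.-1 0 sg) (translate x g z) by [].
rewrite (@eq_key_le _ _ (table n.-1 sg) (translate x g (prefix z n.-1))).
- exact: table_le.
- by move=> q /q_lt qi; rewrite /candidate /translate /bump ltn_eqF // subrr mulr0 addr0.
- by move=> q /q_lt qi; rewrite /translate /prefix -ltnS qi.
Qed.

Lemma energy_ge0 y : 0 <= energy r s t n A1 A2 b box y.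
Proof. by rewrite /energy !addr_ge0 // sumr_ge0. Qed.

Lemma step_modz z : (0 < g)%N -> ((g%:Z * z) %% (2 * g%:Z))%Z = g%:Z * (z %% 2)%Z.
Proof.
move=> g_gt0; rewrite {1}(divz_eq z 2) mulrDr mulrCA [g%:Z * 2]mulrC modzMDl.
rewrite modz_small //; have := @modz_ge0 z 2 isT; have := @ltz_pmod z 2 isT.
move: (z %% 2)%Z => m; nia.
Qed.

(** The table minimizes with the parity penalty over all steps of norm at most [K]. Its result
    avoids the penalty, and by [proximity] any unpenalized competitor is matched by one of such
    norm. *)
Lemma released_step : (0 < n)%N -> (0 < g)%N -> (split_bound r s a <= K)%N ->
  big = energy r s t n A1 A2 b box x + 1 ->
  released g k x -> released g k.+1 (table n 0).
Proof.
move=> n_gt0 g_gt0 K_large bigE x_opt.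
have [z0 e0 _] := table_in_layer n 0.
have penalty (z : nat -> int) : \sum_(q < N) (k < q)%N%:Z *
      (big * ((translate x g z q - x q) %% (2 * g%:Z))%Z) =
    g%:Z * big * \sum_(q < N | (k < q)%N) (z q %% 2)%Z.
  rewrite mulr_sumr [RHS]big_mkcond; apply: eq_bigr => q _.
  rewrite /translate addrAC subrr add0r step_modz //.
  by case: (k < q)%N; rewrite ?mul0r // mul1r; ring.
have no_penalty z : (forall q, (k < q < N)%N -> (2 %| z q)%Z) ->
    energy r s t n A1 A2 b layer_cost (translate x g z) =
    energy r s t n A1 A2 b box (translate x g z).
  move=> z_even; rewrite energy_layer penalty big1 ?mulr0 ?addr0 // => q kq.
  by apply/dvdz_mod0P; apply: z_even; rewrite kq ltn_ord.
have big_gt0 : 0 < big by rewrite bigE; have := energy_ge0 x; lia.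
have key_energy y y' : key_le y y' ->
    energy r s t n A1 A2 b layer_cost y <= energy r s t n A1 A2 b layer_cost y'.
  by move=> /orP[/ltW //|/andP[/eqP ->]].
have even0 (q : nat) : (k < q < N)%N -> (2 %| (0 : int))%Z by [].
(* The zero step has energy [big - 1] and no penalty, while one odd entry after [k] already costs
   [g * big]. *)
have z0_even q : (k < q < N)%N -> (2 %| z0 q)%Z.
  move=> /andP[kq qN].
  have small0 : (\sum_(q < N) `|0 : int| <= K)%N by rewrite big1.
  have := key_energy _ _ (@table_last_le (fun=> 0) n_gt0 small0).
  rewrite (no_penalty _ even0) e0 energy_layer penalty.
  rewrite (_ : translate x g (fun=> 0) = x); last first.
    by apply/boolp.funext => q'; rewrite /translate mulr0 addr0.
  move=> le_x; apply/dvdz_mod0P; move: le_x; rewrite (bigD1 (Ordinal qN)) //=.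
  set rest := (\sum_(_ < _ | _) _)%R; have rest_ge0 : 0 <= rest.
    by apply: sumr_ge0 => q' _; apply: modz_ge0.
  have := @modz_ge0 (z0 q) 2 isT.
  have := energy_ge0 (translate x g z0).
  move: (energy _ _ _ _ _ _ _ _ _) => E; rewrite bigE.
  have := energy_ge0 x; move: (energy _ _ _ _ _ _ _ _ _) => E'.
  move: (z0 q %% 2)%Z => m; nia.
move=> z z_even; rewrite e0.
have zz0_even q : (k < q < N)%N -> (2 %| z0 q + z q)%Z.
  by move=> kq; apply: rpredD; [apply: z0_even|apply: z_even].
have [z' [z'_even z'_small le_z']] := proximity x_opt zz0_even.
have -> : translate (translate x g z0) g z = translate x g (fun q => z0 q + z q).
  by apply/boolp.funext => q; rewrite /translate mulrDr addrA.
apply: lex_le_trans le_z'.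
have z'K := leq_trans z'_small K_large.
have := table_last_le n_gt0 z'K; rewrite e0.
by rewrite /key_le /lex_le !no_penalty.
Qed.

End DynamicProgram.
End Descent.

(** * Timed Hoare rules *)

Fixpoint mod_vars (c : cmd) : seq nat :=
  match c with
  | Skip | Put _ _ _ => [::]
  | Assign x _ | Query x _ _ => [:: x]
  | Seq c1 c2 | If _ c1 c2 => mod_vars c1 ++ mod_vars c2
  | While _ c1 => mod_vars c1
  end.

Fixpoint mod_arrs (c : cmd) : seq nat :=
  match c with
  | Skip | Assign _ _ | Query _ _ _ => [::]
  | Put p _ _ => [:: p]
  | Seq c1 c2 | If _ c1 c2 => mod_arrs c1 ++ mod_arrs c2
  | While _ c1 => mod_arrs c1
  end.

Definition framed (vs ps : seq nat) (st st' : state) : Prop :=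
  (forall x, x \notin vs -> vars st' x = vars st x) /\
  (forall p, p \notin ps -> arrs st' p = arrs st p).

Lemma framed_refl vs ps st : framed vs ps st st. Proof. by []. Qed.

Lemma framed_trans vs1 ps1 vs2 ps2 vs ps st1 st2 st3 :
  {subset vs1 <= vs} -> {subset vs2 <= vs} ->
  {subset ps1 <= ps} -> {subset ps2 <= ps} ->
  framed vs1 ps1 st1 st2 -> framed vs2 ps2 st2 st3 -> framed vs ps st1 st3.
Proof.
move=> v1 v2 p1 p2 [fv1 fp1] [fv2 fp2]; split=> [x xn|p pn].
  rewrite fv2; last by apply: contra xn => /v2.
  by rewrite fv1 //; apply: contra xn => /v1.
rewrite fp2; last by apply: contra pn => /p2.
by rewrite fp1 //; apply: contra pn => /p1.
Qed.

Section Programs.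
Variables (N : nat) (cmp : rel 'cV[int]_N).

Lemma exec_framed c st T st' :
  exec cmp c st T st' -> framed (mod_vars c) (mod_arrs c) st st'.
Proof.
elim=> {c st T st'} //=.
- by move=> x e st; split=> //= y; rewrite inE => /negPf ->.
- move=> p e1 e2 st; split=> //= q; rewrite inE => /negPf qp.
  by apply/boolp.funext => j; rewrite qp.
- by move=> x p q st; split=> //= y; rewrite inE => /negPf ->.
- move=> c1 c2 st1 st2 st3 T1 T2 _ f1 _ f2.
  by apply: framed_trans f1 f2 => x; rewrite mem_cat => ->; rewrite ?orbT.
- move=> e c1 c2 st st' T _ _ f1.
  by apply: framed_trans f1 (framed_refl [::] [::] _) => x //; rewrite mem_cat => ->.
- move=> e c1 c2 st st' T _ _ f1.
  by apply: framed_trans f1 (framed_refl [::] [::] _) => x //; rewrite mem_cat orbC => ->.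
- by move=> e c st1 st2 st3 T1 T2 _ _ f1 _ f2; apply: framed_trans f1 f2.
Qed.

(** Total correctness within a time bound; only an upper bound is kept, so that costs may be rounded
    up. *)
Definition runs (c : cmd) (st : state) (T : nat) (Q : state -> Prop) : Prop :=
  exists T' st', [/\ exec cmp c st T' st', (T' <= T)%N & Q st'].

Lemma runs_weaken c st T T' (Q Q' : state -> Prop) :
  (T <= T')%N -> (forall st', Q st' -> Q' st') -> runs c st T Q -> runs c st T' Q'.
Proof.
move=> TT QQ [T1 [st' [e T1T /QQ Qst']]]; exists T1, st'.
by split=> //; apply: leq_trans TT.
Qed.

Lemma runs_le c st T T' Q : (T <= T')%N -> runs c st T Q -> runs c st T' Q.
Proof. by move=> TT; apply: runs_weaken. Qed.

Lemma runs_framed c st T (Q : state -> Prop) :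
  runs c st T Q ->
  runs c st T (fun st' => Q st' /\ framed (mod_vars c) (mod_arrs c) st st').
Proof.
by move=> [T1 [st' [e T1T Qst']]]; exists T1, st'; split=> //; split=> //; apply: exec_framed e.
Qed.

Lemma runs_skip st (Q : state -> Prop) : Q st -> runs Skip st 1 Q.
Proof. by exists 1%N, st; split=> //; constructor. Qed.

Lemma runs_assign x e st (Q : state -> Prop) :
  Q (set_var x (value st e) st) -> runs (Assign x e) st (expr_cost e).+1 Q.
Proof. by exists (expr_cost e).+1, (set_var x (value st e) st); split=> //; constructor. Qed.

Lemma runs_put p e1 e2 st (Q : state -> Prop) :
  Q (set_cell p (value st e1) (value st e2) st) ->
  runs (Put p e1 e2) st (expr_cost e1 + expr_cost e2).+1 Q.
Proof.
exists (expr_cost e1 + expr_cost e2).+1, (set_cell p (value st e1) (value st e2) st).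
by split=> //; constructor.
Qed.

Lemma runs_query x p q st (Q : state -> Prop) :
  Q (set_var x (cmp (vec_of N st p) (vec_of N st q))%:Z st) ->
  runs (Query x p q) st 1 Q.
Proof. by exists 1%N; eexists; split; last exact: H; constructor. Qed.

Lemma runs_seq c1 c2 st T1 T2 (Q1 Q : state -> Prop) :
  runs c1 st T1 Q1 ->
  (forall st1, Q1 st1 -> framed (mod_vars c1) (mod_arrs c1) st st1 -> runs c2 st1 T2 Q) ->
  runs (Seq c1 c2) st (T1 + T2) Q.
Proof.
move=> [T1' [st1 [e1 le1 Q1st]]] H.
have [T2' [st2 [e2 le2 Qst]]] := H st1 Q1st (exec_framed e1).
by exists (T1' + T2')%N, st2; split=> //; [apply: ExecSeq e1 e2|apply: leq_add].
Qed.

Lemma runs_if e c1 c2 st T (Q : state -> Prop) :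
  (value st e != 0 -> runs c1 st T Q) -> (value st e = 0 -> runs c2 st T Q) ->
  runs (If e c1 c2) st (expr_cost e + T).+1 Q.
Proof.
move=> H1 H2; have [e0|e0] := eqVneq (value st e) 0.
  have [T' [st' [ex le_T Qst]]] := H2 e0.
  by exists (expr_cost e + T').+1, st'; split=> //; [apply: ExecIfFalse|rewrite ltnS leq_add2l].
have [T' [st' [ex le_T Qst]]] := H1 e0.
by exists (expr_cost e + T').+1, st'; split=> //; [apply: ExecIfTrue|rewrite ltnS leq_add2l].
Qed.

Lemma runs_while_true e c st T1 T2 (Q1 Q : state -> Prop) :
  value st e != 0 -> runs c st T1 Q1 ->
  (forall st1, Q1 st1 -> framed (mod_vars c) (mod_arrs c) st st1 ->
    runs (While e c) st1 T2 Q) ->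
  runs (While e c) st (expr_cost e + T1 + T2).+1 Q.
Proof.
move=> e0 [T1' [st1 [e1 le1 Q1st]]] H.
have [T2' [st2 [e2 le2 Qst]]] := H st1 Q1st (exec_framed e1).
exists (expr_cost e + T1' + T2').+1, st2; split=> //; first exact: ExecWhileTrue e1 e2.
by lia.
Qed.

Lemma runs_while_false e c st (Q : state -> Prop) :
  value st e = 0 -> Q st -> runs (While e c) st (expr_cost e).+1 Q.
Proof. by exists (expr_cost e).+1, st; split=> //; apply: ExecWhileFalse. Qed.

Definition For (i : nat) (e : expr) (c : cmd) : cmd :=
  Seq (Assign i (Cst 0))
    (While (Bin OpLe (Bin OpAdd (Var i) (Cst 1)) e)
       (Seq c (Assign i (Bin OpAdd (Var i) (Cst 1))))).

(** [Inv k] is stated with the counter already set to [k]. Per round, 4 units go to the increment,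
    [4 + expr_cost e] to the test and 1 to the loop; the final [7 + expr_cost e] pays for the
    initialization and the failing test. *)
Lemma runs_for i e c st m T (Inv : nat -> state -> Prop) :
  i \notin mod_vars c ->
  (forall st1, framed (i :: mod_vars c) (mod_arrs c) st st1 -> value st1 e = m%:Z) ->
  Inv 0%N (set_var i 0 st) ->
  (forall k st1, (k < m)%N -> framed (i :: mod_vars c) (mod_arrs c) st st1 ->
     vars st1 i = k%:Z -> Inv k st1 ->
     runs c st1 T (fun st2 => Inv k.+1 (set_var i k.+1%:Z st2))) ->
  runs (For i e c) st (m * (T + 9 + expr_cost e) + 7 + expr_cost e)%N (Inv m).
Proof.
move=> ic He Inv0 Hbody; set vs := i :: mod_vars c.
suff loop j st1 : (j <= m)%N -> framed vs (mod_arrs c) st st1 ->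
    vars st1 i = (m - j)%N%:Z -> Inv (m - j)%N st1 ->
    runs (While (Bin OpLe (Bin OpAdd (Var i) (Cst 1)) e)
       (Seq c (Assign i (Bin OpAdd (Var i) (Cst 1))))) st1
       (j * (T + 9 + expr_cost e) + 5 + expr_cost e)%N (Inv m).
  have -> : (m * (T + 9 + expr_cost e) + 7 + expr_cost e =
      2 + (m * (T + 9 + expr_cost e) + 5 + expr_cost e))%N by lia.
  apply: (runs_seq (Q1 := eq (set_var i 0 st))); first exact: runs_assign.
  move=> _ <- _; apply: (loop m) => //; rewrite ?subnn //=.
    by split=> //= x; rewrite inE negb_or => /andP[/negPf ->].
  by rewrite eqxx.
elim: j st1 => [|j IHj] st1 le_j fr vi Inv1.
  rewrite subn0 in vi Inv1.
  exists (expr_cost (Bin OpLe (Bin OpAdd (Var i) (Cst 1)) e)).+1, st1; split; [|by rewrite /=; lia|by []].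
  by apply: ExecWhileFalse => /=; rewrite vi (He _ fr); case: leP => //; lia.
have jm : (m - j.+1 < m)%N by lia.
have [T1 [st2 [e2 le2 Inv2]]] := Hbody _ _ jm fr vi Inv1.
have [fv2 fp2] := exec_framed e2.
pose st3 := set_var i (m - j)%N%:Z st2.
have e3 : exec cmp (Seq c (Assign i (Bin OpAdd (Var i) (Cst 1)))) st1 (T1 + 4) st3.
  apply: ExecSeq e2 _; rewrite /st3.
  have -> : (m - j)%N%:Z = value st2 (Bin OpAdd (Var i) (Cst 1)).
    by rewrite /= fv2 // vi; lia.
  exact: ExecAssign.
have [] := IHj st3 (ltnW le_j).
- split=> [x|p pn]; last by rewrite /= fp2 //; apply: (proj2 fr).
  rewrite inE negb_or => /andP[xi xc]; rewrite /= (negPf xi) fv2 //.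
  by rewrite (proj1 fr) // inE negb_or xi.
- by rewrite /st3 /= eqxx.
- by move: Inv2; rewrite /st3 (_ : (m - j.+1).+1 = m - j)%N //; lia.
move=> T2 [st4 [e4 le4 Inv4]].
exists (expr_cost (Bin OpLe (Bin OpAdd (Var i) (Cst 1)) e) + (T1 + 4) + T2).+1, st4.
split; [|by rewrite /=; lia|by []].
by apply: ExecWhileTrue e3 e4 => /=; rewrite vi (He _ fr); case: leP => //; lia.
Qed.

End Programs.

(** * The program and its specification *)

Declare Scope expr_scope.
Delimit Scope expr_scope with X.
Notation "x + y" := (Bin OpAdd x y) : expr_scope.
Notation "x - y" := (Bin OpSub x y) : expr_scope.
Notation "x * y" := (Bin OpMul x y) : expr_scope.
Notation "x / y" := (Bin OpDiv x y) : expr_scope.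
Notation "x <= y" := (Bin OpLe x y) : expr_scope.

Definition pos_expr (e : expr) : expr := (e * (Cst 0 <= e))%X.
Definition abs_expr (e : expr) : expr := (pos_expr e + pos_expr (Cst 0 - e))%X.
Definition mod_expr (e d : expr) : expr := (e - e / d * d)%X.

Lemma abs_pos_part (z : int) : pos_part z + pos_part (0 - z) = `|z|.
Proof. by rewrite /pos_part; nia. Qed.

Section Spec.
Variables (r s t n K M : nat) (A1 A2 : nat -> nat -> int) (b l u : nat -> int).
Let N := (n * t)%N.
Variables (R : realDomainType) (f : nat -> int -> R) (D : nat) (cmp : rel 'cV[int]_D).

Definition box (q : nat) (z : int) : int :=
  M%:Z * (pos_part (l q - z) + pos_part (z - u q)).

(* Variables: 0 n, 1 a, 2 n t, 3 K, 4 2K + 1, 5 number of states, 6 M,       *)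
(* 7 step g, 8 released coordinate k, 9 penalty, 10 layer, 11 and 12 states, *)
(* 13 energy, 14 to 17 and 19 scratch, 18 energy of the best candidate.      *)
(* Arrays: 5 current point, 6 and 7 table and next table (rows of length     *)
(* n t), 8 best candidate, 9 candidate, 10 powers of 2K + 1.                 *)
Record static (st : state) : Prop := Static {
  static_n : vars st 0%N = n%:Z;
  static_N : vars st 2%N = N%:Z;
  static_K : vars st 3%N = K%:Z;
  static_B : vars st 4%N = (2 * K).+1%:Z;
  static_S : vars st 5%N = (states t K)%:Z;
  static_M : vars st 6%N = M%:Z;
  static_A1 : forall i c, arrs st 0%N (i * t + c)%N%:Z = A1 i c;
  static_A2 : forall i c, arrs st 1%N (i * t + c)%N%:Z = A2 i c;
  static_b : forall i, arrs st 2%N i%:Z = b i;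
  static_l : forall q, arrs st 3%N q%:Z = l q;
  static_u : forall q, arrs st 4%N q%:Z = u q;
  static_pow : forall c, (c < t)%N -> arrs st 10%N c%:Z = ((2 * K).+1 ^ c)%N%:Z }.

Lemma static_framed vs ps st st' :
  framed vs ps st st' -> ~~ has (mem vs) [:: 0; 2; 3; 4; 5; 6]%N ->
  ~~ has (mem ps) [:: 0; 1; 2; 3; 4; 10]%N -> static st -> static st'.
Proof.
move=> [fv fp] /hasPn vn /hasPn pn [n_ N_ K_ B_ S_ M_ a1 a2 b_ l_ u_ w_].
by split=> *; rewrite ?fv ?fp ?a1 ?a2 ?w_ //; (apply: vn || apply: pn).
Qed.

Record context (g k : nat) (big : int) (x : nat -> int) (st : state) : Prop := Context {
  context_static : static st;
  context_g : vars st 7%N = g%:Z;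
  context_k : vars st 8%N = k%:Z;
  context_big : vars st 9%N = big;
  context_x : forall q, (q < N)%N -> arrs st 5%N q%:Z = x q }.

Lemma context_framed vs ps st st' g k big x :
  framed vs ps st st' -> ~~ has (mem vs) [:: 0; 2; 3; 4; 5; 6; 7; 8; 9]%N ->
  ~~ has (mem ps) [:: 0; 1; 2; 3; 4; 5; 10]%N ->
  context g k big x st -> context g k big x st'.
Proof.
move=> fr vn pn [stat g_ k_ big_ x_]; have [fv fp] := fr.
have /hasPn vn' := vn; have /hasPn pn' := pn.
split.
- apply: static_framed fr _ _ stat.
    by apply/hasPn => y; rewrite !inE => yin; apply: vn'; rewrite !inE; lia.
  by apply/hasPn => y; rewrite !inE => yin; apply: pn'; rewrite !inE; lia.
- by rewrite fv //; apply: vn'.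
- by rewrite fv //; apply: vn'.
- by rewrite fv //; apply: vn'.
- by move=> q qN; rewrite fp ?x_ //; apply: pn'.
Qed.

(** * Evaluating the energy of a stored vector *)

Definition holds_vec (p off : nat) (y : nat -> int) (st : state) : Prop :=
  forall q, (q < N)%N -> arrs st p (off + q)%N%:Z = y q.

Lemma holds_vec_framed vs ps p off y st st' :
  framed vs ps st st' -> p \notin ps -> holds_vec p off y st -> holds_vec p off y st'.
Proof. by move=> [_ fp] pn h q qN; rewrite fp // h. Qed.

Hypotheses (r_gt0 : (0 < r)%N) (s_gt0 : (0 < s)%N) (t_gt0 : (0 < t)%N) (n_gt0 : (0 < n)%N).

Definition eval_box (p : nat) : cmd :=
  For 14 (Var 2) (Assign 13
    (Var 13 + (Var 6 * (pos_expr (Get 3 (Var 14) - Get p (Var 14)) +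
                        pos_expr (Get p (Var 14) - Get 4 (Var 14))) +
       (Var 8 + Cst 1 <= Var 14) *
         (Var 9 * mod_expr (Get p (Var 14) - Get 5 (Var 14)) (Cst 2 * Var 7))))%X).

Lemma value_le_nat (i j : nat) : ((i%:Z <= j%:Z)%R : nat) = (i <= j)%N.
Proof. by rewrite lez_nat. Qed.

Lemma runs_eval_box p st g k big x y :
  context g k big x st -> holds_vec p 0 y st -> vars st 13 = 0 ->
  runs cmp (eval_box p) st (N * 100 + 10) (fun st' => vars st' 13 =
    \sum_(q < N) layer_cost box g k x big q (y q)).
Proof.
move=> ctx yp v0.
pose Inv m (st1 : state) := vars st1 13 = \sum_(q < m) layer_cost box g k x big q (y q).
apply: runs_le (@runs_for _ cmp 14%N (Var 2) _ st N 80 Inv _ _ _ _) => //=; first by lia.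
- by move=> st1 fr /=; rewrite (proj1 fr) // (static_N (context_static ctx)).
- by rewrite /Inv /= v0 big_ord0.
move=> m st1 mN fr v14 inv1.
have [stat g_ k_ big_ x_] := context_framed fr isT isT ctx.
have yp1 := holds_vec_framed fr isT yp.
apply: runs_le (runs_assign _ _); first by [].
rewrite /Inv big_ord_recr -inv1 /=.
rewrite v14 g_ k_ big_ x_ // (yp1 m mN) (static_M stat) (static_l stat) (static_u stat).
rewrite /layer_cost /box.
by rewrite -[k%:Z + 1]/((k + 1)%N%:Z) value_le_nat addn1.
Qed.
Definition eval_row1 (p : nat) : cmd :=
  For 14 (Var 2) (Assign 15
    (Var 15 + Get 0 (Var 17 * Cst t%:Z + mod_expr (Var 14) (Cst t%:Z)) * Get p (Var 14))%X).

Lemma runs_eval_row1 p st i y acc :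
  static st -> holds_vec p 0 y st -> vars st 17 = i%:Z -> vars st 15 = acc ->
  runs cmp (eval_row1 p) st (N * 40 + 10)
    (fun st' => vars st' 15 = acc + row1 t A1 N i y).
Proof.
move=> stat yp v17 v15.
pose Inv m (st1 : state) := vars st1 15 = acc + \sum_(q < m) A1 i (q %% t)%N * y q.
apply: runs_le (@runs_for _ cmp 14%N (Var 2) _ st N 25 Inv _ _ _ _) => //=; first by lia.
- by move=> st1 fr /=; rewrite (proj1 fr) // (static_N stat).
- by rewrite /Inv /= v15 big_ord0 addr0.
move=> m st1 mN fr v14 inv1; have stat1 := static_framed fr isT isT stat.
have yp1 := holds_vec_framed fr isT yp.
apply: runs_le (runs_assign _ _); first by [].
rewrite /Inv big_ord_recr addrA -inv1 /=.
rewrite v14 (proj1 fr 17%N isT) v17 (yp1 m mN).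
by rewrite -[_ - _]/((m%:Z %% t%:Z)%Z) modz_nat -PoszM -PoszD (static_A1 stat1).
Qed.

Definition eval_rows1 (p : nat) : cmd :=
  For 17 (Cst r%:Z)
    (Seq (Assign 15 (Cst 0 - Get 2 (Var 17))%X)
    (Seq (eval_row1 p)
         (Assign 13 (Var 13 + abs_expr (Var 15))%X))).

Lemma runs_eval_rows1 p st y v : static st -> holds_vec p 0 y st -> vars st 13 = v ->
  runs cmp (eval_rows1 p) st (r * (N * 40 + 60) + 10) (fun st' => vars st' 13 =
    v + \sum_(i < r) `|row1 t A1 N i y - b i|).
Proof.
move=> stat yp v13.
pose Inv m (st1 : state) := vars st1 13 = v + \sum_(i < m) `|row1 t A1 N i y - b i|.
apply: runs_le (@runs_for _ cmp 17%N (Cst r%:Z) _ st r (5 + (N * 40 + 10 + 20)) Inv _ _ _ _) => //=.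
- by lia.
- by rewrite /Inv /= v13 big_ord0 addr0.
move=> m st1 mr fr v17 inv1; have stat1 := static_framed fr isT isT stat.
have yp1 := holds_vec_framed fr isT yp.
apply: (runs_seq (Q1 := fun st2 => vars st2 15 = - b m)).
  by apply: runs_assign; rewrite /= v17 (static_b stat1) sub0r.
move=> st2 v15 fr2; have stat2 := static_framed fr2 isT isT stat1.
have yp2 := holds_vec_framed fr2 isT yp1.
have v17' : vars st2 17 = m%:Z by rewrite (proj1 fr2).
apply: runs_seq (runs_eval_row1 stat2 yp2 v17' v15) _ => st3 v15' fr3.
apply: runs_le (runs_assign _ _); first by [].
rewrite /Inv big_ord_recr addrA -inv1 /= v15' abs_pos_part.
by rewrite (proj1 fr3 13%N isT) (proj1 fr2 13%N isT) [- b _ + _]addrC.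
Qed.

Definition eval_row2 (p : nat) : cmd :=
  For 16 (Cst t%:Z) (Assign 15
    (Var 15 + Get 1 (mod_expr (Var 17) (Cst s%:Z) * Cst t%:Z + Var 16) *
       Get p (Var 17 / Cst s%:Z * Cst t%:Z + Var 16))%X).

Lemma runs_eval_row2 p st w y acc : (w < n * s)%N ->
  static st -> holds_vec p 0 y st -> vars st 17 = w%:Z -> vars st 15 = acc ->
  runs cmp (eval_row2 p) st (t * 40 + 10)
    (fun st' => vars st' 15 = acc + row2 s t A2 w y).
Proof.
move=> wn stat yp v17 v15.
pose Inv m (st1 : state) := vars st1 15 = acc +
  \sum_(c < m) A2 (w %% s)%N c * y (w %/ s * t + c)%N.
apply: runs_le (@runs_for _ cmp 16%N (Cst t%:Z) _ st t 30 Inv _ _ _ _) => //=; first by lia.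
- by rewrite /Inv /= v15 big_ord0 addr0.
move=> m st1 mt fr v16 inv1; have stat1 := static_framed fr isT isT stat.
have yp1 := holds_vec_framed fr isT yp.
have jN : (w %/ s * t + m < N)%N.
  have : (w %/ s < n)%N by rewrite ltn_divLR.
  by rewrite /N; move: (w %/ s)%N => j; nia.
apply: runs_le (runs_assign _ _); first by [].
rewrite /Inv big_ord_recr addrA -inv1 /=.
rewrite v16 (proj1 fr 17%N isT) v17 -[w%:Z - _]/((w%:Z %% s%:Z)%Z) modz_nat divz_nat.
by rewrite -!PoszM -!PoszD (static_A2 stat1) (yp1 _ jN).
Qed.

Definition eval_rows2 (p : nat) : cmd :=
  For 17 (Var 0 * Cst s%:Z)%X
    (Seq (Assign 15 (Cst 0 - Get 2 (Cst r%:Z + Var 17))%X)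
    (Seq (eval_row2 p)
         (Assign 13 (Var 13 + abs_expr (Var 15))%X))).

Lemma runs_eval_rows2 p st y v : static st -> holds_vec p 0 y st -> vars st 13 = v ->
  runs cmp (eval_rows2 p) st (n * s * (t * 40 + 60) + 10) (fun st' => vars st' 13 =
    v + \sum_(w < n * s) `|row2 s t A2 w y - b (r + w)%N|).
Proof.
move=> stat yp v13.
pose Inv m (st1 : state) := vars st1 13 =
  v + \sum_(w < m) `|row2 s t A2 w y - b (r + w)%N|.
apply: runs_le (@runs_for _ cmp 17%N _ _ st (n * s)%N (7 + (t * 40 + 10 + 20)) Inv _ _ _ _) => //=.
- by lia.
- by move=> st1 fr /=; rewrite (proj1 fr) // (static_n stat) PoszM.
- by rewrite /Inv /= v13 big_ord0 addr0.
move=> m st1 mr fr v17 inv1; have stat1 := static_framed fr isT isT stat.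
have yp1 := holds_vec_framed fr isT yp.
apply: (runs_seq (Q1 := fun st2 => vars st2 15 = - b (r + m)%N)).
  by apply: runs_assign; rewrite /= v17 -PoszD (static_b stat1) sub0r.
move=> st2 v15 fr2; have stat2 := static_framed fr2 isT isT stat1.
have yp2 := holds_vec_framed fr2 isT yp1.
have v17' : vars st2 17 = m%:Z by rewrite (proj1 fr2).
apply: runs_seq (runs_eval_row2 mr stat2 yp2 v17' v15) _ => st3 v15' fr3.
apply: runs_le (runs_assign _ _); first by [].
rewrite /Inv big_ord_recr addrA -inv1 /= v15' abs_pos_part.
by rewrite (proj1 fr3 13%N isT) (proj1 fr2 13%N isT) [- b _ + _]addrC.
Qed.

Definition eval (p : nat) : cmd :=
  Seq (Assign 13 (Cst 0)) (Seq (eval_box p) (Seq (eval_rows1 p) (eval_rows2 p))).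

Definition eval_time : nat :=
  (2 + (N * 100 + 10 + (r * (N * 40 + 60) + 10 + (n * s * (t * 40 + 60) + 10))))%N.

Lemma runs_eval p st g k big x y : context g k big x st -> holds_vec p 0 y st ->
  runs cmp (eval p) st eval_time (fun st' => vars st' 13 =
    energy r s t n A1 A2 b (layer_cost box g k x big) y).
Proof.
move=> ctx yp; rewrite /eval_time.
apply: (runs_seq (Q1 := fun st1 => vars st1 13 = 0)); first exact: runs_assign.
move=> st1 v13 fr1; have ctx1 := context_framed fr1 isT isT ctx.
have yp1 := holds_vec_framed fr1 isT yp.
apply: runs_seq (runs_eval_box ctx1 yp1 v13) _ => st2 v13' fr2.
have ctx2 := context_framed fr2 isT isT ctx1; have yp2 := holds_vec_framed fr2 isT yp1.
apply: runs_seq (runs_eval_rows1 (context_static ctx2) yp2 v13') _ => st3 v13'' fr3.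
have ctx3 := context_framed fr3 isT isT ctx2; have yp3 := holds_vec_framed fr3 isT yp2.
by apply: runs_weaken (runs_eval_rows2 (context_static ctx3) yp3 v13'').
Qed.

(** * Filling the table *)

Definition copy (p : nat) (po : expr) (q : nat) (qo : expr) : cmd :=
  For 14 (Var 2) (Put q (qo + Var 14)%X (Get p (po + Var 14)%X)).

Definition copy_time : nat := (N * 40 + 10)%N.

(** The second conclusion protects the other rows when the target array is a table. *)
Lemma runs_copy p po q qo off off' st y :
  p != q -> (expr_cost po <= 5)%N -> (expr_cost qo <= 5)%N -> static st ->
  (forall st1, framed [:: 14] [:: q] st st1 -> value st1 po = off%:Z) ->
  (forall st1, framed [:: 14] [:: q] st st1 -> value st1 qo = off'%:Z) ->
  holds_vec p off y st ->
  runs cmp (copy p po q qo) st copy_time (fun st' => holds_vec q off' y st' /\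
    forall j, (j < off')%N || (off' + N <= j)%N -> arrs st' q j%:Z = arrs st q j%:Z).
Proof.
move=> pq po_le qo_le stat po_val qo_val yp.
pose Inv m (st1 : state) := forall j : nat, arrs st1 q j%:Z =
  if (off' <= j < off' + m)%N then y (j - off')%N else arrs st q j%:Z.
apply: runs_weaken (@runs_for _ cmp 14%N (Var 2) _ st N 20 Inv _ _ _ _) => //=.
- by rewrite /copy_time; lia.
- move=> st' inv; split=> [j jN|j jout]; rewrite inv.
    by rewrite leq_addr ltn_add2l jN addKn.
  by rewrite (_ : (off' <= j < off' + N)%N = false) //; lia.
- by move=> st1 fr /=; rewrite (proj1 fr) // (static_N stat).
- by move=> j; rewrite addn0 leqNgt andNb.
move=> m st1 mN fr v14 inv.
apply: runs_le (runs_put _ _); first by rewrite /=; lia.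
move=> j /=; rewrite (qo_val st1 fr) (po_val st1 fr) v14 -!PoszD.
rewrite (proj2 fr p) ?inE // (yp m mN) eqxx /= eqz_nat inv.
have [->|jm] := eqVneq j (off' + m)%N; first by rewrite leq_addr addnS leqnn addKn.
by rewrite addnS ltnS (leq_eqVlt j) (negPf jm).
Qed.

Definition add_brick (p : nat) (base d : expr) : cmd :=
  For 16 (Cst t%:Z)
    (Put p (base + Var 16)%X (Get p (base + Var 16) + Var 7 * d)%X).

Definition brick_time : nat := (t * 80 + 10)%N.

Lemma runs_add_brick p base d j (delta : nat -> int) st g y :
  (expr_cost base <= 5)%N -> (expr_cost d <= 40)%N -> vars st 7 = g%:Z ->
  (forall st1, framed [:: 16] [:: p] st st1 -> value st1 base = (j * t)%N%:Z) ->
  (forall c st1, (c < t)%N -> framed [:: 16] [:: p] st st1 ->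
     vars st1 16 = c%:Z -> value st1 d = delta c) ->
  holds_vec p 0 y st ->
  runs cmp (add_brick p base d) st brick_time (fun st' => holds_vec p 0
    (translate y g (fun q => if (q %/ t == j)%N then delta (q %% t)%N else 0)) st').
Proof.
move=> base_le d_le v7 base_val d_val yp.
pose Inv m (st1 : state) := forall q : nat, arrs st1 p q%:Z =
  if (j * t <= q < j * t + m)%N then arrs st p q%:Z + g%:Z * delta (q - j * t)%N
  else arrs st p q%:Z.
apply: runs_weaken (@runs_for _ cmp 16%N (Cst t%:Z) _ st t 65 Inv _ _ _ _) => //=.
- by rewrite /brick_time; lia.
- move=> st' inv q qN; rewrite add0n inv /translate -(yp q qN) add0n.
  have -> : (j * t <= q < j * t + t)%N = (q %/ t == j)%N.
    by rewrite eqn_leq andbC leq_divRL // -[(q %/ t <= j)%N]ltnS ltn_divLR // mulSn addnC.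
  case: eqP => [<-|_]; last by rewrite mulr0 addr0.
  have -> : (q - q %/ t * t = q %% t)%N by rewrite {1}(divn_eq q t) addKn.
  by [].
- by move=> q; rewrite addn0 leqNgt andNb.
move=> m st1 mt fr v16 inv.
apply: runs_le (runs_put _ _); first by rewrite /=; lia.
move=> q /=; rewrite (base_val st1 fr) (d_val m st1 mt fr v16) v16 -!PoszD.
rewrite (proj1 fr 7%N isT) v7 eqxx /= eqz_nat !inv ltnn andbF.
have [->|qm] := eqVneq q (j * t + m)%N; first by rewrite leq_addr addnS leqnn addKn.
by rewrite addnS ltnS (leq_eqVlt q) (negPf qm).
Qed.

Definition digit_expr (x : nat) : expr :=
  (mod_expr (Var x / Get 10 (Var 16)) (Var 4) - Var 3)%X.

Lemma value_digit st x sigma c : static st -> (c < t)%N ->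
  vars st 16 = c%:Z -> vars st x = sigma%:Z ->
  value st (digit_expr x) = digit K c sigma.
Proof.
move=> stat ct v16 vx /=; rewrite vx v16 (static_pow stat ct) (static_B stat) (static_K stat).
by rewrite -[X in X - K%:Z]/((sigma%:Z %/ _)%Z %% _)%Z divz_nat modz_nat.
Qed.

Hypothesis cmpE : forall st p q y z, holds_vec p 0 y st -> holds_vec q 0 z st ->
  cmp (vec_of D st p) (vec_of D st q) = (total t n f y <= total t n f z).

Section Step.
Variables (g k : nat) (big : int) (x : nat -> int).
Let tbl := table r s t n A1 A2 b f box g k K x big.
Let cand := candidate r s t n A1 A2 b f box g k K x big.
Let energy_of := energy r s t n A1 A2 b (layer_cost box g k x big).

Definition holds_table (p i m : nat) (st : state) : Prop :=
  forall sigma, (sigma < m)%N -> holds_vec p (sigma * N) (tbl i sigma) st.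

Lemma holds_table_framed vs ps p i m st st' :
  framed vs ps st st' -> p \notin ps -> holds_table p i m st -> holds_table p i m st'.
Proof. by move=> fr pn h sigma sm; apply: holds_vec_framed fr pn (h _ sm). Qed.

Lemma holds_tableS p i m st st' : holds_table p i m st ->
  holds_vec p (m * N) (tbl i m) st' ->
  (forall j, (j < m * N)%N || (m * N + N <= j)%N -> arrs st' p j%:Z = arrs st p j%:Z) ->
  holds_table p i m.+1 st'.
Proof.
move=> h hm same sigma; rewrite ltnS leq_eqVlt => /orP[/eqP ->//|sm] q qN.
rewrite same ?h //; apply/orP; left.
have : (sigma.+1 * N <= m * N)%N by rewrite leq_mul2r sm orbT.
by rewrite mulSn; lia.
Qed.

Definition init_table : cmd :=
  For 11 (Var 5)
    (Seq (copy 5 (Cst 0) 8 (Cst 0))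
    (Seq (add_brick 8 (Cst 0) (digit_expr 11))
         (copy 8 (Cst 0) 6 (Var 11 * Var 2)%X))).

Lemma runs_init_table st : context g k big x st ->
  runs cmp init_table st
    (states t K * (copy_time + (brick_time + copy_time) + 10) + 8)
    (holds_table 6 0 (states t K)).
Proof.
move=> ctx; have stat := context_static ctx.
apply: runs_le (@runs_for _ cmp 11%N (Var 5) _ st (states t K)
    (copy_time + (brick_time + copy_time)) (holds_table 6 0) _ _ _ _) => //=.
- by rewrite -!addnA.
- by move=> st1 fr /=; rewrite (proj1 fr) // (static_S stat).
move=> m st1 mS fr v11 inv.
have ctx1 := context_framed fr isT isT ctx.
apply: runs_seq (runs_copy (off := 0) (off' := 0) (y := x) _ _ _ (context_static ctx1) _ _ _) _ => //.
  exact: context_x ctx1.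
move=> st2 [h8 _] fr2; have ctx2 := context_framed fr2 isT isT ctx1.
apply: runs_seq.
  apply: (runs_add_brick (j := 0) (delta := fun c => digit K c m) _ _ (context_g ctx2) _ _ h8) => //.
  move=> c st3 ct fr3 v16; have ctx3 := context_framed fr3 isT isT ctx2.
  apply: value_digit (context_static ctx3) ct v16 _.
  by rewrite (proj1 fr3) // (proj1 fr2).
move=> st3 h8' fr3; have ctx3 := context_framed fr3 isT isT ctx2.
have v11' : vars st3 11 = m%:Z by rewrite (proj1 fr3) // (proj1 fr2).
apply: runs_weaken (leqnn _) _ (runs_copy (off := 0) (off' := m * N) _ _ _ (context_static ctx3) _ _ h8') => //.
  move=> st4 [h6 same]; have inv3 := holds_table_framed (p := 6%N) fr2 isT inv.
  have inv3' := holds_table_framed (p := 6%N) fr3 isT inv3.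
  exact: holds_tableS inv3' h6 same.
by move=> st4 fr4 /=; rewrite !(proj1 fr4) // v11' (static_N (context_static ctx3)) PoszM.
Qed.

(** In the extra layer [n] the brick is written past the first [n t] cells of array 9, so the vector
    read from there is unchanged. *)
Definition build : cmd :=
  Seq (copy 6 (Var 12 * Var 2)%X 9 (Cst 0))
      (add_brick 9 ((Var 10 + Cst 1) * Cst t%:Z)%X (digit_expr 11 - digit_expr 12)%X).

Definition build_time : nat := (copy_time + brick_time)%N.

Lemma runs_build st i sigma sigma' : context g k big x st ->
  vars st 10 = i%:Z -> vars st 11 = sigma%:Z -> vars st 12 = sigma'%:Z ->
  holds_table 6 i (states t K) st -> (sigma' < states t K)%N ->
  runs cmp build st build_time (holds_vec 9 0 (cand i sigma sigma')).
Proof.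
move=> ctx v10 v11 v12 htab s'S.
apply: runs_seq (runs_copy (off := sigma' * N) (off' := 0) (y := tbl i sigma')
  _ _ _ (context_static ctx) _ _ _) _ => //.
- move=> st1 fr /=.
  by rewrite !(proj1 fr) // v12 (static_N (context_static ctx)) PoszM.
- exact: htab.
move=> st1 [h9 _] fr1; have ctx1 := context_framed fr1 isT isT ctx.
have bump_if q : bump t K i.+1 sigma q - bump t K i.+1 sigma' q =
    if (q %/ t == i.+1)%N then digit K (q %% t) sigma - digit K (q %% t) sigma' else 0.
  by rewrite /bump; case: eqP => // _; rewrite subrr.
apply: runs_weaken (leqnn _) _ (runs_add_brick (j := i.+1)
  (delta := fun c => digit K c sigma - digit K c sigma') _ _ (context_g ctx1) _ _ h9) => //.
- by move=> st2 h q qN; rewrite h // /cand /candidate /translate bump_if.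
- move=> st2 fr2 /=; rewrite (proj1 fr2) // (proj1 fr1) // v10.
  by rewrite -PoszD addn1 PoszM.
move=> c st2 ct fr2 v16; have stat2 := context_static (context_framed fr2 isT isT ctx1).
rewrite -[value _ _]/(value st2 (digit_expr 11) - value st2 (digit_expr 12)).
congr (_ - _); apply: value_digit => //.
  by rewrite (proj1 fr2) // (proj1 fr1).
by rewrite (proj1 fr2) // (proj1 fr1).
Qed.

(** The lexicographic test in the arithmetic of the language: [e + 1 <= e'] is strict comparison of
    integers, and the product of the two weak comparisons tests equality. *)
Lemma improve_test (e e' : int) (o : bool) :
  ((e + 1 <= e')%R%:Z + (e <= e')%R%:Z * (e' <= e)%R%:Z * o%:Z != 0 :> int) =
  (e < e') || ((e == e') && o).
Proof. by case: o; lia. Qed.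

Definition improve : cmd :=
  Seq build
  (Seq (eval 9)
  (Seq (Query 19 9 8)
       (If ((Var 13 + Cst 1 <= Var 18) +
            (Var 13 <= Var 18) * (Var 18 <= Var 13) * Var 19)%X
          (Seq (copy 9 (Cst 0) 8 (Cst 0)) (Assign 18 (Var 13)))
          Skip))).

Definition improve_time : nat :=
  (build_time + (eval_time + (1 + (20 + copy_time))))%N.

Lemma runs_improve st i sigma sigma' y : context g k big x st ->
  vars st 10 = i%:Z -> vars st 11 = sigma%:Z -> vars st 12 = sigma'%:Z ->
  holds_table 6 i (states t K) st -> (sigma' < states t K)%N ->
  holds_vec 8 0 y st -> vars st 18 = energy_of y ->
  let y' := pick r s t n A1 A2 b f box g k x big y (cand i sigma sigma') in
  runs cmp improve st improve_time
    (fun st' => holds_vec 8 0 y' st' /\ vars st' 18 = energy_of y').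
Proof.
move=> ctx v10 v11 v12 htab s'S h8 v18 /=.
apply: runs_seq (runs_build ctx v10 v11 v12 htab s'S) _ => st1 h9 fr1.
have ctx1 := context_framed fr1 isT isT ctx.
have h81 := holds_vec_framed (p := 8%N) fr1 isT h8.
apply: runs_seq (runs_eval ctx1 h9) _ => st2 v13 fr2.
have ctx2 := context_framed fr2 isT isT ctx1.
have h82 := holds_vec_framed (p := 8%N) fr2 isT h81.
have h92 := holds_vec_framed (p := 9%N) fr2 isT h9.
have v18' : vars st2 18 = energy_of y by rewrite (proj1 fr2) // (proj1 fr1).
set z := cand i sigma sigma' in h9 h92 v13 *.
apply: (runs_seq (Q1 := fun st3 => vars st3 19 = (total t n f z <= total t n f y)%R%:Z)).
  by apply: runs_query; rewrite /= (cmpE h92 h82).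
move=> st3 v19 fr3; have ctx3 := context_framed fr3 isT isT ctx2.
have h83 := holds_vec_framed (p := 8%N) fr3 isT h82.
have h93 := holds_vec_framed (p := 9%N) fr3 isT h92.
have v13' : vars st3 13 = energy_of z by rewrite (proj1 fr3).
have v18'' : vars st3 18 = energy_of y by rewrite (proj1 fr3).
apply: runs_le (runs_if (T := copy_time + 2) _ _).
- by rewrite /=; lia.
- rewrite /= v13' v18'' v19 improve_test => test.
  rewrite /pick /lex_le test.
  apply: runs_seq (runs_copy (off := 0) (off' := 0) _ _ _ (context_static ctx3) _ _ h93) _ => //.
  move=> st4 [h84 _] fr4; apply: runs_assign; split=> [q qN|]; first exact: h84.
  by rewrite /= (proj1 fr4).
- rewrite /= v13' v18'' v19 => /eqP; rewrite -[_ == _]negbK improve_test => /negPf test.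
  rewrite /pick /lex_le test.
  by apply: runs_le (runs_skip _ _) => //; lia.
Qed.

(** Candidate 0 is used as initial value and met again by the loop, exactly as in [best]. *)
Definition state_step : cmd :=
  Seq (Assign 12 (Cst 0))
  (Seq build
  (Seq (copy 9 (Cst 0) 8 (Cst 0))
  (Seq (eval 8)
  (Seq (Assign 18 (Var 13))
  (Seq (For 12 (Var 5) improve)
       (copy 8 (Cst 0) 7 (Var 11 * Var 2)%X)))))).

Definition state_time : nat :=
  (2 + (build_time + (copy_time + (eval_time + (2 +
    (states t K * (improve_time + 9 + 1) + 7 + 1 + copy_time))))))%N.

Lemma runs_state_step st i sigma : context g k big x st ->
  vars st 10 = i%:Z -> vars st 11 = sigma%:Z ->
  holds_table 6 i (states t K) st ->
  runs cmp state_step st state_time (fun st' =>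
    holds_vec 7 (sigma * N) (tbl i.+1 sigma) st' /\
    forall j, (j < sigma * N)%N || (sigma * N + N <= j)%N ->
      arrs st' 7%N j%:Z = arrs st 7%N j%:Z).
Proof.
move=> ctx v10 v11 htab; rewrite /state_step.
apply: (runs_seq (Q1 := fun st1 => vars st1 12 = 0)); first exact: runs_assign.
move=> st1 v12 fr1; have ctx1 := context_framed fr1 isT isT ctx.
have v10_1 : vars st1 10 = i%:Z by rewrite (proj1 fr1).
have v11_1 : vars st1 11 = sigma%:Z by rewrite (proj1 fr1).
have htab1 := holds_table_framed (p := 6%N) fr1 isT htab.
have S_gt0 : (0 < states t K)%N by apply: states_gt0.
apply: runs_seq (runs_build ctx1 v10_1 v11_1 v12 htab1 S_gt0) _ => st2 h9 fr2.
have ctx2 := context_framed fr2 isT isT ctx1.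
apply: runs_seq (runs_copy (off := 0) (off' := 0) _ _ _ (context_static ctx2) _ _ h9) _ => //.
move=> st3 [h8 _] fr3; have ctx3 := context_framed fr3 isT isT ctx2.
apply: runs_seq (runs_eval ctx3 h8) _ => st4 v13 fr4.
have ctx4 := context_framed fr4 isT isT ctx3.
have h84 := holds_vec_framed (p := 8%N) fr4 isT h8.
apply: (runs_seq (Q1 := fun st5 => vars st5 18 = energy_of (cand i sigma 0))).
  exact: runs_assign.
move=> st5 v18 fr5; have ctx5 := context_framed fr5 isT isT ctx4.
have h85 := holds_vec_framed (p := 8%N) fr5 isT h84.
have htab2 := holds_table_framed (p := 6%N) fr2 isT htab1.
have htab3 := holds_table_framed (p := 6%N) fr3 isT htab2.
have htab4 := holds_table_framed (p := 6%N) fr4 isT htab3.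
have htab5 := holds_table_framed (p := 6%N) fr5 isT htab4.
have v10_5 : vars st5 10 = i%:Z.
  by rewrite (proj1 fr5) // (proj1 fr4) // (proj1 fr3) // (proj1 fr2).
have v11_5 : vars st5 11 = sigma%:Z.
  by rewrite (proj1 fr5) // (proj1 fr4) // (proj1 fr3) // (proj1 fr2).
pose bst m := best r s t n A1 A2 b f box g k x big (cand i sigma) m.
pose Inv m st6 := holds_vec 8 0 (bst m) st6 /\ vars st6 18 = energy_of (bst m).
apply: (runs_seq (@runs_for _ cmp 12%N (Var 5) _ st5 (states t K) improve_time Inv _ _ _ _)) => //.
- by move=> st6 fr /=; rewrite (proj1 fr) // (static_S (context_static ctx5)).
- move=> m st6 mS fr v12' [h8' v18']; have ctx6 := context_framed fr isT isT ctx5.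
  have htab6 := holds_table_framed (p := 6%N) fr isT htab5.
  apply: runs_improve ctx6 _ _ v12' htab6 mS h8' v18'; by rewrite (proj1 fr).
move=> st6 [h86 _] fr6; have ctx6 := context_framed fr6 isT isT ctx5.
apply: runs_weaken (leqnn _) _ (runs_copy (off := 0) (off' := sigma * N) _ _ _
  (context_static ctx6) _ _ h86) => //.
  move=> st7 [h7 same]; split=> [//|j jout]; rewrite same //.
  rewrite (proj2 fr6) // (proj2 fr5) // (proj2 fr4) // (proj2 fr3) // (proj2 fr2) //.
  by rewrite (proj2 fr1).
move=> st7 fr7 /=; rewrite !(proj1 fr7) // (proj1 fr6) // v11_5.
by rewrite (static_N (context_static ctx6)) PoszM.
Qed.

(** Every new row is computed from all the old rows, so new rows are collected in array 7 and copied
    back to array 6 afterwards. *)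
Definition layer : cmd :=
  Seq (For 11 (Var 5) state_step)
      (For 11 (Var 5) (copy 7 (Var 11 * Var 2)%X 6 (Var 11 * Var 2)%X)).

Definition layer_time : nat :=
  (states t K * (state_time + 9 + 1) + 7 + 1 +
   (states t K * (copy_time + 9 + 1) + 7 + 1))%N.

Lemma runs_layer st i : context g k big x st -> vars st 10 = i%:Z ->
  holds_table 6 i (states t K) st ->
  runs cmp layer st layer_time (holds_table 6 i.+1 (states t K)).
Proof.
move=> ctx v10 htab; rewrite /layer.
apply: (runs_seq (@runs_for _ cmp 11%N (Var 5) _ st (states t K) state_time
  (holds_table 7 i.+1) _ _ _ _)) => //.
- by move=> st1 fr /=; rewrite (proj1 fr) // (static_S (context_static ctx)).
- move=> m st1 mS fr v11 inv; have ctx1 := context_framed fr isT isT ctx.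
  have htab1 := holds_table_framed (p := 6%N) fr isT htab.
  have v10_1 : vars st1 10 = i%:Z by rewrite (proj1 fr).
  apply: runs_weaken (leqnn _) _ (runs_state_step ctx1 v10_1 v11 htab1) => st2 [h7 same].
  exact: holds_tableS inv h7 same.
move=> st1 htab7 fr1; have ctx1 := context_framed fr1 isT isT ctx.
apply: (@runs_for _ cmp 11%N (Var 5) _ st1 (states t K) copy_time (holds_table 6 i.+1)) => //.
- by move=> st2 fr /=; rewrite (proj1 fr) // (static_S (context_static ctx1)).
move=> m st2 mS fr v11 inv; have ctx2 := context_framed fr isT isT ctx1.
have h7 := holds_vec_framed (p := 7%N) fr isT (htab7 m mS).
have off_val st3 : framed [:: 14%N] [:: 6%N] st2 st3 ->
    value st3 (Var 11 * Var 2)%X = (m * N)%N%:Z.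
  by move=> fr3 /=; rewrite !(proj1 fr3) // v11 (static_N (context_static ctx2)) PoszM.
apply: runs_weaken (leqnn _) _ (runs_copy _ _ _ (context_static ctx2) off_val off_val h7) => //.
by move=> st3 [h6 same]; apply: holds_tableS inv h6 same.
Qed.

Definition layers : cmd := For 10 (Var 0) layer.

Lemma runs_layers st : context g k big x st -> holds_table 6 0 (states t K) st ->
  runs cmp layers st (n * (layer_time + 9 + 1) + 7 + 1) (holds_table 6 n (states t K)).
Proof.
move=> ctx htab.
apply: (@runs_for _ cmp 10%N (Var 0) _ st n layer_time
  (fun m => holds_table 6 m (states t K))) => //.
- by move=> st1 fr /=; rewrite (proj1 fr) // (static_n (context_static ctx)).
- move=> m st1 mn fr v10 inv; have ctx1 := context_framed fr isT isT ctx.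
  exact: runs_layer ctx1 v10 inv.
Qed.

End Step.

End Spec.

Lemma framed_set_var x v st : framed [:: x] [::] st (set_var x v st).
Proof. by split=> //= y; rewrite inE => /negPf ->. Qed.

Lemma pos_part_ge0 z : 0 <= pos_part z.
Proof. by rewrite /pos_part; nia. Qed.

Lemma box_ge0 M l u q z : 0 <= box M l u q z.
Proof. by rewrite mulr_ge0 // addr_ge0 // pos_part_ge0. Qed.

Lemma box_convex M l u q : convex_at (box M l u q).
Proof.
move=> x w h hw; rewrite /box -!mulrDr ler_wpM2l //.
have := (convex_pos_part (l q)).2 x w h hw; have := (convex_pos_part (u q)).1 x w h hw.
by lia.
Qed.

(** * Scaling from a coarse start to the global optimum *)

Section Main.
Variables (r s t n K a : nat) (A1 A2 : nat -> nat -> int) (b l u : nat -> int).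
Hypotheses (r_gt0 : (0 < r)%N) (s_gt0 : (0 < s)%N) (t_gt0 : (0 < t)%N) (n_gt0 : (0 < n)%N).
Hypothesis a_gt0 : (0 < a)%N.
Hypothesis A1_le : forall i c, `|A1 i c| <= a%:Z.
Hypothesis A2_le : forall i c, `|A2 i c| <= a%:Z.
Hypothesis K_large : (split_bound r s a <= K)%N.
Let N := (n * t)%N.
(* The slope of the box penalty beats twice the l1 norm of a column.         *)
Let M := (2 * ((r + s) * a + 1))%N.
Variables (R : realDomainType) (f : nat -> int -> R) (D : nat) (cmp : rel 'cV[int]_D).
Hypothesis f_convex : forall q, (q < N)%N -> convex_at (f q).
Hypothesis cmpE : forall st p q y z, holds_vec t n p 0 y st -> holds_vec t n q 0 z st ->
  cmp (vec_of D st p) (vec_of D st q) = (total t n f y <= total t n f z).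

Let stat := static t n K M A1 A2 b l u.
Let bx := box M l u.
Let opt := released r s t n A1 A2 b f bx.

(** At distance four times the size of the bounds, the box violation exceeds that at 0 by at least
    [|y| / 2], and [M] is twice the slope wanted. *)
Lemma box_growth q (y : int) :
  y = 0 \/ 4 * (`|l q| + `|u q|) <= `|y| ->
  bx q 0 + ((r + s) * a + 1)%N%:Z * `|y| <= bx q y.
Proof.
move=> y_large; have : 2 * (pos_part (l q - 0) + pos_part (0 - u q)) + `|y| <=
    2 * (pos_part (l q - y) + pos_part (y - u q)).
  by rewrite /pos_part; move: (l q) (u q) y_large => l' u'; nia.
by rewrite /bx /box /M; move: (pos_part _ + _) (pos_part _ + _) => p1 p2; nia.
Qed.

Lemma sum_row1_le y :
  \sum_(i < r) `|row1 t A1 N i y| <= (r * a)%N%:Z * \sum_(q < N) `|y q|.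
Proof.
apply: le_trans (_ : \sum_(i < r) a%:Z * \sum_(q < N) `|y q| <= _).
  apply: ler_sum => i _; apply: le_trans (ler_norm_sum _ _ _) _.
  by rewrite mulr_sumr; apply: ler_sum => q _; rewrite normrM ler_wpM2r.
by rewrite sumr_const card_ord PoszM -mulr_natl natz mulrA.
Qed.

Lemma sum_row2_le y :
  \sum_(w < n * s) `|row2 s t A2 w y| <= (s * a)%N%:Z * \sum_(q < N) `|y q|.
Proof.
apply: le_trans (_ : \sum_(w < n * s) \sum_(c < t) a%:Z * `|y (w %/ s * t + c)%N| <= _).
  apply: ler_sum => w _; apply: le_trans (ler_norm_sum _ _ _) _.
  by apply: ler_sum => c _; rewrite normrM ler_wpM2r.
rewrite (sum_bricks n s (fun w => \sum_(c < t) a%:Z * `|y (w %/ s * t + c)%N|)).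
rewrite (sum_bricks n t (fun q => `|y q|)) mulr_sumr; apply: ler_sum => j _.
under eq_bigr => i _ do rewrite divnMDl // (divn_small (ltn_ord i)) addn0 -mulr_sumr.
by rewrite sumr_const card_ord PoszM -mulr_natl natz mulrA.
Qed.

(** A nonzero even step moves a coordinate by at least [2 g], far outside the box. The box penalty
    then grows by [((r + s) a + 1) |y|_1], while the row residuals shrink by at most
    [(r + s) a |y|_1]. So 0 is strictly better than any other such point. *)
Lemma released_init (g : nat) : (0 < g)%N ->
  2 * \sum_(q < N) (`|l q| + `|u q|) <= g%:Z -> opt g 0 (fun=> 0).
Proof.
move=> g_gt0 g_large z z_even; set y := translate _ g z.
have y_large q : (q < N)%N -> y q = 0 \/ 4 * (`|l q| + `|u q|) <= `|y q|.
  move=> qN; have := z_even q qN; rewrite /y /translate add0r.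
  have : `|l q| + `|u q| <= \sum_(q < N) (`|l q| + `|u q|).
    rewrite (bigD1 (Ordinal qN)) //= lerDl; apply: sumr_ge0 => i _.
    by rewrite addr_ge0.
  move: (\sum_(q < N) _) g_large => bd g_large le_bd.
  have [->|z0] := eqVneq (z q) 0; first by left; rewrite mulr0.
  move=> /dvdzP[v zv]; right; rewrite normrM zv normrM.
  have : 1 <= `|v| by move: z0; rewrite zv; lia.
  by move: (`|v|) => v'; nia.
have row_zero1 i : row1 t A1 N i (fun=> 0) = 0.
  by rewrite /row1 big1 // => q _; rewrite mulr0.
have row_zero2 w : row2 s t A2 w (fun=> 0) = 0.
  by rewrite /row2 big1 // => q _; rewrite mulr0.
set Y := \sum_(q < N) `|y q|.
have growth : energy r s t n A1 A2 b bx (fun=> 0) + Y <= energy r s t n A1 A2 b bx y.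
  rewrite /energy -/N.
  have e1 : \sum_(q < N) bx q 0 + ((r + s) * a + 1)%N%:Z * Y <= \sum_(q < N) bx q (y q).
    rewrite mulr_sumr -big_split /=; apply: ler_sum => q _.
    exact: box_growth (y_large q (ltn_ord q)).
  have e2 : \sum_(i < r) `|row1 t A1 N i (fun=> 0) - b i| <=
      \sum_(i < r) `|row1 t A1 N i y - b i| + \sum_(i < r) `|row1 t A1 N i y|.
    by rewrite -big_split /=; apply: ler_sum => i _; rewrite row_zero1; lia.
  have e3 : \sum_(w < n * s) `|row2 s t A2 w (fun=> 0) - b (r + w)%N| <=
      \sum_(w < n * s) `|row2 s t A2 w y - b (r + w)%N| +
      \sum_(w < n * s) `|row2 s t A2 w y|.
    by rewrite -big_split /=; apply: ler_sum => w _; rewrite row_zero2; lia.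
  have := sum_row1_le y; have := sum_row2_le y; rewrite -/Y => e4 e5.
  move: e1 e2 e3 e4 e5; rewrite mulnDl !PoszD !mulrDl mul1r.
  move: (\sum_(_ < N) _) (\sum_(_ < N) _) => c1 c2.
  move: (\sum_(_ < r) _) (\sum_(_ < r) _) (\sum_(_ < r) _) => c3 c4 c5.
  move: (\sum_(_ < n * s) _) (\sum_(_ < n * s) _) (\sum_(_ < n * s) _) => c6 c7 c8.
  by lia.
have Y_ge0 : 0 <= Y by apply: sumr_ge0.
have [Y0|Y_neq0] := eqVneq Y 0; last first.
  by apply/orP; left; rewrite -/(y) ; lia.
have y0 q : (q < N)%N -> y q = 0.
  move=> qN; have /eqP := Y0; rewrite psumr_eq0 // => /allP /(_ (Ordinal qN)).
  by rewrite mem_index_enum => /(_ isT); rewrite normr_eq0 => /eqP.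
rewrite (@eq_lex_le _ _ _ _ _ _ _ _ _ _ _ _ (fun=> 0) (fun=> 0)) //.
exact: lex_le_refl.
Qed.

(** With variable 9 equal to 0 the evaluator returns the plain energy of the current point, from
    which the penalty for this release is set. *)
Definition release : cmd :=
  Seq (Assign 9 (Cst 0))
  (Seq (eval r s t 5)
  (Seq (Assign 9 (Var 13 + Cst 1)%X)
  (Seq (init_table t)
  (Seq (layers r s t)
       (copy 6 (Cst 0) 5 (Cst 0)))))).

Definition release_time : nat :=
  (2 + (eval_time r s t n + (4 +
    (states t K * (copy_time t n + (brick_time t + copy_time t n) + 10) + 8 +
    (n * (layer_time r s t n K + 9 + 1) + 7 + 1 + copy_time t n)))))%N.

(** Here [x] is any integer vector, the current point of the scaling at step [g]; it need not be a
    vertex of a polyhedron. *)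
Definition at_vertex (g : nat) (x : nat -> int) (st : state) : Prop :=
  [/\ stat st, vars st 7%N = g%:Z & holds_vec t n 5 0 x st].

Lemma energy_no_penalty g k x :
  energy r s t n A1 A2 b (layer_cost bx g k x 0) x = energy r s t n A1 A2 b bx x.
Proof.
by apply: eq_energy_cost => q _; rewrite /layer_cost mul0r mulr0 addr0.
Qed.

Lemma runs_release st g k x : (0 < g)%N -> at_vertex g x st -> vars st 8%N = k%:Z ->
  opt g k x ->
  runs cmp release st release_time (fun st' =>
    exists2 x', at_vertex g x' st' & opt g k.+1 x').
Proof.
move=> g_gt0 [st_ g_ x_] k_ x_opt; rewrite /release /release_time.
apply: (runs_seq (Q1 := fun st1 => vars st1 9 = 0)); first exact: runs_assign.
move=> st1 big0 fr1.
have ctx1 : context t n K M A1 A2 b l u g k 0 x st1.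
  split=> //; first exact: static_framed fr1 isT isT st_.
  - by rewrite (proj1 fr1).
  - by rewrite (proj1 fr1).
  - by move=> q qN; rewrite (proj2 fr1) // x_.
have x1 : holds_vec t n 5 0 x st1 by move=> q qN; rewrite (proj2 fr1) // x_.
apply: runs_seq (runs_eval cmp r_gt0 s_gt0 t_gt0 n_gt0 ctx1 x1) _ => st2 v13 fr2.
rewrite energy_no_penalty in v13.
have ctx2 := context_framed fr2 isT isT ctx1.
set big := energy r s t n A1 A2 b bx x + 1.
apply: (runs_seq (Q1 := fun st3 => vars st3 9 = big)).
  by apply: runs_assign; rewrite /= v13.
move=> st3 big3 fr3.
have ctx3 : context t n K M A1 A2 b l u g k big x st3.
  have [st2_ g2 k2 _ x2] := ctx2; split=> //; first exact: static_framed fr3 isT isT st2_.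
  - by rewrite (proj1 fr3).
  - by rewrite (proj1 fr3).
  - by move=> q qN; rewrite (proj2 fr3) // x2.
apply: runs_seq (runs_init_table f cmp r_gt0 s_gt0 t_gt0 n_gt0 ctx3) _ => st4 tab4 fr4.
have ctx4 := context_framed fr4 isT isT ctx3.
apply: runs_seq (runs_layers r_gt0 s_gt0 t_gt0 n_gt0 cmpE ctx4 tab4) _ => st5 tab5 fr5.
have ctx5 := context_framed fr5 isT isT ctx4.
have tab5' := tab5 0%N (states_gt0 t K).
apply: runs_weaken (leqnn _) _ (runs_framed (runs_copy (off' := 0)
  cmp r_gt0 s_gt0 t_gt0 n_gt0 _ _ _ (context_static ctx5) _ _ tab5')) => //.
move=> st6 [[h5 _] fr6]; exists (table r s t n A1 A2 b f bx g k K x big n 0).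
  split=> //; first exact: static_framed fr6 isT isT (context_static ctx5).
  by rewrite (proj1 fr6) // (context_g ctx5).
have bx_convex q : (q < N)%N -> convex_at (bx q) by move=> _; apply: box_convex.
have := released_step r_gt0 s_gt0 t_gt0 a_gt0 A1_le A2_le f_convex bx_convex (box_ge0 M l u) n_gt0 g_gt0 K_large (erefl big) x_opt.
by [].
Qed.

Definition phase : cmd := For 8 (Var 2) release.

Definition phase_time : nat := (N * (release_time + 9 + 1) + 7 + 1)%N.

Lemma at_vertex_framed vs ps st st' g x :
  framed vs ps st st' -> ~~ has (mem vs) [:: 0; 2; 3; 4; 5; 6; 7]%N ->
  ~~ has (mem ps) [:: 0; 1; 2; 3; 4; 5; 10]%N -> at_vertex g x st -> at_vertex g x st'.
Proof.
move=> fr vn pn [st_ g_ x_]; have [fv fp] := fr.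
have /hasPn vn' := vn; have /hasPn pn' := pn; split.
- apply: static_framed fr _ _ st_.
    by apply/hasPn => y; rewrite !inE => yin; apply: vn'; rewrite !inE; lia.
  by apply/hasPn => y; rewrite !inE => yin; apply: pn'; rewrite !inE; lia.
- by rewrite fv //; apply: vn'.
- by move=> q qN; rewrite fp ?x_ //; apply: pn'.
Qed.

Lemma runs_phase st g x : (0 < g)%N -> at_vertex g x st -> opt g 0 x ->
  runs cmp phase st phase_time (fun st' => exists2 x', at_vertex g x' st' & opt g N x').
Proof.
move=> g_gt0 x_ x_opt.
have stable x' st1 v : at_vertex g x' st1 -> at_vertex g x' (set_var 8 v st1).
  exact: at_vertex_framed (framed_set_var 8 v st1) isT isT.
pose Inv m st1 := exists2 x', at_vertex g x' st1 & opt g m x'.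
apply: (@runs_for _ cmp 8%N (Var 2) _ st N release_time Inv) => //.
- by move=> st1 fr /=; case: x_ => st_ _ _; rewrite (proj1 fr) // (static_N st_).
- by exists x => //; apply: stable.
move=> k st1 kN fr v8 [x1 x1_ opt1].
apply: runs_weaken (leqnn _) _ (runs_release g_gt0 x1_ v8 opt1) => st2 [x2 x2_ opt2].
by exists x2 => //; apply: stable.
Qed.

(** At [k = N] the parity condition is empty, and an even [z] at step [g] is the vector [z / 2] at
    step [2 g]. *)
Lemma opt_halve (g : nat) x : opt (2 * g) N x -> opt g 0 x.
Proof.
move=> x_opt z z_even; have vac q : (N <= q < n * t)%N -> (2 %| z q %/ 2)%Z.
  by rewrite leqNgt => /andP[/negP].
have := x_opt (fun q => (z q %/ 2)%Z) vac.
rewrite (@eq_lex_le _ _ _ _ _ _ _ _ _ _ _ _ x (translate x g z)) // => q qN.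
rewrite /translate -[in RHS](divzK (z_even q _)) // PoszM.
by congr (_ + _); ring.
Qed.

Definition scale_loop : cmd :=
  While (Cst 1 <= Var 7)%X (Seq phase (Assign 7 (Var 7 / Cst 2)%X)).

(** The steps are [2^p, ..., 2, 1], hence [p.+1] phases; halving 1 gives 0, which ends the loop. *)
Lemma runs_scale_loop p st x :
  at_vertex (2 ^ p) x st -> opt (2 ^ p) 0 x ->
  runs cmp scale_loop st (p.+1 * (phase_time + 20) + 10)
    (fun st' => exists2 x', at_vertex 0 x' st' & opt 1 N x').
Proof.
elim: p st x => [|p IHp] st x x_ x_opt.
  have [_ g_ _] := x_.
  apply: runs_le (runs_while_true (T1 := phase_time + 4) (T2 := 4)
    (Q1 := fun st1 => exists2 x', at_vertex 0 x' st1 & opt 1 N x') _ _ _).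
  - by rewrite /=; lia.
  - by rewrite /= g_.
  - apply: runs_seq (runs_phase (isT : (0 < 1)%N) x_ x_opt) _ => st1 [x1 [st1_ g1 x1_] opt1] fr1.
    apply: runs_assign; exists x1 => //; split=> //.
      exact: static_framed (framed_set_var 7 _ _) isT isT st1_.
    by rewrite /= g1.
  - move=> st1 [x1 x1_ opt1] _; have [_ g1 _] := x1_.
    by apply: runs_while_false; [rewrite /= g1|exists x1].
have [_ g_ _] := x_; have p2_gt0 : (0 < 2 ^ p.+1)%N by rewrite expn_gt0.
apply: runs_le (runs_while_true (T1 := phase_time + 4)
  (T2 := p.+1 * (phase_time + 20) + 10)
  (Q1 := fun st1 => exists2 x', at_vertex (2 ^ p) x' st1 & opt (2 ^ p) 0 x') _ _ _).
- by rewrite /=; lia.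
- rewrite /= g_; move: p2_gt0; move: (2 ^ _)%N => v; by case: v.
- apply: runs_seq (runs_phase p2_gt0 x_ x_opt) _ => st1 [x1 [st1_ g1 x1_] opt1] fr1.
  apply: runs_assign; exists x1; last by apply: opt_halve; rewrite -expnS.
  split=> //; first exact: static_framed (framed_set_var 7 _ _) isT isT st1_.
  by rewrite /= g1 divz_nat expnS mulKn.
- by move=> st1 [x1 x1_ opt1] _; apply: IHp x1_ opt1.
Qed.

Lemma opt_global x y : opt 1 N x -> lex_le r s t n A1 A2 b f bx x y.
Proof.
move=> x_opt; have vac q : (N <= q < n * t)%N -> (2 %| y q - x q)%Z.
  by rewrite leqNgt => /andP[/negP].
have := x_opt (fun q => y q - x q) vac.
rewrite (@eq_lex_le _ _ _ _ _ _ _ _ _ _ _ _ x y) // => q qN.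
by rewrite /translate mul1r addrC subrK.
Qed.

Definition finish : cmd :=
  Seq (Assign 8 (Cst 0)) (Seq (Assign 9 (Cst 0))
  (Seq (eval r s t 5) (Assign 0 (Var 13 <= Cst 0)%X))).

Lemma runs_finish g st x : at_vertex g x st ->
  runs cmp finish st (8 + eval_time r s t n) (fun st' => holds_vec t n 5 0 x st' /\
    vars st' 0%N = (energy r s t n A1 A2 b bx x <= 0)%R%:Z).
Proof.
move=> x_; apply: runs_le (runs_seq (T1 := 2) (T2 := 2 + (eval_time r s t n + 4))
  (Q1 := fun st1 => at_vertex g x st1 /\ vars st1 8 = 0) _ _).
- by lia.
- by apply: runs_assign; split=> //; apply: at_vertex_framed (framed_set_var 8 _ _) isT isT x_.
move=> st1 [x1_ k1] _.
apply: (runs_seq (Q1 := fun st2 => context t n K M A1 A2 b l u g 0 0 x st2)).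
  apply: runs_assign; have [st1_ g1 h5] := x1_; split=> //.
  exact: static_framed (framed_set_var 9 _ _) isT isT st1_.
move=> st2 ctx _; have h5 : holds_vec t n 5 0 x st2 by exact: context_x ctx.
apply: runs_seq (runs_eval cmp r_gt0 s_gt0 t_gt0 n_gt0 ctx h5) _ => st3 v13 fr3.
apply: runs_assign; rewrite /= v13 energy_no_penalty; split=> //.
exact: holds_vec_framed fr3 isT h5.
Qed.

End Main.

(** * Matrices, objective and input arrays *)

Lemma nth_flatten_uniform (T : Type) (x0 : T) (d i c : nat) (ss : seq (seq T)) :
  all (fun e => size e == d) ss -> (i < size ss)%N -> (c < d)%N ->
  nth x0 (flatten ss) (i * d + c) = nth x0 (nth [::] ss i) c.
Proof.
elim: ss i => [//|e ss IHss] [|i] /= /andP[/eqP se all_d] ilt cd.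
  by rewrite nth_cat se cd.
by rewrite nth_cat se mulSn -addnA ltnNge leq_addr /= addKn IHss.
Qed.

Lemma nth_row_major (m d : nat) (A : 'M[int]_(m, d)) (i : 'I_m) (c : 'I_d) :
  nth 0 (row_major A) (i * d + c) = A i c.
Proof.
rewrite /row_major (@nth_flatten_uniform _ _ d).
- by rewrite (nth_map i) ?size_enum_ord // (nth_map c) ?size_enum_ord // !nth_ord_enum.
- by apply/allP => e /mapP[j _ ->]; rewrite size_map size_enum_ord.
- by rewrite size_map size_enum_ord.
- exact: ltn_ord.
Qed.

Definition entries (m : nat) (v : 'cV[int]_m) (q : nat) : int := nth 0 (row_major v) q.

Lemma entriesE (m : nat) (v : 'cV[int]_m) (i : 'I_m) : entries v i = v i 0.
Proof. by rewrite -(nth_row_major v i 0) muln1 addn0. Qed.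

Definition mx_entry (m d : nat) (A : 'M[int]_(m, d)) (i c : nat) : int :=
  nth 0 (row_major A) (i * d + c).

Lemma mx_entry_le (m d a : nat) (A : 'M[int]_(m, d)) :
  (forall i c, `|A i c| <= a%:Z) -> forall i c, `|mx_entry A i c| <= a%:Z.
Proof.
move=> A_le i c; rewrite /mx_entry; have [lt_size|ge_size] := ltnP (i * d + c) (size (row_major A)).
  have /allpairsP[[j j'] [_ _ ->]] := mem_nth 0 lt_size; exact: A_le.
by rewrite nth_default // normr0.
Qed.

Section Bricks.
Variables (n t : nat).

Lemma sum_columns_card : (\sum_(k < n) t = n * t)%N.
Proof. by rewrite sum_nat_const card_ord. Qed.

Lemma sum_flat (V : nmodType) (F : nat -> V) :
  \sum_(k < \sum_(j < n) t) F k = \sum_(q < n * t) F q.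
Proof. by rewrite -!(big_mkord xpredT F) sum_columns_card. Qed.

(** Relates the numbering of block indices by [tagnat] to the index arithmetic of the program. *)
Lemma flat_index (k : 'I_(\sum_(j < n) t)) :
  nat_of_ord k = (tagnat.sig1 k * t + tagnat.sig2 k)%N.
Proof.
rewrite {1}(tagnat.rect k); congr (_ + _)%N.
by rewrite -big_ord_widen ?sum_nat_const ?card_ord // ltnW.
Qed.

Lemma flat_div (k : 'I_(\sum_(j < n) t)) : (k %/ t)%N = tagnat.sig1 k.
Proof.
have ct := ltn_ord (tagnat.sig2 k); have t_gt0 : (0 < t)%N by apply: leq_trans ct.
by rewrite flat_index divnMDl // divn_small // addn0.
Qed.

Lemma flat_mod (k : 'I_(\sum_(j < n) t)) : (k %% t)%N = tagnat.sig2 k.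
Proof. by rewrite flat_index modnMDl modn_small. Qed.

End Bricks.

Section Nfold.
Variables (r s t n : nat) (A1 : 'M[int]_(r, t)) (A2 : 'M[int]_(s, t)).
Hypotheses (s_gt0 : (0 < s)%N) (t_gt0 : (0 < t)%N).
Implicit Type x : 'cV[int]_(\sum_(k < n) t).

Lemma nfold_row1 x (i : 'I_r) :
  (nfold n A1 A2 *m x) (lshift _ i) 0 = row1 t (mx_entry A1) (n * t) i (entries x).
Proof.
rewrite /nfold mul_col_mx col_mxEu mxE /row1.
rewrite -(sum_flat n t (fun q => mx_entry A1 i (q %% t) * entries x q)).
by apply: eq_bigr => k _; rewrite entriesE flat_mod /mx_entry nth_row_major mxE.
Qed.

Lemma nfold_row2 x (w : 'I_(\sum_(k < n) s)) :
  (nfold n A1 A2 *m x) (rshift _ w) 0 = row2 s t (mx_entry A2) w (entries x).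
Proof.
have wn : (w %/ s < n)%N by rewrite flat_div.
rewrite /nfold mul_col_mx col_mxEd mxE /row2.
transitivity (\sum_(k < \sum_(j < n) t)
    if (k %/ t == w %/ s)%N then mx_entry A2 (w %% s) (k %% t) * entries x k else 0).
  apply: eq_bigr => k _; rewrite mxE !flat_div eq_sym val_eqE.
  case: eqP => _; last by rewrite mxE mul0r.
  by rewrite entriesE !flat_mod /mx_entry nth_row_major.
rewrite (sum_flat n t (fun k => if (k %/ t == w %/ s)%N then
  mx_entry A2 (w %% s) (k %% t) * entries x k else 0)).
rewrite -(big_mkord xpredT (fun k => if (k %/ t == w %/ s)%N then
  mx_entry A2 (w %% s) (k %% t) * entries x k else 0)) -big_mkcond sum_brick //.
by apply: eq_bigr => c _; rewrite modnMDl (modn_small (ltn_ord c)).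
Qed.

Variables (M : nat) (b : 'cV[int]_(r + \sum_(k < n) s)) (l u : 'cV[int]_(\sum_(k < n) t)).

Lemma box_eq0 (l' u' : nat -> int) q z : (0 < M)%N ->
  (box M l' u' q z == 0) = (l' q <= z <= u' q).
Proof.
move=> M_gt0; rewrite /box mulf_eq0 (_ : M%:Z == 0 = false) /=; last by case: M M_gt0.
by rewrite /pos_part; move: (l' q) (u' q) => lq uq; apply/idP/idP => H; nia.
Qed.

Let energy_of x := energy r s t n (mx_entry A1) (mx_entry A2) (entries b)
  (box M (entries l) (entries u)) (entries x).

(** The energy is a sum of nonnegative terms, each vanishing exactly when one bound pair or one
    equation is satisfied. *)
Lemma feasible_energy x : (0 < M)%N ->
  feasible (nfold n A1 A2) b l u x <-> energy_of x <= 0.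
Proof.
move=> M_gt0.
have E1 : 0 <= \sum_(q < n * t) box M (entries l) (entries u) q (entries x q).
  by apply: sumr_ge0 => q _; apply: box_ge0.
have E2 : 0 <= \sum_(i < r) `|row1 t (mx_entry A1) (n * t) i (entries x) - entries b i|.
  by apply: sumr_ge0.
have E3 : 0 <= \sum_(w < n * s)
    `|row2 s t (mx_entry A2) w (entries x) - entries b (r + w)%N|.
  by apply: sumr_ge0.
have -> : (energy_of x <= 0) =
    [&& \sum_(q < n * t) box M (entries l) (entries u) q (entries x q) == 0,
        \sum_(i < r) `|row1 t (mx_entry A1) (n * t) i (entries x) - entries b i| == 0 &
        \sum_(w < n * s)
          `|row2 s t (mx_entry A2) w (entries x) - entries b (r + w)%N| == 0].
  rewrite /energy_of /energy.
  by move: (\sum_(_ < n * t) _) (\sum_(_ < r) _) (\sum_(_ < n * s) _) E1 E2 E3; lia.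
rewrite -(sum_flat n t (fun q => box M (entries l) (entries u) q (entries x q))).
rewrite -(sum_flat n s (fun w => `|row2 s t (mx_entry A2) w (entries x) - entries b (r + w)%N|)).
split=> [[Ax lxu]|/and3P[]].
  apply/and3P; split; apply/eqP; apply: big1 => i _.
  - by apply/eqP; rewrite box_eq0 // !entriesE.
  - by rewrite -nfold_row1 Ax -entriesE subrr normr0.
  - by rewrite -nfold_row2 Ax -entriesE subrr normr0.
rewrite !psumr_eq0 //; last by move=> q _; apply: box_ge0.
move=> /allP H1 /allP H2 /allP H3; split; last first.
  move=> i; have := H1 i; rewrite mem_index_enum => /(_ isT).
  by rewrite /= box_eq0 // !entriesE.
apply/colP => i; case: (split_ordP i) => j ->.
  have := H2 j; rewrite mem_index_enum => /(_ isT) /=.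
  by rewrite normr_eq0 subr_eq0 nfold_row1 -entriesE => /eqP.
have := H3 j; rewrite mem_index_enum => /(_ isT) /=.
by rewrite normr_eq0 subr_eq0 nfold_row2 -entriesE => /eqP.
Qed.

End Nfold.

Section Objective.
Variables (R : realType).

Lemma convex_chord (g : R -> R) (p x y : R) :
  @convex_function R R^o classical_sets.setT g -> 0 <= p <= 1 ->
  g (p * x + (1 - p) * y) <= p * g x + (1 - p) * g y.
Proof.
move=> g_convex /andP[p0 p1].
exact: (g_convex (Itv01 p0 p1) x y (mem_set I) (mem_set I)).
Qed.

(** With [p = h / (w - x)], the inner points are [p w + (1 - p) x] and [p x + (1 - p) w]; the two
    chord inequalities add up to the claim. *)
Lemma convex_at_int (g : R -> R) :
  @convex_function R R^o classical_sets.setT g -> convex_at (fun z : int => g z%:~R).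
Proof.
move=> g_convex x w h hw.
have [h0|h_neq0] := eqVneq h 0; first by rewrite h0 addr0 subr0.
have wx : w - x != 0 by move: hw h_neq0; rewrite /conformal; lia.
pose p : R := h%:~R / (w - x)%:~R.
have p01 : 0 <= p <= 1.
  rewrite /p; move: hw => /orP[] /andP[h_ge h_le].
    have wx_gt0 : 0 < (w - x)%:~R :> R by rewrite ltr0z; lia.
    by rewrite divr_ge0 ?ler0z ?(ltW wx_gt0) //= ?ler_pdivrMr ?mul1r ?ler_int //; lia.
  have wx_lt0 : (w - x)%:~R < 0 :> R by rewrite ltrz0; lia.
  by rewrite mulr_le0 ?lerz0 ?invr_le0 ?(ltW wx_lt0) //= ler_ndivrMr ?mul1r ?ler_int.
have ph : p * (w - x)%:~R = h%:~R by rewrite /p divfK // intr_eq0.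
have -> : (x + h)%:~R = p * w%:~R + (1 - p) * x%:~R :> R.
  by rewrite rmorphD /= -ph rmorphB /=; ring.
have -> : (w - h)%:~R = p * x%:~R + (1 - p) * w%:~R :> R.
  by rewrite rmorphB /= -ph rmorphB /=; ring.
have := convex_chord w%:~R x%:~R g_convex p01.
have := convex_chord x%:~R w%:~R g_convex p01.
lra.
Qed.

End Objective.

(** * Preprocessing: constants, powers and the initial step *)

Fixpoint pow_expr (e : expr) (k : nat) : expr :=
  if k is k'.+1 then (e * pow_expr e k')%X else Cst 1.

Lemma value_pow st e k (v : nat) : value st e = v%:Z -> value st (pow_expr e k) = (v ^ k)%N%:Z.
Proof. by move=> ve; elim: k => //= k ->; rewrite ve expnS PoszM. Qed.

Lemma cost_pow x k : expr_cost (pow_expr (Var x) k) = (2 * k + 1)%N.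
Proof. by elim: k => //= k ->; lia. Qed.

(** If [x < 2^i] and [y < 2^j] then [x + y < 2^(i+j)]. Thus the initial step, chosen above the sum
    of all bounds, still has an exponent linear in the encoding length. *)
Lemma sum_lt_pow (m : nat) (F G : nat -> nat) :
  (forall i, (i < m)%N -> (F i < 2 ^ G i)%N) ->
  (\sum_(i < m) F i < 2 ^ (\sum_(i < m) G i))%N.
Proof.
elim: m => [|m IHm] FG; first by rewrite !big_ord0.
rewrite !big_ord_recr /= expnD.
have := FG m (leqnn _); have := IHm (fun i im => FG i (ltnW im)).
by move: (\sum_(_ < m) F _)%N (2 ^ _)%N (2 ^ _)%N => x y z; nia.
Qed.

Lemma lt_pow_bitlen z : (`|z| < 2 ^ bitlen z)%N.
Proof.
rewrite /bitlen; apply: leq_trans (up_logP `|z|.+1 (isT : (1 < 2)%N)) _.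
by rewrite leq_exp2l.
Qed.

Definition double_loop : cmd :=
  While (Var 7 <= Cst 2 * Var 15)%X (Assign 7 (Var 7 * Cst 2)%X).

Lemma runs_double (D : nat) (cmp : rel 'cV[int]_D) m i st (bd : nat) :
  vars st 7%N = (2 ^ i)%N%:Z -> vars st 15%N = bd%:Z -> (2 * bd < 2 ^ (i + m))%N ->
  runs cmp double_loop st (m * 10 + 6) (fun st' => exists p,
    [/\ vars st' 7%N = (2 ^ p)%N%:Z, (2 * bd < 2 ^ p)%N & (p <= i + m)%N]).
Proof.
elim: m i st => [|m IHm] i st v7 v15 lt_bd.
  rewrite addn0 in lt_bd *; apply: runs_while_false; last by exists i.
  by rewrite /= v7 v15; move: (2 ^ i)%N lt_bd => g; lia.
have [le_g|lt_g] := leqP (2 ^ i) (2 * bd); last first.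
  apply: runs_le (runs_while_false _ _ _ _); first by rewrite /=; lia.
    by rewrite /= v7 v15; move: (2 ^ i)%N lt_g => g; lia.
  by exists i; rewrite leq_addr.
apply: runs_le (runs_while_true (T1 := 4) (T2 := m * 10 + 6)
  (Q1 := fun st1 => vars st1 7 = (2 ^ i.+1)%N%:Z /\ vars st1 15 = bd%:Z) _ _ _).
- by rewrite /=; lia.
- by rewrite /= v7 v15; move: (2 ^ i)%N le_g => g; lia.
- by apply: runs_assign; rewrite /= v7 v15 expnSr PoszM.
move=> st1 [v7' v15'] _; rewrite -[(i + m.+1)%N]addSnnS; apply: IHm => //.
by rewrite addSnnS.
Qed.

Section Setup.
Variables (r s t c0 e : nat).

(** Whatever depends on [r], [s], [t] alone, including the unrolled powers, is a constant of the
    program; [n], [a] and the bounds are read from the input. *)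
Definition setup : cmd :=
  Seq (Assign 2 (Var 0 * Cst t%:Z)%X)
  (Seq (Assign 3 (Cst c0%:Z * pow_expr (Var 1) e)%X)
  (Seq (Assign 4 (Cst 2 * Var 3 + Cst 1)%X)
  (Seq (Assign 5 (pow_expr (Var 4) t))
  (Seq (Assign 6 (Cst 2 * (Cst (r + s)%N%:Z * Var 1 + Cst 1))%X)
  (Seq (Assign 15 (Cst 1))
  (Seq (For 16 (Cst t%:Z)
         (Seq (Put 10 (Var 16) (Var 15)) (Assign 15 (Var 15 * Var 4)%X)))
  (Seq (Assign 15 (Cst 0))
  (Seq (For 14 (Var 2) (Assign 15
         (Var 15 + (abs_expr (Get 3 (Var 14)) + abs_expr (Get 4 (Var 14))))%X))
  (Seq (Assign 7 (Cst 1)) double_loop))))))))).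

Variables (n a : nat) (A1 : 'M[int]_(r, t)) (A2 : 'M[int]_(s, t)).
Variables (b : 'cV[int]_(r + \sum_(k < n) s)) (l u : 'cV[int]_(\sum_(k < n) t)).

Let K := (c0 * a ^ e)%N.
Let M := (2 * ((r + s) * a + 1))%N.
Let bd := (\sum_(q < n * t) (`|entries l q| + `|entries u q|))%N.
Let width := (vec_bitlen l + vec_bitlen u)%N.

Lemma bd_lt : (bd < 2 ^ width)%N.
Proof.
rewrite /bd /width /vec_bitlen big_split.
have part (v : 'cV[int]_(\sum_(k < n) t)) :
    (\sum_(q < n * t) `|entries v q| < 2 ^ (\sum_i bitlen (v i 0%R)))%N.
  have -> : (\sum_i bitlen (v i 0%R) = \sum_(q < n * t) bitlen (entries v q))%N.
    rewrite -(sum_flat n t (fun q => bitlen (entries v q))).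
    by apply: eq_bigr => i _; rewrite entriesE.
  apply: (sum_lt_pow (F := fun q => `|entries v q|%N)
    (G := fun q => bitlen (entries v q))) => q _; exact: lt_pow_bitlen.
have := part l; have := part u; rewrite expnD /=.
move: (\sum_(q < n * t) _)%N (\sum_(q < n * t) _)%N => x y.
by move: (2 ^ _)%N (2 ^ _)%N => z w; nia.
Qed.

Definition setup_time : nat :=
  (4 + (2 * e + 4 + (6 + (2 * t + 2 + (8 + (2 + (t * 17 + 8 + (2 +
   (n * t * 70 + 8 + (2 + ((width + 1) * 10 + 6)))))))))))%N.

Lemma runs_setup (D : nat) (cmp : rel 'cV[int]_D) :
  runs cmp setup (init_state a A1 A2 b l u) setup_time (fun st => exists p,
    [/\ at_vertex r s t n K a (mx_entry A1) (mx_entry A2) (entries b)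
          (entries l) (entries u) (2 ^ p) (fun=> 0) st,
        (2 * bd <= 2 ^ p)%N & (p <= width + 1)%N]).
Proof.
set st0 := init_state a A1 A2 b l u; rewrite /setup /setup_time.
apply: (runs_seq (Q1 := fun st => vars st 2 = (n * t)%N%:Z)).
  by apply: runs_assign; rewrite /= PoszM.
move=> st1 v2 fr1; apply: (runs_seq (Q1 := fun st => vars st 3 = K%:Z)).
  apply: runs_le (runs_assign _ _); first by rewrite /= cost_pow; lia.
  rewrite /= (value_pow e (v := a)) ?PoszM //.
  by rewrite /= (proj1 fr1).
move=> st2 v3 fr2; apply: (runs_seq (Q1 := fun st => vars st 4 = (2 * K).+1%:Z)).
  by apply: runs_assign; rewrite /= v3; lia.
move=> st3 v4 fr3; apply: (runs_seq (Q1 := fun st => vars st 5 = (states t K)%:Z)).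
  apply: runs_le (runs_assign _ _); first by rewrite /= cost_pow; lia.
  by rewrite /= (@value_pow st3 (Var 4) t _ v4).
move=> st4 v5 fr4; apply: (runs_seq (Q1 := fun st => vars st 6 = M%:Z)).
  apply: runs_assign; rewrite /= (proj1 fr4) // (proj1 fr3) // (proj1 fr2) //.
  rewrite (proj1 fr1) //= /M; lia.
move=> st5 v6 fr5; apply: (runs_seq (Q1 := fun st => vars st 15 = 1)).
  exact: runs_assign.
move=> st6 v15 fr6.
have v4' : vars st6 4 = (2 * K).+1%:Z by rewrite (proj1 fr6) // (proj1 fr5) // (proj1 fr4).
pose powers m (st : state) := vars st 15 = ((2 * K).+1 ^ m)%N%:Z /\
  forall c, (c < m)%N -> arrs st 10%N c%:Z = ((2 * K).+1 ^ c)%N%:Z.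
apply: (runs_seq (Q1 := powers t)).
  apply: runs_le (@runs_for _ cmp 16%N (Cst t%:Z) _ st6 t 7 powers _ _ _ _) => //=.
  - by rewrite /expr_cost; lia.
  - move=> m st7 mt fr v16 [v15' pw].
    apply: (runs_seq (T1 := 3) (Q1 := fun st => vars st 15 = ((2 * K).+1 ^ m)%N%:Z /\
      forall c, (c < m.+1)%N -> arrs st 10%N c%:Z = ((2 * K).+1 ^ c)%N%:Z)).
      apply: runs_put; split=> // c; rewrite ltnS leq_eqVlt /= v16 eqz_nat.
      by have [-> _|_ /= /pw] := eqVneq c m.
    move=> st8 [v15'' pw'] fr8; apply: runs_assign; split=> //=.
    by rewrite v15'' (proj1 fr8) // (proj1 fr) // v4' expnSr PoszM.
move=> st7 [_ pw] fr7; apply: (runs_seq (Q1 := fun st => vars st 15 = 0)).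
  exact: runs_assign.
move=> st8 v15' fr8.
have v2' : vars st8 2 = (n * t)%N%:Z.
  rewrite (proj1 fr8) // (proj1 fr7) // (proj1 fr6) // (proj1 fr5) // (proj1 fr4) //.
  by rewrite (proj1 fr3) // (proj1 fr2).
have arr_lu p : (p < 6)%N -> arrs st8 p = arrs st0 p.
  case: p => [|[|[|[|[|[|p]]]]]] // _;
  rewrite (proj2 fr8) // (proj2 fr7) // (proj2 fr6) // (proj2 fr5) // (proj2 fr4) //;
  by rewrite (proj2 fr3) // (proj2 fr2) // (proj2 fr1).
pose sums m (st : state) := vars st 15 =
  (\sum_(q < m) (`|entries l q| + `|entries u q|))%N%:Z.
apply: (runs_seq (Q1 := sums (n * t)%N)).
  apply: runs_le (@runs_for _ cmp 14%N (Var 2) _ st8 (n * t) 55 sums _ _ _ _) => //=.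
  - by lia.
  - by move=> st9 fr /=; rewrite (proj1 fr).
  - by rewrite /sums big_ord0.
  move=> m st9 mN fr v14 inv; apply: runs_le (runs_assign _ _); first by [].
  rewrite /sums big_ord_recr PoszD -inv /= !abs_pos_part v14.
  by rewrite !(proj2 fr) // !arr_lu.
move=> st9 v15'' fr9; apply: (runs_seq (Q1 := fun st => vars st 7 = 1)).
  exact: runs_assign.
move=> st10 v7 fr10.
have v15_10 : vars st10 15 = bd%:Z by rewrite (proj1 fr10).
have bd_small : (2 * bd < 2 ^ (0 + (width + 1)))%N.
  by rewrite add0n addn1 expnS ltn_pmul2l // bd_lt.
apply: runs_weaken (leqnn _) _ (runs_framed (runs_double cmp (i := 0) v7 v15_10 bd_small)).
move=> st11 [[p [v7' le_bd le_p]] fr11]; exists p; split=> //; last exact: ltnW.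
have arr_in q : (q < 6)%N -> arrs st11 q = arrs st0 q.
  by move=> q6; rewrite (proj2 fr11) // (proj2 fr10) // (proj2 fr9) // arr_lu.
have keep x : x \notin [:: 7; 14; 15; 16]%N -> vars st11 x = vars st6 x.
  rewrite !inE !negb_or => /and4P[x7 x14 x15 x16].
  rewrite (proj1 fr11) ?inE // (proj1 fr10) ?inE // (proj1 fr9) ?inE ?negb_or ?x14 ?x15 //.
  rewrite (proj1 fr8) ?inE // (proj1 fr7) // !inE ?negb_or.
  by rewrite x15 x16.
split=> //; last by move=> q qN; rewrite add0n arr_in // /st0 /= nth_nil.
- split=> [||||||i c|i c|i|q|q|c ct]; last first.
    by rewrite (proj2 fr11) // (proj2 fr10) // (proj2 fr9) // (proj2 fr8) // pw.
  all: rewrite ?keep // ?arr_in //.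
  - by rewrite (proj1 fr6).
  - by rewrite (proj1 fr6) // (proj1 fr5).
  - by rewrite (proj1 fr6) // (proj1 fr5) // (proj1 fr4) // (proj1 fr3).
  - by rewrite (proj1 fr6) // (proj1 fr5) // (proj1 fr4) // (proj1 fr3) // (proj1 fr2).
  - rewrite (proj1 fr6) // (proj1 fr5) // (proj1 fr4) // (proj1 fr3) // (proj1 fr2) //.
    by rewrite (proj1 fr1).
Qed.

End Setup.

(** * Running time *)

Section Costs.
Variables (r s t : nat).

(** Uses [2 d B + 1 <= 3 d q]. *)
Lemma block_size_le (d B q : nat) : (0 < d)%N -> (0 < q)%N -> (B <= q)%N ->
  (block_size d B <= ((3 * d) ^ d + d) * q ^ d)%N.
Proof.
move=> d_gt0 q_gt0 Bq; rewrite mulnDl -expnMn leq_add //.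
  by rewrite leq_exp2r //; nia.
by rewrite leq_pmulr // expn_gt0 q_gt0.
Qed.

Definition inner_const : nat := (((3 * s) ^ s + s) * 2 ^ s)%N.
Definition split_const : nat :=
  (2 * (((3 * r) ^ r + r) * (inner_const * 2) ^ r * inner_const))%N.

(** A block inside a brick has size [O(a^s)], so its sum in the shared rows is [O(a^(s+1))].
    Grouping in dimension [r] costs [O(a^(r(s+1)))] blocks, and the product has exponent
    [r(s+1) + s]. *)
Lemma split_bound_le a : (0 < r)%N -> (0 < s)%N -> (0 < a)%N ->
  (split_bound r s a <= split_const * a ^ (r * s + r + s))%N.
Proof.
move=> r_gt0 s_gt0 a_gt0; rewrite /split_bound /nfold_size /split_const -mulnA leq_mul2l /=.
have inner : (block_size s (2 * a) <= inner_const * a ^ s)%N.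
  by rewrite /inner_const -mulnA -expnMn; apply: block_size_le; rewrite ?muln_gt0.
have c_gt0 : (0 < inner_const)%N by rewrite /inner_const muln_gt0 addn_gt0 s_gt0 orbT expn_gt0.
have q_gt0 : (0 < inner_const * 2 * a ^ s.+1)%N by rewrite 2!muln_gt0 c_gt0 expn_gt0 a_gt0.
have outer : (block_size r (block_size s (2 * a) * (2 * a)) <=
    ((3 * r) ^ r + r) * (inner_const * 2 * a ^ s.+1) ^ r)%N.
  apply: block_size_le => //; apply: leq_trans (leq_mul inner (leqnn _)) _.
  by rewrite expnSr; apply/eq_leq; ring.
apply: leq_trans (leq_mul outer inner) _; apply/eq_leq.
rewrite [((_ * a ^ s.+1) ^ r)%N]expnMn -expnM (_ : r * s + r + s = s.+1 * r + s)%N; last by ring.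
by rewrite expnD; ring.
Qed.

Section Bounds.
Variables (n K : nat).
Hypothesis n_gt0 : (0 < n)%N.
Let S := states t K.
Let S_gt0 : (0 < S)%N := states_gt0 t K.

Definition eval_const : nat := (32 + t * 100 + r * (t * 40 + 60) + s * (t * 40 + 60))%N.

Lemma eval_time_le : (eval_time r s t n <= eval_const * n)%N.
Proof.
have rn : (r <= r * n)%N by rewrite leq_pmulr.
rewrite /eval_time /eval_const; nia.
Qed.

Lemma copy_time_le : (copy_time t n <= (t * 40 + 10) * n)%N.
Proof. by rewrite /copy_time; nia. Qed.

Lemma brick_time_le : (brick_time t <= (t * 80 + 10) * n)%N.
Proof. by rewrite /brick_time leq_pmulr. Qed.

Definition state_const : nat := (3 * eval_const + t * 500 + 500)%N.

Lemma state_time_le : (state_time r s t n K <= state_const * (n * S))%N.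
Proof.
have eval_le := eval_time_le; have copy_le := copy_time_le; have brick_le := brick_time_le.
have improve_le : (improve_time r s t n + 10 <= (eval_const + t * 200 + 61) * n)%N.
  by rewrite /improve_time /build_time; nia.
have loop_le : (S * (improve_time r s t n + 9 + 1) <=
    (eval_const + t * 200 + 61) * (n * S))%N.
  rewrite -[(_ + 9 + 1)%N]addnA; apply: leq_trans (leq_mul (leqnn S) improve_le) _.
  by apply/eq_leq; ring.
have nS : (n <= n * S)%N by rewrite leq_pmulr.
rewrite /state_time -/S; move: (S * _)%N (n * S)%N loop_le nS => x y loop_le nS.
rewrite /build_time /state_const; nia.
Qed.

Definition release_const : nat := (2 * state_const + eval_const + t * 500 + 500)%N.

(** There are [n] layers with [S] states each, and every state compares [S] candidates in time
    [O(n)] each. *)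
Lemma release_time_le :
  (release_time r s t n K <= release_const * (n * n * (S * S)))%N.
Proof.
have eval_le := eval_time_le; have copy_le := copy_time_le; have brick_le := brick_time_le.
have S1 : (S <= S * S)%N by rewrite leq_pmulr.
have SS_gt0 : (0 < S * S)%N by rewrite muln_gt0 S_gt0.
have n_le : (n <= n * (S * S))%N by rewrite leq_pmulr.
have nS_le : (n * S <= n * (S * S))%N by rewrite leq_mul2l S1 orbT.
have nn_le : (n * (S * S) <= n * n * (S * S))%N.
  by rewrite leq_mul2r leq_pmulr // orbT.
have state_le : (S * (state_time r s t n K + 9 + 1) <=
    (state_const + 10) * (n * (S * S)))%N.
  rewrite -[(_ + 9 + 1)%N]addnA mulnDr.
  apply: leq_trans (leq_add (leq_mul (leqnn S) state_time_le) (leqnn _)) _.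
  rewrite (_ : S * (state_const * (n * S)) = state_const * (n * (S * S)))%N; last by ring.
  by rewrite mulnDl leq_add2l mulnC leq_mul2l (leq_trans S1) ?orbT // leq_pmull.
have tab_le : (S * (copy_time t n + 9 + 1) <= (t * 40 + 20) * (n * (S * S)))%N.
  apply: leq_trans (_ : S * ((t * 40 + 20) * n) <= _)%N.
    by rewrite leq_mul2l; apply/orP; right; lia.
  rewrite (_ : S * ((t * 40 + 20) * n) = (t * 40 + 20) * (n * S))%N; last by ring.
  by rewrite leq_mul2l nS_le orbT.
have layer_le : (layer_time r s t n K <= (state_const + t * 40 + 50) * (n * (S * S)))%N.
  rewrite /layer_time -/S; move: (S * (state_time _ _ _ _ _ + 9 + 1))%N
    (S * (copy_time _ _ + 9 + 1))%N (n * (S * S))%N state_le tab_le n_le => x y z.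
  by move=> xz yz nz; nia.
have layers_le : (n * (layer_time r s t n K + 9 + 1) <=
    (state_const + t * 40 + 60) * (n * n * (S * S)))%N.
  apply: leq_trans (_ : n * ((state_const + t * 40 + 60) * (n * (S * S))) <= _)%N.
    rewrite leq_mul2l; apply/orP; right; move: (n * (S * S))%N n_le layer_le => z.
    by move=> nz; nia.
  by apply/eq_leq; ring.
have init_le : (S * (copy_time t n + (brick_time t + copy_time t n) + 10) <=
    (t * 160 + 40) * (n * n * (S * S)))%N.
  apply: leq_trans (_ : S * ((t * 160 + 40) * n) <= _)%N.
    by rewrite leq_mul2l; apply/orP; right; lia.
  rewrite (_ : S * ((t * 160 + 40) * n) = (t * 160 + 40) * (n * S))%N; last by ring.
  by rewrite leq_mul2l (leq_trans nS_le nn_le) orbT.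
rewrite /release_time -/S; move: (leq_trans n_le nn_le) layers_le init_le.
set x := (n * (layer_time _ _ _ _ _ + 9 + 1))%N.
set y := (S * (copy_time _ _ + _ + 10))%N; set z := (n * n * (S * S))%N.
move: x y z => x y z nz xz yz.
have eval_z := leq_trans eval_le (leq_mul (leqnn eval_const) nz).
have copy_z := leq_trans copy_le (leq_mul (leqnn (t * 40 + 10)%N) nz).
rewrite /release_const; move: eval_z copy_z.
have tz := leq0n (t * z); have sz := leq0n (state_const * z).
by move: (eval_time _ _ _ _) (copy_time _ _) => E C; lia.
Qed.

Definition phase_const : nat := (t * (release_const + 10) + 8)%N.

Lemma phase_time_le :
  (phase_time r s t n K <= phase_const * (n ^ 3 * (S * S)))%N.
Proof.
have SS_gt0 : (0 < S * S)%N by rewrite muln_gt0 S_gt0.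
have X_gt0 : (0 < n * n * (S * S))%N by rewrite !muln_gt0 n_gt0 S_gt0.
rewrite /phase_time (_ : n ^ 3 = n * n * n)%N; last by rewrite !expnS expn0; ring.
apply: leq_trans (_ : n * t * ((release_const + 10) * (n * n * (S * S))) + 8 <= _)%N.
  rewrite -addnA leq_add2r leq_mul2l; apply/orP; right.
  by move: release_time_le; move: (n * n * (S * S))%N X_gt0 => z z_gt0; nia.
rewrite (_ : n * n * n * (S * S) = n * (n * n * (S * S)))%N; last by ring.
move: (n * n * (S * S))%N X_gt0 => z z_gt0; rewrite /phase_const.
have : (0 < n * z)%N by rewrite muln_gt0 n_gt0.
rewrite (_ : n * t * ((release_const + 10) * z) = t * (release_const + 10) * (n * z))%N; last by ring.
by move: (n * z)%N => w; nia.
Qed.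

End Bounds.

Lemma states_sq_le a e K : (0 < t)%N -> (0 < K)%N -> (K <= split_const * a ^ e)%N ->
  (states t K * states t K <= (3 * split_const) ^ (2 * t) * a ^ (2 * t * e))%N.
Proof.
move=> t_gt0 K_gt0 K_le; rewrite /states -expnD addnn -mul2n.
apply: leq_trans (_ : (3 * (split_const * a ^ e)) ^ (2 * t) <= _)%N.
  by rewrite leq_exp2r ?muln_gt0 //; lia.
by rewrite mulnA expnMn -expnM [(e * _)%N]mulnC.
Qed.

Definition total_const : nat :=
  (2 * phase_const + eval_const + 2 * (r * s + r + s) + t * 100 + 200)%N.

(** The number [p.+1] of phases is at most [2 L]; setup and final test are of lower order. *)
Lemma total_time_le (n a p K : nat) (b : 'cV[int]_(r + \sum_(k < n) s))
    (l u : 'cV[int]_(\sum_(k < n) t)) :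
  (0 < n)%N -> (p <= vec_bitlen l + vec_bitlen u + 1)%N ->
  (setup_time (r * s + r + s)%N l u +
     (p.+1 * (phase_time r s t n K + 20) + 10 + (8 + eval_time r s t n)) <=
   total_const * (n ^ 3 * (states t K * states t K) * input_bitlen a b l u))%N.
Proof.
move=> n_gt0 p_le; rewrite /setup_time /input_bitlen.
have bit_gt0 : (0 < bitlen a%:Z)%N by [].
set L := (bitlen _ + _ + _ + _)%N; set w := (vec_bitlen l + vec_bitlen u)%N in p_le *.
have L_gt0 : (0 < L)%N by rewrite /L; lia.
have w_le : (w + 1 <= L)%N by rewrite /w /L; lia.
have SS_gt0 : (0 < states t K * states t K)%N by rewrite muln_gt0 states_gt0.
set X := (n ^ 3 * _)%N; have X_gt0 : (0 < X)%N by rewrite muln_gt0 expn_gt0 n_gt0.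
have n_X : (n <= X)%N.
  rewrite /X (_ : n ^ 3 = n * (n * n))%N; last by rewrite !expnS expn0; ring.
  by rewrite -mulnA leq_pmulr // !muln_gt0 n_gt0 states_gt0.
have XL : (X <= X * L)%N by rewrite leq_pmulr.
have LX : (L <= X * L)%N by rewrite leq_pmull.
have phase_le : (p.+1 * (phase_time r s t n K + 20) <=
    2 * (phase_const + 20) * (X * L))%N.
  apply: leq_trans (_ : 2 * L * ((phase_const + 20) * X) <= _)%N.
    apply: leq_mul; first by lia.
    have := phase_time_le K n_gt0; rewrite -/X; move: X_gt0; clear; nia.
  by apply/eq_leq; ring.
have eval_le : (eval_time r s t n <= eval_const * (X * L))%N.
  apply: leq_trans (eval_time_le K n_gt0) _.
  by rewrite leq_mul2l (leq_trans n_X XL) orbT.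
have nt_le : (n * t * 70 <= t * 70 * (X * L))%N.
  rewrite (_ : n * t * 70 = t * 70 * n)%N; last by ring.
  by rewrite leq_mul2l (leq_trans n_X XL) orbT.
have t_le : (t <= t * (X * L))%N by rewrite leq_pmulr // muln_gt0 X_gt0.
have e_le : (r * s + r + s <= (r * s + r + s) * (X * L))%N.
  by rewrite leq_pmulr // muln_gt0 X_gt0.
have XL_gt0 : (0 < X * L)%N by rewrite muln_gt0 X_gt0.
rewrite /total_const; move: phase_le eval_le nt_le t_le e_le XL_gt0 LX.
move: (r * s + r + s)%N (X * L)%N (p.+1 * _)%N (n * t * 70)%N w_le => e z x y w_le.
by move: (eval_time _ _ _ _) => E; clear -w_le; lia.
Qed.

End Costs.

Theorem theorem7 (r s t : nat) (r_gt0 : (0 < r)%N) (s_gt0 : (0 < s)%N)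
    (t_gt0 : (0 < t)%N) :
  exists (p : cmd) (C : nat),
    forall (R : realType) (n a : nat)
      (A1 : 'M[int]_(r, t)) (A2 : 'M[int]_(s, t))
      (b : 'cV[int]_(r + \sum_(k < n) s)) (l u : 'cV[int]_(\sum_(k < n) t))
      (f : 'cV[R]_(\sum_(k < n) t) -> R),
      (0 < n)%N -> (0 < a)%N ->
      (forall i j, `|A1 i j| <= a%:Z) ->
      (forall i j, `|A2 i j| <= a%:Z) ->
      separable_convex f ->
      exists (T : nat) (st : state),
        [/\ exec (comparison_oracle f) p (init_state a A1 A2 b l u) T st,
            solves (nfold n A1 A2) b l u f st
          & (T <= C * (a ^ (3 * t * (r * s + s * t + r + s)) * n ^ 3
                       * input_bitlen a b l u))%N].
Proof.
set e := (r * s + r + s)%N; set c0 := split_const r s.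
exists (Seq (setup r s t c0 e) (Seq (scale_loop r s t) (finish r s t))).
(* The second factor is the part of [(2K+1)^(2t)] free of [a], from [K = c0 * a ^ e] and
   [2K+1 <= 3K]. *)
exists (total_const r s t * (3 * c0) ^ (2 * t))%N.
move=> R n a A1 A2 b l u f n_gt0 a_gt0 A1_le A2_le [g [g_convex fE]].
have A1e_le := mx_entry_le A1_le; have A2e_le := mx_entry_le A2_le.
pose D := (\sum_(k < n) t)%N; pose K := (c0 * a ^ e)%N.
have K_large : (split_bound r s a <= K)%N by apply: split_bound_le.
have c0_gt0 : (0 < c0)%N.
  have s_pos : (0 < inner_const s)%N.
    by rewrite /inner_const muln_gt0 addn_gt0 s_gt0 orbT expn_gt0.
  by rewrite /c0 /split_const 3!muln_gt0 s_pos addn_gt0 r_gt0 orbT expn_gt0 muln_gt0 s_pos.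
have K_gt0 : (0 < K)%N by rewrite muln_gt0 c0_gt0 expn_gt0 a_gt0.
(* The default 0 is harmless, since [total] reads only the coordinates below [n t]. *)
pose h (q : nat) (z : int) : R := if (insub q : option 'I_D) is Some i then g i z%:~R else 0.
have hE (i : 'I_D) z : h i z = g i z%:~R by rewrite /h valK.
have h_convex q : (q < n * t)%N -> convex_at (h q).
  rewrite -sum_columns_card => qD; have := convex_at_int (g_convex (Ordinal qD)).
  by move=> conv x w d dw; rewrite !(hE (Ordinal qD)); apply: conv.
have total_at (x : 'cV[int]_D) y : (forall i : 'I_D, x i 0 = y (nat_of_ord i)) ->
    at_point f x = total t n h y.
  move=> xy; rewrite /at_point fE /total -(sum_flat n t (fun q => h q (y q))).
  by apply: eq_bigr => i _; rewrite hE mxE xy.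
have vecE st p y : holds_vec t n p 0 y st -> forall i : 'I_D,
    vec_of D st p i 0 = y (nat_of_ord i).
  by move=> hy i; rewrite mxE -[RHS]hy ?add0n // -sum_columns_card.
have cmpE st p q y z : holds_vec t n p 0 y st -> holds_vec t n q 0 z st ->
    comparison_oracle f (vec_of D st p) (vec_of D st q) =
    (total t n h y <= total t n h z).
  move=> hy hz; rewrite /comparison_oracle.
  by rewrite (total_at _ _ (vecE _ _ _ hy)) (total_at _ _ (vecE _ _ _ hz)).
set cmp := comparison_oracle f in cmpE *.
have [T1 [st1 [exec1 T1_le [p [vertex1 p_large p_le]]]]] := runs_setup c0 e a A1 A2 b l u cmp.
have p_gt0 : (0 < 2 ^ p)%N by rewrite expn_gt0.
have opt1 : released r s t n (mx_entry A1) (mx_entry A2) (entries b) h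
    (box (2 * ((r + s) * a + 1)) (entries l) (entries u)) (2 ^ p) 0 (fun=> 0).
  apply: released_init => //.
  have -> : \sum_(q < n * t) (`|entries l q| + `|entries u q|) =
      (\sum_(q < n * t) (`|entries l q| + `|entries u q|)%N)%N%:Z.
    by elim/big_rec2: _ => // q x y _ ->; rewrite PoszD.
  by rewrite -PoszM lez_nat.
have [T2 [st2 [exec2 T2_le [x vertex2 opt2]]]] := runs_scale_loop
  r_gt0 s_gt0 t_gt0 n_gt0 a_gt0 A1e_le A2e_le K_large h_convex cmpE vertex1 opt1.
have [T3 [st3 [exec3 T3_le [x3 flag]]]] := runs_finish
  r_gt0 s_gt0 t_gt0 n_gt0 a_gt0 K_large cmp vertex2.
exists (T1 + (T2 + T3))%N, st3; split.
- exact: ExecSeq exec1 (ExecSeq exec2 exec3).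
- pose M := (2 * ((r + s) * a + 1))%N; have M_gt0 : (0 < M)%N by rewrite /M; lia.
  have feasE := feasible_energy A1 A2 s_gt0 t_gt0 b l u _ M_gt0.
  have least (y : 'cV[int]_D) := opt_global (entries y) opt2.
  (* Feasible points are those of energy at most 0. A minimal energy above 0 excludes them all;
     otherwise the energies of [x] and of a feasible [y] are equal, and the lexicographic order
     compares them by [f]. *)
  have [x_feas|x_infeas] := lerP (energy r s t n (mx_entry A1) (mx_entry A2)
    (entries b) (box M (entries l) (entries u)) x) 0; last first.
    right; split=> [|y /feasE y_feas]; first by rewrite flag leNgt x_infeas.
    have /orP[lt_y|/andP[/eqP eq_y _]] := least y.
      by have := lt_le_trans (lt_trans x_infeas lt_y) y_feas; rewrite ltxx.
    by move: x_infeas; rewrite eq_y => /lt_le_trans /(_ y_feas); rewrite ltxx.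
  left; split; first by rewrite flag x_feas.
  have x3E q : (q < n * t)%N -> entries (vec_of D st3 5) q = x q.
    rewrite -sum_columns_card => qD.
    exact: etrans (entriesE _ (Ordinal qD)) (vecE _ _ _ x3 (Ordinal qD)).
  split=> [|y /feasE y_feas].
    by apply/feasE; rewrite (eq_energy _ _ _ _ _ _ x3E).
  rewrite (total_at _ x (vecE _ _ _ x3)).
  rewrite (total_at y (entries y)) => [|i]; last by rewrite entriesE.
  have /orP[lt_y|/andP[_ //]] := least y.
  have := energy_ge0 r s t n (mx_entry A1) (mx_entry A2) (entries b)
    (box_ge0 M (entries l) (entries u)) x.
  by move=> /le_lt_trans /(_ (lt_le_trans lt_y y_feas)); rewrite ltxx.
- apply: leq_trans (leq_add T1_le (leq_add T2_le T3_le)) _.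
  apply: leq_trans (total_time_le a K b n_gt0 p_le) _.
  rewrite -[leqRHS]mulnA leq_mul2l; apply/orP; right.
  rewrite [leqRHS]mulnA leq_mul2r; apply/orP; right.
  apply: leq_trans (_ : n ^ 3 * ((3 * c0) ^ (2 * t) * a ^ (2 * t * e)) <= _)%N.
    rewrite leq_mul2l; apply/orP; right.
    exact: states_sq_le t_gt0 K_gt0 (leqnn _).
  rewrite mulnC [leqRHS]mulnA leq_mul2r; apply/orP; right.
  rewrite leq_mul2l; apply/orP; right; apply: leq_pexp2l => //.
  (* The exponent obtained is [2t(rs+r+s)], at most [3t(rs+st+r+s)]. *)
  by rewrite /e; nia.
Qed.
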